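(* Let $\mathcal{C}$ be an essentially small triangulated category and let $\mathcal{A}\subset\mathcal{C}$ be the heart of a bounded $t$-structure such that $\mathcal{A}$, and every heart obtained from $\mathcal{A}$ by a finite sequence of simple tilts, has finite length and finitely many simple objects (up to isomorphism). Let $s_1,\ldots,s_k$ be distinct simple objects of $\mathcal{A}$, and suppose $\mathcal{T}\subset\langle s_1,\ldots,s_k\rangle$ is a torsion theory in $\mathcal{A}$ containing only finitely many (isomorphism classes of) indecomposables. Then $$S_{\{s_1,\ldots,s_k\}}\subset U(\mathcal{A})\cap\overline{U(L_{\mathcal{T}}\mathcal{A})},$$ and in particular $\dim_{\mathbb{R}} U(\mathcal{A})\cap\overline{U(L_{\mathcal{T}}\mathcal{A})}\geq k$.
   Context: Subcategories are strict and full. $\langle S\rangle$ denotes the extension-closed subcategory generated by $S$. A $t$-structure on $\mathcal{C}$ is a subcategory $\mathcal{D}$ with $\mathcal{D}[1]\subset\mathcal{D}$ such that every $c\in\mathcal{C}$ fits in an exact triangle $d\to c\to d'\to d[1]$ with $d\in\mathcal{D}$, $d'\in\mathcal{D}^\perp=\{c : \mathrm{Hom}(d,c)=0\ \forall d\in\mathcal{D}\}$; its heart is the abelian category $\mathcal{D}\cap\mathcal{D}^\perp[1]$; it is bounded if every object lies in $\mathcal{D}[-n]\cap\mathcal{D}^\perp[n]$ for some $n\in\mathbb{N}$. All $t$-structures are assumed bounded; a bounded $t$-structure is determined by its heart. A torsion theory in an abelian category $\mathcal{A}$ is a subcategory $\mathcal{T}$ such that every $a\in\mathcal{A}$ fits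 in a short exact sequence $0\to t\to a\to f\to 0$ with $t\in\mathcal{T}$ and $f\in\mathcal{F}:=\mathcal{T}^\perp$ (orthogonal in $\mathcal{A}$). If $\mathcal{A}$ is a heart, the left tilt at $\mathcal{T}$ is the heart $L_{\mathcal{T}}\mathcal{A}=\langle\mathcal{F},\mathcal{T}[-1]\rangle$ and the right tilt is the heart $R_{\mathcal{T}}\mathcal{A}=\langle\mathcal{F}[1],\mathcal{T}\rangle$. For $s\in\mathcal{A}$ simple (with $\mathcal{A}$ of finite length and with finitely many simples), $L_s\mathcal{A}:=L_{\langle s\rangle}\mathcal{A}$ and $R_s\mathcal{A}:=R_{{}^\perp\langle s\rangle}\mathcal{A}$, where ${}^\perp\langle s\rangle=\{a\in\mathcal{A}:\mathrm{Hom}(a,s')=0\ \forall s'\in\langle s\rangle\}$; these are the simple (left, right) tilts of $\mathcal{A}$. A stability condition $\sigma=(\mathcal{Z},\mathcal{P})$ on $\mathcal{C}$ (Bridgeland) consists of a homomorphism $\mathcal{Z}:K(\mathcal{C})\to\mathbb{C}$ (central charge) and full additive subcategories $\mathcal{P}(\varphi)$, $\varphi\in\mathbb{R}$ (semi-stables of phase $\varphi$), with: nonzero $c\in\mathcal{P}(\varphi)$ has $\mathcal{Z}(c)=m(c)e^{i\pi\varphi}$, $m(c)>0$; $\mathcal{P}(\varphi+1)=\mathcal{P}(\varphi)[1]$; $\mathrm{Hom}(c,c')=0$ for $c\in\mathcal{P}(\varphi)$, $c'\in\mathcal{P}(\varphi')$, $\varphi>\varphi'$; and every nonzero $c$ has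 a finite filtration by triangles with semi-stable factors of strictly decreasing phases $\varphi_1>\cdots>\varphi_n$. Put $\varphi_\sigma^+(c)=\varphi_1$, $\varphi_\sigma^-(c)=\varphi_n$, and let $m_\sigma(c)$ be the sum of the masses $m$ of the factors. Its heart is the extension-closed subcategory generated by semi-stables with phases in $(0,1]$. $\mathrm{Stab}(\mathcal{C})$ is the space of locally-finite stability conditions (for some $\epsilon>0$ every quasi-abelian category $\mathcal{P}(t-\epsilon,t+\epsilon)$ has finite length), with the topology of the generalised metric $d(\sigma,\tau)=\sup_{c\neq0}\max(|\varphi_\sigma^-(c)-\varphi_\tau^-(c)|,|\varphi_\sigma^+(c)-\varphi_\tau^+(c)|,|\log(m_\sigma(c)/m_\tau(c))|)$. $U(\mathcal{A})\subset\mathrm{Stab}(\mathcal{C})$ is the subset of locally-finite stability conditions with heart $\mathcal{A}$, and bars denote closures in $\mathrm{Stab}(\mathcal{C})$. $S_{\{s_1,\ldots,s_k\}}\subset U(\mathcal{A})$ is the set of $\sigma\in U(\mathcal{A})$ for which $s_1,\ldots,s_k$ have phase $1$ and all other simples of $\mathcal{A}$ have phases in $(0,1)$. *)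

(* Defs.v *)
From HB Require Import structures.
From mathcomp Require Import all_boot all_order all_algebra.
From mathcomp Require Import complex.
From mathcomp Require Import all_classical all_reals all_analysis.

Set Implicit Arguments.
Unset Strict Implicit.
Unset Printing Implicit Defensive.

Import Order.TTheory GRing.Theory Num.Theory numFieldNormedType.Exports.

Local Open Scope classical_set_scope.
Local Open Scope ring_scope.

(* Objects and morphisms form types, so categories are small relative to the
   ambient universe; an essentially small category is represented by any small
   category equivalent to it. *)
Record preadditive_category := PreadditiveCategory {
  obj :> Type;
  hom : obj -> obj -> zmodType;
  idm : forall x, hom x x;
  comp : forall x y z, hom y z -> hom x y -> hom x z;
  comp_idl : forall x y (f : hom x y), comp (idm y) f = f;
  comp_idr : forall x y (f : hom x y), comp f (idm x) = f;
  compA : forall x y z t (h : hom z t) (g : hom y z) (f : hom x y),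
    comp h (comp g f) = comp (comp h g) f;
  comp_addl : forall x y z (g g' : hom y z) (f : hom x y),
    comp (g + g') f = comp g f + comp g' f;
  comp_addr : forall x y z (g : hom y z) (f f' : hom x y),
    comp g (f + f') = comp g f + comp g f'
}.
Arguments hom {p} x y.
Arguments idm {p} x.
Arguments comp {p x y z} g f.

Notation "g \oc f" := (comp g f) (at level 40, left associativity).

Section Preadditive.
Variable C : preadditive_category.
Implicit Types (x y z : C) (A : set C).

Definition is_iso x y (f : hom x y) : Prop :=
  exists g : hom y x, g \oc f = idm x /\ f \oc g = idm y.

Definition isomorphic x y : Prop := exists f : hom x y, is_iso f.

Definition is_zero x : Prop := idm x = 0.

Definition is_biproduct x y b : Prop :=
  exists (i1 : hom x b) (i2 : hom y b) (p1 : hom b x) (p2 : hom b y),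
    [/\ p1 \oc i1 = idm x, p2 \oc i2 = idm y, p1 \oc i2 = 0, p2 \oc i1 = 0
      & i1 \oc p1 + i2 \oc p2 = idm b].

(* A strict full subcategory is an isomorphism-closed set of objects. *)
Definition strict A : Prop := forall x y, isomorphic x y -> A x -> A y.

Definition additive_subcategory A : Prop :=
  [/\ strict A, (exists2 x, A x & is_zero x)
    & forall x y b, A x -> A y -> is_biproduct x y b -> A b].

(* [right_perp D] is D^⊥ and [left_perp D] is ^⊥D. *)
Definition right_perp (D : set C) : set C :=
  [set c | forall d, D d -> forall f : hom d c, f = 0].

Definition left_perp (D : set C) : set C :=
  [set c | forall d, D d -> forall f : hom c d, f = 0].

Definition finite_up_to_iso (X : set C) : Prop :=
  exists (n : nat) (r : 'I_n -> C), forall x, X x -> exists i, isomorphic x (r i).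

(* The definitions taking [A] as an argument, down to [torsion_theory], are
   internal to the full subcategory [A]: all test objects range over [A] only. *)

Definition is_kernel A k a b (i : hom k a) (p : hom a b) : Prop :=
  p \oc i = 0 /\
  forall x (u : hom x a), A x -> p \oc u = 0 ->
    exists! v : hom x k, i \oc v = u.

Definition is_cokernel A k a b (i : hom k a) (p : hom a b) : Prop :=
  p \oc i = 0 /\
  forall x (u : hom a x), A x -> u \oc i = 0 ->
    exists! v : hom b x, v \oc p = u.

Definition short_exact A k a b (i : hom k a) (p : hom a b) : Prop :=
  [/\ A k, A a, A b, is_kernel A i p & is_cokernel A i p].

Definition mono A x y (i : hom x y) : Prop :=
  forall z (u : hom z x), A z -> i \oc u = 0 -> u = 0.

(* In a quasi-abelian category the strict monomorphisms are the morphisms which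
   are kernels; in an abelian category these are all the monomorphisms. *)
Definition strict_mono A x y (i : hom x y) : Prop :=
  exists (z : C) (p : hom y z), A z /\ is_kernel A i p.

Definition factors_through e x y (i : hom x e) (j : hom y e) : Prop :=
  exists w : hom x y, i = j \oc w.

Definition artinian A : Prop :=
  forall (e : C) (x : nat -> C) (i : forall n, hom (x n) e), A e ->
    (forall n, A (x n) /\ strict_mono A (i n)) ->
    (forall n, factors_through (i n.+1) (i n)) ->
    exists N, forall n, (N <= n)%N -> factors_through (i n) (i n.+1).

Definition noetherian A : Prop :=
  forall (e : C) (x : nat -> C) (i : forall n, hom (x n) e), A e ->
    (forall n, A (x n) /\ strict_mono A (i n)) ->
    (forall n, factors_through (i n) (i n.+1)) ->
    exists N, forall n, (N <= n)%N -> factors_through (i n.+1) (i n).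

Definition finite_length A : Prop := artinian A /\ noetherian A.

Definition simple A : set C :=
  [set s | [/\ A s, ~ is_zero s
    & forall x (i : hom x s), A x -> mono A i -> is_zero x \/ is_iso i]].

Definition indecomposable A : set C :=
  [set x | [/\ A x, ~ is_zero x
    & forall y z, A y -> A z -> is_biproduct y z x -> is_zero y \/ is_zero z]].

Definition torsion_theory A (T : set C) : Prop :=
  [/\ strict T, T `<=` A
    & forall a, A a -> exists (t f : C) (i : hom t a) (p : hom a f),
        [/\ T t, right_perp T f & short_exact A i p]].

End Preadditive.

(* The shift is an additive auto-equivalence, not necessarily strictly
   invertible. *)
Record triangulated_category := TriangulatedCategory {
  tcat :> preadditive_category;
  has_zero : exists x : tcat, is_zero x;
  has_biproducts : forall x y : tcat, exists b, is_biproduct x y b;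
  shift : tcat -> tcat;
  shiftm : forall x y : tcat, hom x y -> hom (shift x) (shift y);
  shiftm_id : forall x, shiftm (idm x) = idm (shift x);
  shiftm_comp : forall (x y z : tcat) (g : hom y z) (f : hom x y),
    shiftm (g \oc f) = shiftm g \oc shiftm f;
  shiftm_add : forall (x y : tcat) (f g : hom x y),
    shiftm (f + g) = shiftm f + shiftm g;
  shiftm_bij : forall x y : tcat, bijective (@shiftm x y);
  shift_ess_surj : forall y : tcat, exists x, isomorphic (shift x) y;
  triangle : forall x y z : tcat,
    hom x y -> hom y z -> hom z (shift x) -> Prop;
  TR1_id : forall x z : tcat, is_zero z ->
    triangle (idm x) (0 : hom x z) 0;
  TR1_iso : forall (x y z x' y' z' : tcat)
      (f : hom x y) (g : hom y z) (h : hom z (shift x))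
      (f' : hom x' y') (g' : hom y' z') (h' : hom z' (shift x'))
      (u : hom x x') (v : hom y y') (w : hom z z'),
    triangle f g h -> is_iso u -> is_iso v -> is_iso w ->
    f' \oc u = v \oc f -> g' \oc v = w \oc g -> h' \oc w = shiftm u \oc h ->
    triangle f' g' h';
  TR1_cone : forall (x y : tcat) (f : hom x y),
    exists (z : tcat) (g : hom y z) (h : hom z (shift x)), triangle f g h;
  TR2 : forall (x y z : tcat)
      (f : hom x y) (g : hom y z) (h : hom z (shift x)),
    triangle f g h <-> triangle g h (- shiftm f);
  TR3 : forall (x y z x' y' z' : tcat)
      (f : hom x y) (g : hom y z) (h : hom z (shift x))
      (f' : hom x' y') (g' : hom y' z') (h' : hom z' (shift x'))
      (u : hom x x') (v : hom y y'),
    triangle f g h -> triangle f' g' h' -> f' \oc u = v \oc f ->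
    exists w : hom z z', g' \oc v = w \oc g /\ h' \oc w = shiftm u \oc h;
  TR4 : forall (x y z u v w : tcat) (f : hom x y) (g : hom y z)
      (a : hom y u) (b : hom u (shift x))
      (c : hom z w) (d : hom w (shift y))
      (e : hom z v) (k : hom v (shift x)),
    triangle f a b -> triangle g c d -> triangle (g \oc f) e k ->
    exists (p : hom u v) (q : hom v w),
      [/\ triangle p q (shiftm a \oc d),
          p \oc a = e \oc g, k \oc p = b, q \oc e = c
        & d \oc q = shiftm f \oc k]
}.
Arguments shift {t} x.
Arguments shiftm {t x y} f.
Arguments triangle {t x y z} f g h.

Section Hearts.
Variable C : triangulated_category.
Implicit Types (A B D S T : set C).

Definition shift_up S : set C := [set x | exists2 y, S y & isomorphic x (shift y)].
Definition shift_down S : set C := [set x | S (shift x)].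

(* [translate n S] is S[n], for S a strict subcategory. *)
Definition translate (n : int) S : set C :=
  match n with
  | Posz m => iter m shift_up S
  | Negz m => iter m.+1 shift_down S
  end.

(* [ext_closure S] is ⟨S⟩; it always contains the zero objects. *)
Inductive ext_closure S : set C :=
| ext_zero x : is_zero x -> ext_closure S x
| ext_gen x : S x -> ext_closure S x
| ext_iso x y : isomorphic x y -> ext_closure S x -> ext_closure S y
| ext_ext x y z (f : hom x y) (g : hom y z) (h : hom z (shift x)) :
    triangle f g h -> ext_closure S x -> ext_closure S z -> ext_closure S y.

Definition t_structure D : Prop :=
  [/\ strict D, translate 1 D `<=` D
    & forall c : C, exists (d d' : C)
        (f : hom d c) (g : hom c d') (h : hom d' (shift d)),
        [/\ D d, right_perp D d' & triangle f g h]].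

Definition bounded D : Prop :=
  forall c : C, exists n : nat,
    (translate (- n%:Z) D `&` translate n%:Z (right_perp D)) c.

Definition heart D : set C := D `&` translate 1 (right_perp D).

Definition is_heart A : Prop :=
  exists D, [/\ t_structure D, bounded D & A = heart D].

Definition left_tilt A T : set C :=
  ext_closure ((A `&` right_perp T) `|` translate (-1) T).

Definition right_tilt A T : set C :=
  ext_closure (translate 1 (A `&` right_perp T) `|` T).

Definition simple_left_tilt A (s : C) : set C :=
  left_tilt A (ext_closure [set s]).

Definition simple_right_tilt A (s : C) : set C :=
  right_tilt A (A `&` left_perp (ext_closure [set s])).

Inductive simple_tilts A : set C -> Prop :=
| simple_tilts0 : simple_tilts A A
| simple_tilts_left B (s : C) :
    simple_tilts A B -> simple B s -> simple_tilts A (simple_left_tilt B s)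
| simple_tilts_right B (s : C) :
    simple_tilts A B -> simple B s -> simple_tilts A (simple_right_tilt B s).

End Hearts.

Section StabilityConditions.
Variables (R : realType) (C : triangulated_category).

(* [filtration P s c]: c has a finite filtration by triangles whose successive
   nonzero factors are the a in P phi, (phi, a) running through the list s. *)
Inductive filtration (P : R -> set C) : seq (R * C) -> C -> Prop :=
| filtration_nil x : is_zero x -> filtration P [::] x
| filtration_rcons s x y phi a
    (f : hom x y) (g : hom y a) (h : hom a (shift x)) :
    filtration P s x -> triangle f g h -> P phi a -> ~ is_zero a ->
    filtration P (rcons s (phi, a)) y.

Definition HN_filtration (P : R -> set C) (s : seq (R * C)) (c : C) : Prop :=
  filtration P s c /\ sorted (fun x y : R => y < x) (unzip1 s).

(* Homomorphisms from the Grothendieck group K(C) are the functions on objects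
   which are additive on exact triangles. *)
Record stability_condition := StabilityCondition {
  Z : C -> R[i];
  Z_add : forall (x y z : C) (f : hom x y) (g : hom y z) (h : hom z (shift x)),
    triangle f g h -> Z y = Z x + Z z;
  P : R -> set C;
  P_additive : forall phi, additive_subcategory (P phi);
  Z_phase : forall phi c, P phi c -> ~ is_zero c ->
    exists2 m : R, 0 < m & Z c = (m * cos (pi * phi) +i* (m * sin (pi * phi)))%C;
  P_shift : forall phi, P (phi + 1) = translate 1 (P phi);
  P_hom : forall phi psi c d, P phi c -> P psi d -> psi < phi ->
    forall f : hom c d, f = 0;
  P_HN : forall c, ~ is_zero c -> exists s, HN_filtration P s c
}.

(* P(I) for I the open interval ]a, b[. *)
Definition P_itv (sigma : stability_condition) (a b : R) : set C :=
  ext_closure [set x | exists2 phi, a < phi < b & P sigma phi x].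

(* P(]t - e, t + e[) is quasi-abelian as soon as its length is less than 1. *)
Definition locally_finite (sigma : stability_condition) : Prop :=
  exists e : R, 0 < e < 2^-1 /\
    forall t, finite_length (P_itv sigma (t - e) (t + e)).

Definition heart_of (sigma : stability_condition) : set C :=
  ext_closure [set x | exists2 phi, 0 < phi <= 1 & P sigma phi x].

Definition filtration_mass (sigma : stability_condition) (s : seq (R * C)) : R :=
  \sum_(u <- s) ComplexField.Normc.normc (Z sigma u.2).

(* Harder-Narasimhan filtrations are unique up to isomorphism, so for c nonzero
   the sets below are singletons. *)
Definition phi_plus (sigma : stability_condition) (c : C) : R :=
  xget 0 [set phi | exists2 s, HN_filtration (P sigma) s c
                             & phi = head 0 (unzip1 s)].

Definition phi_minus (sigma : stability_condition) (c : C) : R :=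
  xget 0 [set phi | exists2 s, HN_filtration (P sigma) s c
                             & phi = last 0 (unzip1 s)].

Definition mass (sigma : stability_condition) (c : C) : R :=
  xget 0 [set m | exists2 s, HN_filtration (P sigma) s c
                           & m = filtration_mass sigma s].

Definition stab_dist_at (sigma tau : stability_condition) (c : C) : R :=
  Num.max `|phi_minus sigma c - phi_minus tau c|
    (Num.max `|phi_plus sigma c - phi_plus tau c|
             `|ln (mass sigma c / mass tau c)|).

Definition stab_dist (sigma tau : stability_condition) : \bar R :=
  ereal_sup [set (stab_dist_at sigma tau c)%:E | c in [set c : C | ~ is_zero c]].

Lemma mass_gt0 sigma c : ~ is_zero c -> 0 < mass sigma c.
Proof.
move=> c0; have [s0 Hs0] := P_HN sigma c0.
rewrite /mass; set X := (X in xget _ X).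
have : X (xget 0 X) by apply: xgetPex; exists (filtration_mass sigma s0), s0.
move=> [s [Hs _] ->] {Hs0 s0 X}.
suff [[_ /c0]|] : (s = [::] /\ is_zero c) \/ 0 < filtration_mass sigma s by [].
elim: Hs => [x x0|{}s x y phi a f g h _ IH _ Pa a0]; first by left.
right; rewrite /filtration_mass -cats1 big_cat big_seq1 /= -/(filtration_mass sigma s).
have a_gt0 : 0 < ComplexField.Normc.normc (Z sigma a).
  have [m m0 ->] := Z_phase Pa a0.
  rewrite /ComplexField.Normc.normc sqrtr_gt0 !exprMn -mulrDr.
  by rewrite cos2Dsin2 mulr1 exprn_gt0.
case: IH => [[-> _]|IH]; last by rewrite addr_gt0.
by rewrite /filtration_mass big_nil add0r.
Qed.

Lemma stab_dist_refl sigma : (stab_dist sigma sigma <= 0)%E.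
Proof.
apply: ge_ereal_sup => _ [c /= c0 <-]; rewrite lee_fin.
by rewrite /stab_dist_at !subrr divff ?gt_eqF ?mass_gt0// ln1 normr0 !maxxx.
Qed.

Lemma stab_dist_sym sigma tau : stab_dist sigma tau = stab_dist tau sigma.
Proof.
rewrite /stab_dist; congr ereal_sup; apply: eq_imagel => c /= c0.
rewrite /stab_dist_at distrC (distrC (phi_plus _ _)).
by rewrite -[mass sigma c / _]invf_div lnV ?posrE ?divr_gt0 ?mass_gt0// normrN.
Qed.

Lemma stab_dist_triangle rho sigma tau (a b : R) :
  (stab_dist sigma rho < a%:E)%E -> (stab_dist rho tau < b%:E)%E ->
  (stab_dist sigma tau < (a + b)%:E)%E.
Proof.
move=> ha hb; rewrite EFinD; apply: le_lt_trans (lteD ha hb).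
apply: ge_ereal_sup => _ [c /= c0 <-].
have la : ((stab_dist_at sigma rho c)%:E <= stab_dist sigma rho)%E.
  by apply: ereal_sup_ubound; exists c.
have lb : ((stab_dist_at rho tau c)%:E <= stab_dist rho tau)%E.
  by apply: ereal_sup_ubound; exists c.
apply: le_trans (leeD la lb); rewrite -EFinD lee_fin.
have lnE : ln (mass sigma c / mass tau c) =
    ln (mass sigma c / mass rho c) + ln (mass rho c / mass tau c).
  rewrite -lnM ?posrE ?divr_gt0 ?mass_gt0//.
  by rewrite mulrA divfK ?gt_eqF ?mass_gt0.
rewrite /stab_dist_at lnE !ge_max; apply/and3P; split.
- apply: le_trans (ler_distD (phi_minus rho c) _ _) _.
  by rewrite lerD// le_max lexx.
- apply: le_trans (ler_distD (phi_plus rho c) _ _) _.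
  by rewrite lerD// !le_max lexx !orbT.
- apply: le_trans (ler_normD _ _) _.
  by rewrite lerD// !le_max lexx !orbT.
Qed.

Record Stab := MkStab {
  stab_cond :> stability_condition;
  stab_locally_finite : locally_finite stab_cond
}.

End StabilityConditions.

HB.instance Definition _ (R : realType) (C : triangulated_category) :=
  gen_eqMixin (Stab R C).
HB.instance Definition _ (R : realType) (C : triangulated_category) :=
  gen_choiceMixin (Stab R C).

Section StabTopology.
Variables (R : realType) (C : triangulated_category).

Definition stab_ball (sigma : Stab R C) (e : R) : set (Stab R C) :=
  [set tau | (stab_dist sigma tau < e%:E)%E].

Lemma stab_ball_center sigma (e : R) : 0 < e -> stab_ball sigma e sigma.
Proof. by move=> e0; apply: le_lt_trans (stab_dist_refl _) _; rewrite lte_fin. Qed.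

Lemma stab_ball_sym sigma tau (e : R) :
  stab_ball sigma e tau -> stab_ball tau e sigma.
Proof. by rewrite /stab_ball /= stab_dist_sym. Qed.

Lemma stab_ball_triangle sigma rho tau (a b : R) :
  stab_ball sigma a rho -> stab_ball rho b tau -> stab_ball sigma (a + b) tau.
Proof. exact: stab_dist_triangle. Qed.

HB.instance Definition _ := hasNbhs.Build (Stab R C)
  (nbhs_ (entourage_ stab_ball)).

HB.instance Definition _ := @Nbhs_isPseudoMetric.Build R (Stab R C)
  (entourage_ stab_ball) erefl stab_ball
  stab_ball_center stab_ball_sym stab_ball_triangle erefl.

Definition U (A : set C) : set (Stab R C) := [set sigma | heart_of sigma = A].

Definition S_ (A : set C) (k : nat) (s : 'I_k -> C) : set (Stab R C) :=
  U A `&` [set sigma |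
    (forall i, P sigma 1 (s i)) /\
    forall x, simple A x -> (forall i, ~ isomorphic x (s i)) ->
      exists2 phi, 0 < phi < 1 & P sigma phi x].

End StabTopology.
Arguments U R {C} A.
Arguments S_ R {C} A {k} s.

Definition embedding (X Y : topologicalType) (f : X -> Y) : Prop :=
  [/\ injective f, continuous f
    & forall V, open V -> exists2 W, open W & f @^-1` W = V].

(* The supremum of the d such that X contains a homeomorphic copy of R^d
   (equivalently of an open d-dimensional ball); it is -oo for X empty. *)
Definition dim_real (R : realType) (Y : topologicalType) (X : set Y) : \bar R :=
  ereal_sup [set d%:R%:E | d in [set d : nat |
    exists f : 'rV[R]_d -> Y, embedding f /\ range f `<=` X]].

(* Main.v *)
(* Write B for the left tilt of A at T and let sigma lie in S_{s_1,...,s_k}.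

   If s is a simple object in T then B is also the tilt of L_s A at the objects
   of T without maps from s, a torsion theory with fewer indecomposables. So B is
   an iterated simple tilt of A, and it has finite length and finitely many
   simples. Its length function l extends to an additive function on C, by the
   long exact cohomology sequence. As T consists of objects of phase 1, the heart
   B is contained in P_sigma([0,1]); hence Z + i e l maps the nonzero objects of B
   to the upper half plane for all e > 0, and defines a stability condition tau
   with heart B. When e tends to 0, tau tends to sigma:
   - the two central charges differ by at most d |Z| on sigma-semistable objects,
     with d small, because A has finitely many simples. Vanishing of morphisms
     between P_sigma and the tau-factors then puts P_sigma(phi) in
     P_tau([phi - eta, phi + eta]), which controls the phases;
   - an object of P_sigma([phi - eta, phi + eta]) has mass at most
     |Z| / cos(pi eta), so the masses are controlled once the mass is known to be
     subadditive on triangles. By Crofton's formula the mass is an average over t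
     of the heights of the central charge above the line of phase t, taken over
     all cohomologies with respect to P(t,t+1]; each of these heights is
     subadditive by the long exact sequence.

   The same estimates show that sending x in R^k to the stability condition with
   heart A and central charge - exp x_i on s_i and i on the other simples is
   continuous; it is an embedding since s_i has mass exp x_i. *)

From HB Require Import structures.
From mathcomp Require Import all_boot all_order all_algebra.
From mathcomp Require Import complex.
From mathcomp Require Import all_classical all_reals all_analysis.
From mathcomp Require Import zify ring lra.
Require Import Defs.

Set Implicit Arguments.
Unset Strict Implicit.
Unset Printing Implicit Defensive.

Import Order.TTheory GRing.Theory Num.Theory numFieldNormedType.Exports.

Local Open Scope classical_set_scope.
Local Open Scope ring_scope.

(** * Triangulated categories *)

Section PreadditiveTheory.
Variable C : preadditive_category.
Implicit Types x y z t : C.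

(** The shift is only an auto-equivalence, so t-structures are handled as integer-indexed families
    [t_family], stable under isomorphism, and exactness in a heart is expressed by triangles. The
    metric estimate rests on one asymmetric hypothesis: P_tau(psi) lies in P_sigma([n, n + 1])
    whenever n < psi <= n + 1. It holds for the tilted heart because T[-1] has phase 0, and for the
    chart because the hearts agree; hence a single comparison gives both the closure statement and
    the continuity of the chart. Crofton's formula is used in a discrete form: masses are compared
    with finite sums of heights over N equidistant directions, exact up to a factor cos(pi / (2 N))
    that tends to 1. A stability condition is built from a central charge together with a separate
    integral length function. The length bounds the quotients of a given object and leaves finitely
    many values for their charges, so quotients of least phase exist although the image of the
    central charge may fail to be discrete. *)

Lemma comp0l x y z (f : hom x y) : (0 : hom y z) \oc f = 0.
Proof. by apply: (addrI (0 \oc f)); rewrite -comp_addl !addr0. Qed.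

Lemma comp0r x y z (g : hom y z) : g \oc (0 : hom x y) = 0.
Proof. by apply: (addrI (g \oc 0)); rewrite -comp_addr !addr0. Qed.

Lemma compNl x y z (g : hom y z) (f : hom x y) : (- g) \oc f = - (g \oc f).
Proof. by apply: (addrI (g \oc f)); rewrite -comp_addl !subrr comp0l. Qed.

Lemma compNr x y z (g : hom y z) (f : hom x y) : g \oc (- f) = - (g \oc f).
Proof. by apply: (addrI (g \oc f)); rewrite -comp_addr !subrr comp0r. Qed.

Lemma compBl x y z (g g' : hom y z) (f : hom x y) :
  (g - g') \oc f = g \oc f - g' \oc f.
Proof. by rewrite comp_addl compNl. Qed.

Lemma compBr x y z (g : hom y z) (f f' : hom x y) :
  g \oc (f - f') = g \oc f - g \oc f'.
Proof. by rewrite comp_addr compNr. Qed.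

Lemma zero_to x y (f : hom x y) : is_zero x -> f = 0.
Proof. by move=> x0; rewrite -(comp_idr f) x0 comp0r. Qed.

Lemma to_zero x y (f : hom x y) : is_zero y -> f = 0.
Proof. by move=> y0; rewrite -(comp_idl f) y0 comp0l. Qed.

Lemma is_iso_id x : is_iso (idm x).
Proof. by exists (idm x); rewrite comp_idl. Qed.

Lemma is_iso_comp x y z (g : hom y z) (f : hom x y) :
  is_iso g -> is_iso f -> is_iso (g \oc f).
Proof.
move=> [g' [g1 g2]] [f' [f1 f2]]; exists (f' \oc g'); split.
  by rewrite compA -(compA f') g1 comp_idr.
by rewrite compA -(compA g) f2 comp_idr.
Qed.

Lemma is_isoN x y (f : hom x y) : is_iso f -> is_iso (- f).
Proof.
by move=> [g [g1 g2]]; exists (- g); rewrite !compNl !compNr !opprK.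
Qed.

Lemma isomorphic_refl x : isomorphic x x.
Proof. by exists (idm x); exact: is_iso_id. Qed.

Lemma isomorphic_sym x y : isomorphic x y -> isomorphic y x.
Proof. by move=> [f [g [h1 h2]]]; exists g, f. Qed.

Lemma isomorphic_trans x y z : isomorphic x y -> isomorphic y z -> isomorphic x z.
Proof. by move=> [f Hf] [g Hg]; exists (g \oc f); exact: is_iso_comp. Qed.

Lemma isomorphic_zero x y : is_zero x -> isomorphic x y -> is_zero y.
Proof.
by move=> x0 [f [g [_ h2]]]; rewrite /is_zero -h2 (to_zero g x0) comp0r.
Qed.

Lemma biproduct_sym x y b : is_biproduct x y b -> is_biproduct y x b.
Proof.
move=> [i1 [i2 [p1 [p2 [a1 a2 a3 a4 a5]]]]].
by exists i2, i1, p2, p1; split=> //; rewrite addrC.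
Qed.

Lemma right_perp_sub (D E : set C) : D `<=` E -> right_perp E `<=` right_perp D.
Proof. by move=> DE c Hc d /DE Hd f; exact: Hc. Qed.

Lemma strict_right_perp (D : set C) : strict (right_perp D).
Proof.
move=> x y [f [g [_ fg]]] Dx d Dd u.
by rewrite -(comp_idl u) -fg -compA (Dx _ Dd (g \oc u)) comp0r.
Qed.

End PreadditiveTheory.

Section TriangulatedTheory.
Variable C : triangulated_category.
Implicit Types x y z w : C.

Lemma shiftm0 x y : shiftm (0 : hom x y) = 0.
Proof. by apply: (addrI (shiftm 0)); rewrite -shiftm_add !addr0. Qed.

Lemma shiftmN x y (f : hom x y) : shiftm (- f) = - shiftm f.
Proof. by apply: (addrI (shiftm f)); rewrite -shiftm_add !subrr shiftm0. Qed.

Lemma shiftm_inj x y : injective (@shiftm C x y).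
Proof. exact: bij_inj (@shiftm_bij C x y). Qed.

Lemma shiftm_surj x y (g : hom (shift x) (shift y)) : exists f, g = shiftm f.
Proof. by have [h _ hK] := @shiftm_bij C x y; exists (h g); rewrite hK. Qed.

Lemma is_zero_shift x : is_zero (shift x) <-> is_zero x.
Proof.
split=> [x0|x0]; last by rewrite /is_zero -shiftm_id x0 shiftm0.
by apply: shiftm_inj; rewrite shiftm_id shiftm0.
Qed.

Lemma is_iso_shift x y (f : hom x y) : is_iso f -> is_iso (shiftm f).
Proof.
by move=> [g [g1 g2]]; exists (shiftm g); rewrite -!shiftm_comp g1 g2 !shiftm_id.
Qed.

Lemma isomorphic_shift x y : isomorphic (shift x) (shift y) <-> isomorphic x y.
Proof.
split=> [[f [g [g1 g2]]]|[f Hf]]; last by exists (shiftm f); exact: is_iso_shift.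
have [f' ff'] := shiftm_surj f; have [g' gg'] := shiftm_surj g.
exists f', g'; split; apply: shiftm_inj;
  by rewrite shiftm_comp -ff' -gg' ?g1 ?g2 shiftm_id.
Qed.

Lemma tri_rot x y z (f : hom x y) (g : hom y z) (h : hom z (shift x)) :
  triangle f g h -> triangle g h (- shiftm f).
Proof. exact: (proj1 (TR2 f g h)). Qed.

Lemma tri_rotV x y z (f : hom x y) (g : hom y z) (h : hom z (shift x)) :
  triangle g h (- shiftm f) -> triangle f g h.
Proof. exact: (proj2 (TR2 f g h)). Qed.

Lemma tri_comp0 x y z (f : hom x y) (g : hom y z) (h : hom z (shift x)) :
  triangle f g h -> g \oc f = 0.
Proof.
move=> H; have [z0 Hz0] := has_zero C.
have [w [-> _]] := TR3 (TR1_id x Hz0) H (erefl (f \oc idm x)).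
exact: comp0r.
Qed.

(** Exactness of Hom(w, -): [TR3] extends [u] to a morphism from the rotated identity triangle of
    [w], and full faithfulness of the shift undoes the rotation. *)
Lemma tri_ker x y z (f : hom x y) (g : hom y z) (h : hom z (shift x)) w
    (u : hom w y) :
  triangle f g h -> g \oc u = 0 -> exists v, u = f \oc v.
Proof.
move=> H gu; have [z0 Hz0] := has_zero C.
have [|w' [_]] := TR3 (u := u) (v := 0) (tri_rot (TR1_id w Hz0)) (tri_rot H).
  by rewrite gu comp0l.
have [v ->] := shiftm_surj w'; rewrite compNl compNr shiftm_id comp_idr.
by move=> /oppr_inj; rewrite -shiftm_comp => /shiftm_inj <-; exists v.
Qed.

Lemma tri_coker x y z (f : hom x y) (g : hom y z) (h : hom z (shift x)) w
    (u : hom y w) :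
  triangle f g h -> u \oc f = 0 -> exists v, u = v \oc g.
Proof.
move=> H uf; have [z0 Hz0] := has_zero C.
have Hw : triangle (0 : hom z0 w) (idm w) (0 : hom w (shift z0)).
  apply: tri_rotV; rewrite shiftm0 oppr0.
  by apply: TR1_id; apply/is_zero_shift.
have [|v [e _]] := TR3 (u := 0) (v := u) H Hw; first by rewrite uf comp0l.
by exists v; rewrite -e comp_idl.
Qed.

Lemma tri_ker2 x y z (f : hom x y) (g : hom y z) (h : hom z (shift x)) w
    (u : hom w z) :
  triangle f g h -> h \oc u = 0 -> exists v, u = g \oc v.
Proof. by move=> /tri_rot; exact: tri_ker. Qed.

Lemma tri_coker2 x y z (f : hom x y) (g : hom y z) (h : hom z (shift x)) w
    (u : hom z w) :
  triangle f g h -> u \oc g = 0 -> exists v, u = v \oc h.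
Proof. by move=> /tri_rot; exact: tri_coker. Qed.

Lemma tri_ker3 x y z (f : hom x y) (g : hom y z) (h : hom z (shift x)) w
    (u : hom w x) :
  triangle f g h -> f \oc u = 0 -> exists v, shiftm u = h \oc v.
Proof.
move=> /tri_rot/tri_rot H fu; apply: (tri_ker H).
by rewrite compNl -shiftm_comp fu shiftm0 oppr0.
Qed.

(** [z] need not be a shift: the fibre [w] of [f] is a preimage of [z] up to the isomorphism [e],
    and the sign is the one prescribed by [TR2]. *)
Lemma tri_unrot x y z (f : hom x y) (g : hom y z) (h : hom z (shift x)) :
  triangle f g h -> exists w (i : hom w x) (k : hom y (shift w))
    (e : hom (shift w) z), [/\ is_iso e, triangle i f k & shiftm i = - (h \oc e)].
Proof.
move=> H; have [w [e [e' [e1 e2]]]] := shift_ess_surj z.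
have [i ie] := shiftm_surj (- (h \oc e)).
exists w, i, (e' \oc g), e; split=> //; first by exists e'.
apply: tri_rotV; apply: (TR1_iso H (is_iso_id x) (is_iso_id y) (w := e')).
- by exists e.
- by rewrite comp_idr comp_idl.
- by rewrite comp_idr.
- by rewrite -ie opprK -compA e2 shiftm_id comp_idl comp_idr.
Qed.

Lemma tri_shift x y z (f : hom x y) (g : hom y z) (h : hom z (shift x)) :
  triangle f g h <-> triangle (- shiftm f) (- shiftm g) (- shiftm h).
Proof. by split=> [H|H]; [apply/tri_rot/tri_rot/tri_rot|do 3! apply: tri_rotV]. Qed.

Lemma tri_isol x y z x' (f : hom x y) (g : hom y z) (h : hom z (shift x)) :
  triangle f g h -> isomorphic x' x -> exists (f' : hom x' y) h', triangle f' g h'.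
Proof.
move=> H [e [e' [e1 e2]]]; exists (f \oc e), (shiftm e' \oc h).
apply: (TR1_iso H (u := e') (v := idm y) (w := idm z));
  try exact: is_iso_id; first by exists e.
- by rewrite -compA e2 comp_idr comp_idl.
- by rewrite comp_idl comp_idr.
- by rewrite comp_idr.
Qed.

Lemma tri_isor x y z z' (f : hom x y) (g : hom y z) (h : hom z (shift x)) :
  triangle f g h -> isomorphic z z' -> exists (g' : hom y z') h', triangle f g' h'.
Proof.
move=> H [e [e' [e1 e2]]]; exists (e \oc g), (h \oc e').
apply: (TR1_iso H (u := idm x) (v := idm y) (w := e));
  try exact: is_iso_id; first by exists e'.
- by rewrite comp_idr comp_idl.
- by rewrite comp_idr.
- by rewrite -compA e1 shiftm_id comp_idl comp_idr.
Qed.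

Lemma tri_isom x y y' z (f : hom x y) (g : hom y z) (h : hom z (shift x)) :
  triangle f g h -> isomorphic y y' -> exists (f' : hom x y') g', triangle f' g' h.
Proof.
move=> H [e [e' [e1 e2]]]; exists (e \oc f), (g \oc e').
apply: (TR1_iso H (u := idm x) (v := e) (w := idm z));
  try exact: is_iso_id; first by exists e'.
- by rewrite comp_idr.
- by rewrite -compA e1 comp_idl comp_idr.
- by rewrite comp_idr shiftm_id comp_idl.
Qed.

Definition tri x y z := exists (f : hom x y) (g : hom y z) (h : hom z (shift x)),
  triangle f g h.

Lemma tri_iso x y z x' y' z' : tri x y z ->
  isomorphic x x' -> isomorphic y y' -> isomorphic z z' -> tri x' y' z'.
Proof.
move=> [f [g [h H]]] /isomorphic_sym xx' yy' zz'.
have [f1 [h1 H1]] := tri_isol H xx'.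
have [f2 [g2 H2]] := tri_isom H1 yy'.
have [g3 [h3 H3]] := tri_isor H2 zz'.
by exists f2, g3, h3.
Qed.

Lemma tri_of_rot x y z : tri (shift x) (shift y) (shift z) -> tri x y z.
Proof.
move=> [f [g [h H]]].
have [f' ff'] := shiftm_surj (- f); have [g' gg'] := shiftm_surj (- g).
have [h' hh'] := shiftm_surj (- h).
by exists f', g', h'; apply/tri_shift; rewrite -ff' -gg' -hh' !opprK.
Qed.

Lemma tri_shifted x y z : tri x y z -> tri (shift x) (shift y) (shift z).
Proof. by move=> [f [g [h /tri_shift H]]]; eexists; eexists; eexists; exact: H. Qed.

Lemma tri_rotate x y z : tri x y z -> tri y z (shift x).
Proof. by move=> [f [g [h /tri_rot H]]]; exists g, h, (- shiftm f). Qed.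

Lemma tri_unrotate x y z : tri x y (shift z) -> tri z x y.
Proof.
move=> [f [g [h H]]]; have [w [i [k [e [He H1 _]]]]] := tri_unrot H.
have wz : isomorphic w z by apply/isomorphic_shift; exists e.
apply: (tri_iso (x := w) (y := x) (z := y)); last 3 first.
- exact: wz.
- exact: isomorphic_refl.
- exact: isomorphic_refl.
by exists i, f, k.
Qed.

Lemma tri_zero_l x y z (f : hom x y) (g : hom y z) (h : hom z (shift x)) :
  triangle f g h -> is_zero x -> is_iso g.
Proof.
move=> H x0; have [|v ve] := tri_ker2 (u := idm z) H.
  by apply: to_zero; apply/is_zero_shift.
exists v; split=> //.
have [|u ue] := tri_ker (u := v \oc g - idm y) H.
  by rewrite compBr compA -ve comp_idl comp_idr subrr.
by apply/eqP; rewrite -subr_eq0 ue (zero_to f x0) comp0l.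
Qed.

Lemma tri_zero_r x y z (f : hom x y) (g : hom y z) (h : hom z (shift x)) :
  triangle f g h -> is_zero z -> is_iso f.
Proof.
move=> H z0; have [|v ve] := tri_ker (u := idm y) H; first exact: to_zero.
exists v; split=> //.
have [|u ue] := tri_ker3 (u := v \oc f - idm x) H.
  by rewrite compBr compA -ve comp_idl comp_idr subrr.
apply/eqP; rewrite -subr_eq0; apply/eqP/shiftm_inj.
by rewrite ue (to_zero u z0) comp0r shiftm0.
Qed.

Lemma tri_id x z : is_zero z -> tri x x z.
Proof. by move=> z0; exists (idm x), 0, 0; exact: TR1_id. Qed.

Lemma tri_idr x z : is_zero z -> tri z x x.
Proof.
move=> z0; apply: tri_unrotate; apply: tri_id; exact/is_zero_shift.
Qed.

(** As [p1] retracts [i1], the connecting map of the cone of [i1] vanishes, and the map induced by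
    [p2] on the cone is an isomorphism. *)
Lemma biproduct_triangle x y b : is_biproduct x y b -> tri x b y.
Proof.
move=> [i1 [i2 [p1 [p2 [a1 a2 a3 a4 a5]]]]].
have [z [g [h H]]] := TR1_cone i1.
have [v ve] := tri_coker H a4.
have h0 : h = 0.
  have : shiftm i1 \oc h = 0.
    by have := tri_comp0 (tri_rot (tri_rot H)); rewrite compNl => /eqP; rewrite oppr_eq0 => /eqP.
  move=> /(congr1 (comp (shiftm p1))); rewrite compA -shiftm_comp a1 shiftm_id.
  by rewrite comp_idl comp0r.
have e1 : g \oc i2 \oc v \oc g = g.
  have : g \oc idm b = g by exact: comp_idr.
  rewrite -a5 comp_addr (compA g i1) (tri_comp0 H) comp0l add0r => e.
  by rewrite -[RHS]e -!compA -ve.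
have [|w we] := tri_coker2 (u := g \oc i2 \oc v - idm z) H.
  by rewrite compBl e1 comp_idl subrr.
have iso_v : is_iso v.
  exists (g \oc i2); split; last by rewrite compA -ve.
  by apply/eqP; rewrite -subr_eq0 we h0 comp0r.
have [g' [h' H']] := tri_isor H (ex_intro _ v iso_v).
by exists i1, g', h'.
Qed.

(* The octahedral axiom, for the fibres of [y -> z], [z -> c] and [y -> c]. *)
Lemma oct_fib x y z z' c (f : hom x y) (g : hom y z) (h : hom z (shift x))
    (i : hom z' z) (p : hom z c) (k : hom c (shift z')) :
  triangle f g h -> triangle i p k ->
  exists y' (j : hom y' y) (l : hom c (shift y')) (m : hom x y') (n : hom y' z')
    (q : hom z' (shift x)),
    [/\ triangle j (p \oc g) l, triangle m n q & j \oc m = f].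
Proof.
move=> H1 H2; have [v [e [d H3]]] := TR1_cone (p \oc g).
have [a [b [H4 _ Ha _ _]]] := TR4 (tri_rot H1) (tri_rot H2) H3.
have [y' [j [l [r [[r' [r1 r2]] H5 jE]]]]] := tri_unrot H3.
have [m' mE] := shiftm_surj (r' \oc a).
have [n' nE] := shiftm_surj (b \oc r).
have [q' qE] := shiftm_surj (- (shiftm h \oc - shiftm i)).
have H6 : triangle (- m') (- n') q'.
  apply/tri_shift; rewrite !shiftmN !opprK -mE -nE -qE opprK.
  apply: (TR1_iso H4 (u := idm _) (v := r') (w := idm _)).
  - exact: is_iso_id.
  - by exists r.
  - exact: is_iso_id.
  - by rewrite comp_idr.
  - by rewrite -compA r2 comp_idl comp_idr.
  - by rewrite comp_idr shiftm_id comp_idl.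
exists y', j, l, m', n', q'; split=> //; last first.
  apply: shiftm_inj; rewrite shiftm_comp jE -mE compNl -compA (compA r) r2.
  by rewrite comp_idl Ha opprK.
(* Undoing one shift negates the maps of the triangle; the automorphism [- idm y'] absorbs the signs
   of [m'] and [n']. *)
apply: (TR1_iso H6 (u := idm x) (v := - idm y') (w := idm z')).
- exact: is_iso_id.
- by apply: is_isoN; exact: is_iso_id.
- exact: is_iso_id.
- by rewrite comp_idr compNl comp_idl opprK.
- by rewrite compNr comp_idr comp_idl.
- by rewrite comp_idr shiftm_id comp_idl.
Qed.

Lemma oct_cof x y z u w (f : hom x y) (g : hom y z)
    (a : hom y u) (b : hom u (shift x)) (c : hom z w) (d : hom w (shift y)) :
  triangle f a b -> triangle g c d ->
  exists v (e : hom z v) (k : hom v (shift x)),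
    triangle (g \oc f) e k /\ tri u v w.
Proof.
move=> H1 H2; have [v [e [k H3]]] := TR1_cone (g \oc f).
have [p [q [H4 _ _ _ _]]] := TR4 H1 H2 H3.
by exists v, e, k; split=> //; exists p, q, (shiftm a \oc d).
Qed.

Lemma oct_fib_obj x y z z' c : tri x y z -> tri z' z c ->
  exists2 y', tri y' y c & tri x y' z'.
Proof.
move=> [f [g [h H1]]] [i [p [k H2]]].
have [y' [j [l [m [n [q [H3 H4 _]]]]]]] := oct_fib H1 H2.
by exists y'; [exists j, (p \oc g), l|exists m, n, q].
Qed.

Lemma oct_cof_obj x y z u w : tri x y u -> tri y z w ->
  exists2 v, tri x z v & tri u v w.
Proof.
move=> [f [a [b H1]]] [g [c [d H2]]].
have [v [e [k [H3 H4]]]] := oct_cof H1 H2.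
by exists v => //; exists (g \oc f), e, k.
Qed.

Lemma hom_ext_l x y z w : tri x y z -> (forall f : hom x w, f = 0) ->
  (forall f : hom z w, f = 0) -> forall f : hom y w, f = 0.
Proof.
move=> [f [g [h H]]] xw zw u; have [v ->] := tri_coker H (xw (u \oc f)).
by rewrite (zw v) comp0l.
Qed.

Lemma hom_ext_r x y z w : tri x y z -> (forall f : hom w x, f = 0) ->
  (forall f : hom w z, f = 0) -> forall f : hom w y, f = 0.
Proof.
move=> [f [g [h H]]] wx wz u; have [v ->] := tri_ker H (wz (g \oc u)).
by rewrite (wx v) comp0r.
Qed.

Lemma hom_iso_l x x' w : isomorphic x x' -> (forall f : hom x w, f = 0) ->
  forall f : hom x' w, f = 0.
Proof.
by move=> [e [e' [_ e2]]] H f; rewrite -(comp_idr f) -e2 compA (H (f \oc e)) comp0l.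
Qed.

Lemma hom_shift x w : (forall f : hom x w, f = 0) ->
  forall f : hom (shift x) (shift w), f = 0.
Proof. by move=> H f; have [g ->] := shiftm_surj f; rewrite (H g) shiftm0. Qed.

Lemma hom_unshift x w : (forall f : hom (shift x) (shift w), f = 0) ->
  forall f : hom x w, f = 0.
Proof. by move=> H f; apply: shiftm_inj; rewrite (H (shiftm f)) shiftm0. Qed.

(** If [g] is zero, the identity of [z] factors through [shift x]. This turns orthogonality into
    vanishing of objects. *)
Lemma tri_g0 x y z (f : hom x y) (g : hom y z) (h : hom z (shift x)) :
  triangle f g h -> g = 0 -> (forall u : hom (shift x) z, u = 0) -> is_zero z.
Proof.
move=> H g0 Hu; have [|v] := tri_coker2 (u := idm z) H.
  by rewrite g0 comp0r.
by rewrite /is_zero => ->; rewrite (Hu v) comp0l.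
Qed.

Lemma tri_f0 x y z (f : hom x y) (g : hom y z) (h : hom z (shift x)) :
  triangle f g h -> f = 0 -> (forall u : hom (shift x) z, u = 0) -> is_zero x.
Proof.
move=> H f0 Hu; have [|v] := tri_ker3 (u := idm x) H.
  by rewrite f0 comp0l.
by rewrite (Hu v) comp0r shiftm_id => ?; apply/is_zero_shift.
Qed.

Lemma ext_closure_tri (S : set C) x y z : tri x y z ->
  ext_closure S x -> ext_closure S z -> ext_closure S y.
Proof. by move=> [f [g [h H]]]; exact: ext_ext H. Qed.

Lemma ext_closure_sub (S E : set C) :
  S `<=` E -> (forall x, is_zero x -> E x) -> strict E ->
  (forall x y z, tri x y z -> E x -> E z -> E y) -> ext_closure S `<=` E.
Proof.
move=> SE E0 Es Ee x; elim=> {x}.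
- exact: E0.
- exact: SE.
- by move=> x y xy _ Ex; exact: Es Ex.
- by move=> x y z f g h H _ Ex _ Ez; apply: (Ee x y z) => //; exists f, g, h.
Qed.

Lemma ext_closure_mono (S E : set C) : S `<=` ext_closure E ->
  ext_closure S `<=` ext_closure E.
Proof.
move=> SE; apply: ext_closure_sub => //.
- exact: ext_zero.
- by move=> x y; exact: ext_iso.
- by move=> x y z; exact: ext_closure_tri.
Qed.

Section Additive.
Variables (V : zmodType).

Definition tri_additive (f : C -> V) : Prop :=
  forall x y z, tri x y z -> f y = f x + f z.

Variable f : C -> V.
Hypothesis fA : tri_additive f.

Lemma additive_zero x : is_zero x -> f x = 0.
Proof. by move=> x0; apply: (addrI (f x)); rewrite addr0 -(fA (tri_id x x0)). Qed.

Lemma additive_iso x y : isomorphic x y -> f x = f y.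
Proof.
move=> xy; have [z z0] := has_zero C.
have H : tri x y z.
  apply: (tri_iso (tri_id x z0)) => //; exact: isomorphic_refl.
by rewrite (fA H) (additive_zero z0) addr0.
Qed.

Lemma additive_shift x : f (shift x) = - f x.
Proof.
have [z z0] := has_zero C.
have := fA (tri_rotate (tri_id x z0)); rewrite (additive_zero z0) => /eqP.
by rewrite eq_sym addr_eq0 => /eqP ->; rewrite opprK.
Qed.

End Additive.
End TriangulatedTheory.

(** * t-structures, hearts and their lengths *)

(* [L n] and [Rr n] stand for D[n] and D^⊥[n]. *)
Record t_family (C : triangulated_category) (L Rr : int -> set C) : Prop := TFamily {
  tf_isoL : forall n, strict (L n);
  tf_isoR : forall n, strict (Rr n);
  tf_shiftL : forall n x, L (n + 1) (shift x) <-> L n x;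
  tf_shiftR : forall n x, Rr (n + 1) (shift x) <-> Rr n x;
  tf_decL : forall n, L (n + 1) `<=` L n;
  tf_incR : forall n, Rr n `<=` Rr (n + 1);
  tf_hom : forall n x y, L n x -> Rr n y -> forall f : hom x y, f = 0;
  tf_tri : forall n c, exists x y, [/\ L n x, Rr n y & tri x c y];
  tf_bndL : forall c, exists n, L n c;
  tf_bndR : forall c, exists n, Rr n c
}.

Definition hrt (C : triangulated_category) (L Rr : int -> set C) (n : int) : set C :=
  L n `&` Rr (n + 1).

Section TFamilyTheory.
Variable C : triangulated_category.
Variables L Rr : int -> set C.
Hypothesis tf : t_family L Rr.
Implicit Types (x y z c : C) (n m : int).
Notation H := (hrt L Rr).

Lemma tf_leL n m : n <= m -> L m `<=` L n.
Proof.
move=> nm; have -> : m = n + `|m - n|%N%:Z by lia.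
elim: `|m - n|%N => [|k IH] x; first by rewrite addr0.
by rewrite -addn1 PoszD addrA => /(tf_decL tf); exact: IH.
Qed.

Lemma tf_leR n m : n <= m -> Rr n `<=` Rr m.
Proof.
move=> nm; have -> : m = n + `|m - n|%N%:Z by lia.
elim: `|m - n|%N => [|k IH] x; first by rewrite addr0.
by rewrite -addn1 PoszD addrA => /IH; exact: (tf_incR tf).
Qed.

Lemma tf_hom_le n m x y : L m x -> Rr n y -> n <= m -> forall f : hom x y, f = 0.
Proof. by move=> Lx Ry nm; apply: (tf_hom tf (n := n)) => //; exact: tf_leL Lx. Qed.

Lemma tf_L0 n x : is_zero x -> L n x.
Proof.
move=> x0; have [u [v [Lu Rv [f [g [h T]]]]]] := tf_tri tf n x.
have v0 : is_zero v.
  apply: (tri_g0 T); first exact: zero_to.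
  apply: (tf_hom_le (m := n + 1) (n := n)) => //; first exact/(tf_shiftL tf).
  by rewrite lerDl.
by apply: (tf_isoL tf) Lu; exists f; exact: tri_zero_r T v0.
Qed.

(** In the truncation triangle of [x] the map to the second term vanishes, so that term is zero. *)
Lemma tf_perpL n x : (forall y, Rr n y -> forall f : hom x y, f = 0) -> L n x.
Proof.
move=> Hx; have [u [v [Lu Rv [f [g [h T]]]]]] := tf_tri tf n x.
have v0 : is_zero v.
  apply: (tri_g0 T); first exact: Hx.
  apply: (tf_hom_le (m := n + 1) (n := n)) => //; first exact/(tf_shiftL tf).
  by rewrite lerDl.
by apply: (tf_isoL tf) Lu; exists f; exact: tri_zero_r T v0.
Qed.

Lemma tf_perpR n y : (forall x, L n x -> forall f : hom x y, f = 0) -> Rr n y.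
Proof.
move=> Hy; have [u [v [Lu Rv [f [g [h T]]]]]] := tf_tri tf n y.
have u0 : is_zero u.
  apply: (tri_f0 T); first exact: Hy.
  apply: (tf_hom_le (m := n + 1) (n := n)) => //; first exact/(tf_shiftL tf).
  by rewrite lerDl.
by apply: (tf_isoR tf) Rv; apply: isomorphic_sym; exists g; exact: tri_zero_l T u0.
Qed.

Lemma tf_R0 n x : is_zero x -> Rr n x.
Proof. by move=> x0; apply: tf_perpR => y _ f; exact: to_zero. Qed.

Lemma tf_zero n x : L n x -> Rr n x -> is_zero x.
Proof. by move=> Lx Rx; rewrite /is_zero (tf_hom tf Lx Rx (idm x)). Qed.

Lemma tf_extL n x y z : tri x y z -> L n x -> L n z -> L n y.
Proof.
move=> T Lx Lz; apply: tf_perpL => w Rw.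
by apply: (hom_ext_l T) => f; exact: (tf_hom tf) Rw _.
Qed.

Lemma tf_extR n x y z : tri x y z -> Rr n x -> Rr n z -> Rr n y.
Proof.
move=> T Rx Rz; apply: tf_perpR => w Lw.
by apply: (hom_ext_r T) => f; exact: (tf_hom tf) Lw _ _.
Qed.

Lemma tf_coneL n x y z : tri x y z -> L n y -> L (n - 1) x -> L n z.
Proof.
move=> /tri_rotate T Ly Lx; apply: (tf_extL T) => //.
by rewrite -(subrK 1 n); apply/(tf_shiftL tf).
Qed.

Lemma tf_fibR n x y z : tri x y z -> Rr n y -> Rr (n + 1) z -> Rr n x.
Proof.
move=> [f [g [h T]]] Ry Rz; apply: tf_perpR => w Lw u.
have [v ve] := tri_ker3 T (tf_hom tf Lw Ry (f \oc u)).
apply: shiftm_inj; rewrite ve (tf_hom tf (n := n + 1) _ Rz v) ?comp0r ?shiftm0//.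
exact/(tf_shiftL tf).
Qed.

Lemma hrt0 n x : is_zero x -> H n x.
Proof. by move=> x0; split; [exact: tf_L0|exact: tf_R0]. Qed.

Lemma hrt_strict n : strict (H n).
Proof.
by move=> x y xy [Lx Rx]; split; [exact: (tf_isoL tf) Lx|exact: (tf_isoR tf) Rx].
Qed.

Lemma hrt_ext n x y z : tri x y z -> H n x -> H n z -> H n y.
Proof.
by move=> T [Lx Rx] [Lz Rz]; split; [exact: tf_extL T _ _|exact: tf_extR T _ _].
Qed.

Lemma hrt_shift n x : H (n + 1) (shift x) <-> H n x.
Proof. by split=> -[a b]; split; apply/(tf_shiftL tf) || apply/(tf_shiftR tf). Qed.

Lemma tf_truncL n c : L n c -> exists x a, [/\ L (n + 1) x, H n a & tri x c a].
Proof.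
move=> Lc; have [x [a [Lx Ra T]]] := tf_tri tf (n + 1) c.
exists x, a; split=> //; split=> //; apply: (tf_coneL T) => //.
by apply: tf_leL Lx; lia.
Qed.

(** The obstruction is a map from [shift w] to [z], which vanishes by orthogonality; thus the first
    map of a triangle in the heart is a monomorphism. *)
Lemma hrt_mono n x y z (f : hom x y) (g : hom y z) (h : hom z (shift x)) w
    (u : hom w x) :
  triangle f g h -> L n w -> Rr (n + 1) z -> f \oc u = 0 -> u = 0.
Proof.
move=> T Lw Rz fu; have [v ve] := tri_ker3 T fu.
apply: shiftm_inj; rewrite ve (tf_hom tf (n := n + 1) _ Rz v) ?comp0r ?shiftm0//.
exact/(tf_shiftL tf).
Qed.

Lemma hrt_epi n x y z (f : hom x y) (g : hom y z) (h : hom z (shift x)) w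
    (u : hom z w) :
  triangle f g h -> L n x -> Rr (n + 1) w -> u \oc g = 0 -> u = 0.
Proof.
move=> T Lx Rw ug; have [v ->] := tri_coker2 T ug.
rewrite (tf_hom tf (n := n + 1) _ Rw v) ?comp0l//; exact/(tf_shiftL tf).
Qed.

(* Image factorisation in the heart: the cone z of f has cohomology the kernel
   and the cokernel of f, and the octahedral axiom produces the image. *)
Lemma hrt_factor n x y (f : hom x y) : H n x -> H n y ->
  exists k i c (j : hom k x) (e : hom x i) (q : hom i (shift k))
    (m : hom i y) (p : hom y c) (r : hom c (shift i)),
    [/\ H n k, H n i & H n c] /\
    [/\ triangle j e q, triangle m p r & m \oc e = f].
Proof.
move=> Hx Hy; have [z [g [h T]]] := TR1_cone f.
have Lz : L n z.
  apply: (tf_coneL (x := x) (y := y)); first by exists f, g, h.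
    by case: Hy.
  by apply: tf_leL (proj1 Hx); lia.
have Rz : Rr (n + 1 + 1) z.
  apply: (tf_extR (tri_rotate (ex_intro _ f (ex_intro _ g (ex_intro _ h T))))).
    by apply: tf_leR (proj2 Hy); lia.
  by apply/(tf_shiftR tf); case: Hx.
have [z1 [z0 [Lz1 Hz0 T1]]] := tf_truncL Lz.
have Rz1 : Rr (n + 1 + 1) z1.
  by apply: (tf_fibR T1) => //; apply: tf_leR (proj2 Hz0); lia.
case: T1 => i' [p' [k' T1]].
have [i [m [r [e [e' [q [T2 T3 me]]]]]]] := oct_fib T T1.
have [k [j [q' [eps [He T4 _]]]]] := tri_unrot T3.
exists k, i, z0, j, e, q', m, (p' \oc g), r.
have Hk : H n k.
  have kz : isomorphic z1 (shift k) by apply: isomorphic_sym; exists eps.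
  by apply/hrt_shift; split; [exact: (tf_isoL tf) Lz1|exact: (tf_isoR tf) Rz1].
split; split=> //; split.
- apply: (tf_coneL (x := k) (y := x)); first by exists j, e, q'.
    by case: Hx.
  by apply: tf_leL (proj1 Hk); lia.
- apply: (tf_fibR (y := y) (z := z0)); first by exists m, (p' \oc g), r.
    by case: Hy.
  by apply: tf_leR (proj2 Hz0); lia.
Qed.

Lemma tri_f0_hrt n x y z (f : hom x y) (g : hom y z) (h : hom z (shift x)) :
  triangle f g h -> L n x -> Rr (n + 1) z -> f = 0 -> is_zero x.
Proof.
move=> T Lx Rz f0; rewrite /is_zero.
by apply: (hrt_mono T Lx Rz); rewrite f0 comp0l.
Qed.

Lemma tri_g0_hrt n x y z (f : hom x y) (g : hom y z) (h : hom z (shift x)) :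
  triangle f g h -> L n x -> Rr (n + 1) z -> g = 0 -> is_zero z.
Proof.
move=> T Lx Rz g0; rewrite /is_zero.
by apply: (hrt_epi T Lx Rz); rewrite g0 comp0r.
Qed.

(** In the image factorisation the kernel is annihilated by the monomorphism [f], hence zero, and
    [f] is its own image. *)
Lemma mono_tri n x y (f : hom x y) : H n x -> H n y -> mono (H n) f ->
  exists c (p : hom y c) (r : hom c (shift x)), H n c /\ triangle f p r.
Proof.
move=> Hx Hy fm; have [k [i [c [j [e [q [m [p [r [[Hk Hi Hc] [T1 T2 me]]]]]]]]]]] :=
  hrt_factor f Hx Hy.
have k0 : is_zero k.
  apply: (tri_f0_hrt T1 (proj1 Hk) (proj2 Hi)); apply: fm => //.
  by rewrite -me -compA (tri_comp0 T1) comp0r.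
have [e' [e1 e2]] := tri_zero_l T1 k0.
exists c, p, (shiftm e' \oc r); split=> //.
apply: (TR1_iso T2 (u := e') (v := idm y) (w := idm c)); try exact: is_iso_id.
- by exists e.
- by rewrite -me -compA e2 comp_idr comp_idl.
- by rewrite comp_idl comp_idr.
- by rewrite comp_idr.
Qed.

Lemma tri_kernel n x y z (f : hom x y) (g : hom y z) (h : hom z (shift x)) :
  H n x -> H n y -> H n z -> triangle f g h -> is_kernel (H n) f g.
Proof.
move=> Hx Hy Hz T; split=> [|w u Hw gu]; first exact: tri_comp0 T.
have [v ->] := tri_ker T gu; exists v; split=> // v' fv.
apply/eqP; rewrite eq_sym -subr_eq0; apply/eqP.
by apply: (hrt_mono T (proj1 Hw) (proj2 Hz)); rewrite compBr fv subrr.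
Qed.

Lemma kernel_mono n x y z (f : hom x y) (g : hom y z) :
  is_kernel (H n) f g -> mono (H n) f.
Proof.
move=> [gf Hk] w u Hw fu; have [|v [_ Hv]] := Hk w (f \oc u) Hw.
  by rewrite compA gf comp0l.
by rewrite -(Hv u)// (Hv 0)// comp0r fu.
Qed.

(** The cone [c] of the monomorphism [f] lies in the heart and satisfies the same universal property
    as the cokernel [z]. *)
Lemma short_exact_tri n x y z (f : hom x y) (g : hom y z) :
  short_exact (H n) f g -> tri x y z.
Proof.
move=> [Hx Hy Hz fk [_ gc]].
have [c [p [r [Hc T]]]] := mono_tri Hx Hy (kernel_mono fk).
have [v [vp _]] := gc c p Hc (tri_comp0 T).
have [w gw] := tri_coker T (proj1 fk).
have wg : isomorphic c z.
  exists w, v; split.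
    apply/eqP; rewrite -subr_eq0; apply/eqP.
    apply: (hrt_epi T (proj1 Hx) (proj2 Hc)).
    by rewrite compBl -compA -gw vp comp_idl subrr.
  have [//|u [_ Hu]] := gc z g Hz; first by case: fk.
  rewrite -(Hu (w \oc v)) ?(Hu (idm z))//; first exact: comp_idl.
  by rewrite -compA vp -gw.
have [g' [h' T']] := tri_isor T wg.
by exists f, g', h'.
Qed.

End TFamilyTheory.

(** * The truncations of a bounded t-structure *)

Section HeartFamily.
Variable C : triangulated_category.
Implicit Types (S D : set C) (x y : C) (n : int).

Lemma strict_shift_up S : strict (shift_up S).
Proof.
move=> x y xy [z Sz xz]; exists z => //.
exact: isomorphic_trans (isomorphic_sym xy) xz.
Qed.

Lemma shift_up_shift S x : strict S -> shift_up S (shift x) <-> S x.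
Proof.
move=> sS; split=> [[y Sy /isomorphic_shift xy]|Sx].
  by apply: sS Sy; exact: isomorphic_sym.
by exists x => //; exact: isomorphic_refl.
Qed.

Lemma strict_translate n S : strict S -> strict (translate n S).
Proof.
have sd S' : strict S' -> strict (shift_down S').
  by move=> sS x y /isomorphic_shift; exact: sS.
move=> sS; case: n => k /=; last by elim: k => [|k IH] /=; exact: sd.
by elim: k => [|k IH] //=; exact: strict_shift_up.
Qed.

Lemma translate_shift n S x : strict S ->
  translate (n + 1) S (shift x) <-> translate n S x.
Proof.
move=> sS; case: n => [k|[|k]].
- rewrite -PoszD addn1 /=.
  exact/shift_up_shift/(@strict_translate k%:Z).
- exact: iff_refl.
- have -> : Negz k.+1 + 1 = Negz k by rewrite !NegzE; lia.
  exact: iff_refl.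
Qed.

Lemma shift_surj_iso y : exists x, isomorphic y (shift x).
Proof. by have [x /isomorphic_sym] := shift_ess_surj y; exists x. Qed.

Lemma translateS n S : strict S -> translate (n + 1) S = shift_up (translate n S).
Proof.
move=> sS; apply/seteqP; split=> y; have [x yx] := shift_surj_iso y.
- move=> /(strict_translate sS yx) /(translate_shift _ _ sS) Sx.
  by exists x.
- move=> /(strict_shift_up yx) /(shift_up_shift _ (strict_translate sS)) Sx.
  apply: (strict_translate sS (isomorphic_sym yx)).
  exact/(translate_shift _ _ sS).
Qed.

Lemma translate_ind (Q : int -> Prop) : Q 0 -> (forall n, Q n -> Q (n + 1)) ->
  (forall n, Q (n + 1) -> Q n) -> forall n, Q n.
Proof.
move=> Q0 Qs Qp [k|k]; first by elim: k => // k IH; rewrite -addn1 PoszD; exact: Qs.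
elim: k => [|k IH]; first by apply: Qp; rewrite NegzE addNr.
by apply: Qp; have -> : Negz k.+1 + 1 = Negz k by rewrite !NegzE; lia.
Qed.

Lemma translate_mono n S D : strict S -> strict D ->
  S `<=` D -> translate n S `<=` translate n D.
Proof.
move=> sS sD SD; elim/translate_ind: n => // n IH x.
- rewrite !translateS// => -[y Sy xy]; exists y => //; exact: IH.
- by move=> /(translate_shift n x sS) /IH /(translate_shift n x sD).
Qed.

Lemma translateD n m S : strict S -> translate n (translate m S) = translate (n + m) S.
Proof.
move=> sS; have sm := strict_translate (n := m) sS.
elim/translate_ind: n => [|n IH|n IH]; first by rewrite add0r.
  by rewrite translateS// IH addrAC translateS.
apply/seteqP; split=> x.
  move=> /(translate_shift n x sm); rewrite IH addrAC => /translate_shift; exact.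
by move=> /(translate_shift _ x sS) Hx; apply/(translate_shift n x sm);
  rewrite IH addrAC.
Qed.

(** Orthogonality and truncation are carried from level 0 to all levels by the shift, in both
    directions; the inclusion of D^⊥ in D^⊥[1] is dual to that of D[1] in D. *)
Lemma t_structure_family D : t_structure D -> bounded D ->
  t_family (fun n => translate n D) (fun n => translate n (right_perp D)).
Proof.
move=> [sD D1 Dtri] Db; have sR := @strict_right_perp C D.
have homn n x y : translate n D x -> translate n (right_perp D) y ->
    forall f : hom x y, f = 0.
  elim/translate_ind: n x y => [x y Dx Dy f|n IH x y|n IH x y].
  - exact: Dy.
  - rewrite !translateS// => -[x' Dx xx'] [y' Dy yy'] f.
    have [x1 xx1] := isomorphic_sym xx'; have [y1 [y2 [y12 y21]]] := yy'.
    have z : y1 \oc f \oc x1 = 0 by apply: hom_shift; exact: IH.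
    move: xx1 => [x2 [x12 x21]].
    have -> : f = y2 \oc (y1 \oc f \oc x1) \oc x2.
      by rewrite !compA y12 comp_idl -compA x21 comp_idr.
    by rewrite z comp0r comp0l.
  - move=> /(translate_shift n x sD) Dx /(translate_shift n y sR) Dy.
    by apply: hom_unshift; exact: IH.
have dec : forall n, translate (n + 1) D `<=` translate n D.
  move=> n; rewrite -translateD//.
  exact: (translate_mono (strict_translate (n := 1) sD) sD D1).
split.
- by move=> n; exact: strict_translate.
- by move=> n; exact: strict_translate.
- by move=> n x; exact: (translate_shift n x).
- by move=> n x; exact: (translate_shift n x).
- exact: dec.
- move=> n.
  have R1 : right_perp D `<=` translate 1 (right_perp D).
    move=> x Rx; have [y xy] := shift_surj_iso x; exists y => //.
    move=> d Dd; apply: hom_unshift => f.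
    have Ry : right_perp D (shift y) by exact: strict_right_perp Rx.
    by apply: Ry; apply: D1; exists d => //; exact: isomorphic_refl.
  have sR1 := strict_translate (n := 1) sR.
  by rewrite -translateD//; exact: (translate_mono sR sR1 R1).
- exact: homn.
- elim/translate_ind => [c|n IH c|n IH c].
  + by have [x [y [f [g [h [Dx Ry T]]]]]] := Dtri c; exists x, y; split=> //;
      exists f, g, h.
  + have [b cb] := shift_surj_iso c; have [x [y [Dx Ry T]]] := IH b.
    exists (shift x), (shift y); split; try exact/translate_shift.
    apply: (tri_iso (tri_shifted T)); try exact: isomorphic_refl.
    exact: isomorphic_sym.
  + have [x [y [Dx Ry T]]] := IH (shift c).
    have [x' xx'] := shift_surj_iso x; have [y' yy'] := shift_surj_iso y.
    exists x', y'; split.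
    * by apply/translate_shift => //; exact: (strict_translate sD) Dx.
    * by apply/translate_shift => //; exact: (strict_translate sR) Ry.
    * apply: tri_of_rot; apply: (tri_iso T) => //; exact: isomorphic_refl.
- by move=> c; have [n [Lc _]] := Db c; exists (- n%:Z).
- by move=> c; have [n [_ Rc]] := Db c; exists n%:Z.
Qed.

Lemma is_heart_family A : is_heart A ->
  exists L Rr : int -> set C, t_family L Rr /\ A = hrt L Rr 0.
Proof.
move=> [D [Dt Db ->]]; exists (fun n => translate n D), (fun n => translate n (right_perp D)).
by split; first exact: t_structure_family.
Qed.

End HeartFamily.

(** * Hearts of finite length: chain conditions, Schur's lemma, composition series *)

Section FiniteLength.
Variable C : triangulated_category.
Variables L Rr : int -> set C.
Hypothesis tf : t_family L Rr.
Implicit Types (x y z s : C).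
Notation H := (hrt L Rr 0).

(** Dependent choice turns a counterexample into an endless chain of proper subobjects of [y]. The
    octahedral axiom keeps the cones of the composites into [y] inside the heart, so these are
    kernels and the chain condition applies. *)
Lemma artinian_ind (Q : C -> Prop) : artinian H ->
  (forall y, H y ->
    (forall x z, H x -> H z -> ~ is_zero z -> tri x y z -> Q x) -> Q y) ->
  forall y, H y -> Q y.
Proof.
move=> art IH y Hy; apply: contrapT => nQ.
pose bad := {y : C | H y /\ ~ Q y}.
have step (b : bad) : exists (b' : bad) (i : hom (sval b') (sval b)),
    exists z (p : hom (sval b) z) r, [/\ H z, ~ is_zero z & triangle i p r].
  case: b => x [Hx nQx] /=; apply: contrapT => no; apply: nQx; apply: IH => //.
  move=> x' z Hx' Hz z0 [i [p [r T]]]; apply: contrapT => nQx'.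
  by apply: no; exists (exist _ x' (conj Hx' nQx')), i, z, p, r.
pose nx b : bad := sval (cid (step b)).
have nxP b := svalP (cid (step b)).
pose im b : hom (sval (nx b)) (sval b) := sval (cid (nxP b)).
have imP b := svalP (cid (nxP b)).
pose b n : bad := iter n nx (exist _ y (conj Hy nQ)).
pose fix I n : hom (sval (b n)) y :=
  match n with 0%N => idm y | n'.+1 => I n' \oc im (b n') end.
have HI n : exists z (p : hom y z) r, H z /\ triangle (I n) p r.
  elim: n => [|n [z [p [r [Hz T]]]]].
    have [z0 Hz0] := has_zero C.
    by exists z0, 0, 0; split; [exact: (hrt0 tf)|exact: TR1_id].
  have [z' [p' [r' [Hz' _ T']]]] := imP (b n).
  have [v [e [k [T3 T4]]]] := oct_cof T' T.
  by exists v, e, k; split=> //; exact: (hrt_ext tf T4).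
have Hb n : H (sval (b n)) by case: (b n) => ? [].
have [N /(_ N (leqnn N)) [w ww]] : exists N, forall n, (N <= n)%N ->
    factors_through (I n) (I n.+1).
  apply: art => // n; last by exists (im (b n)).
  split=> //; have [z [p [r [Hz T]]]] := HI n.
  by exists z, p; split=> //; exact: (tri_kernel tf (Hb n) Hy Hz T).
have [z [p [r [Hz z0 T]]]] := imP (b N).
apply: z0; apply: (tri_g0_hrt tf T (proj1 (Hb N.+1)) (proj2 Hz)).
have [z' [p' [r' [Hz' T']]]] := HI N.
(* Stabilisation provides a section of the inclusion [im (b N)], which forces its nonzero cokernel
   to vanish. *)
have e : im (b N) \oc w = idm _.
  apply/eqP; rewrite -subr_eq0; apply/eqP.
  apply: (hrt_mono tf T' (proj1 (Hb _)) (proj2 Hz')).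
  by rewrite compBr compA comp_idr -[I N \oc im _]/(I N.+1) -ww subrr.
by rewrite -(comp_idr p) -e compA (tri_comp0 T) comp0l.
Qed.

(** The chain condition speaks of subobjects while the induction passes to quotients: it is applied
    to the kernels [k n] of the composite quotient maps [P n]. *)
Lemma noetherian_ind (Q : C -> Prop) : noetherian H ->
  (forall y, H y ->
    (forall x z, H x -> H z -> ~ is_zero x -> tri x y z -> Q z) -> Q y) ->
  forall y, H y -> Q y.
Proof.
move=> noe IH y Hy; apply: contrapT => nQ.
pose bad := {y : C | H y /\ ~ Q y}.
have step (b : bad) : exists (b' : bad) (p : hom (sval b) (sval b')),
    exists x (i : hom x (sval b)) r, [/\ H x, ~ is_zero x & triangle i p r].
  case: b => z [Hz nQz] /=; apply: contrapT => no; apply: nQz; apply: IH => //.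
  move=> x z' Hx Hz' x0 [i [p [r T]]]; apply: contrapT => nQz'.
  by apply: no; exists (exist _ z' (conj Hz' nQz')), p, x, i, r.
pose nx b : bad := sval (cid (step b)).
have nxP b := svalP (cid (step b)).
pose im b : hom (sval b) (sval (nx b)) := sval (cid (nxP b)).
have imP b := svalP (cid (nxP b)).
pose b n : bad := iter n nx (exist _ y (conj Hy nQ)).
have Hb n : H (sval (b n)) by case: (b n) => ? [].
pose fix P n : hom y (sval (b n)) :=
  match n with 0%N => idm y | n'.+1 => im (b n') \oc P n' end.
have HP n : exists k (j : hom k y) r, H k /\ triangle j (P n) r.
  elim: n => [|n [k [j [r [Hk T]]]]].
    have [z0 Hz0] := has_zero C; exists z0, 0, 0; split; first exact: (hrt0 tf).
    apply: tri_rotV; rewrite shiftm0 oppr0.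
    by apply: TR1_id; exact/is_zero_shift.
  have [x [i [r' [Hx _ T']]]] := imP (b n).
  have [y' [j' [l [m [m' [q [T1 T2 _]]]]]]] := oct_fib T T'.
  exists y', j', l; split=> //; apply: (hrt_ext tf _ Hk Hx).
  by exists m, m', q.
pose k n := sval (cid (HP n)).
have kP n := svalP (cid (HP n)).
pose j n : hom (k n) y := sval (cid (kP n)).
have jP n := svalP (cid (kP n)).
have Hk n : H (k n) by have [r []] := jP n.
have [N /(_ N (leqnn N)) [w ww]] : exists N, forall n, (N <= n)%N ->
    factors_through (j n.+1) (j n).
  apply: noe => // n; have [r [_ T]] := jP n.
    by split=> //; exists (sval (b n)), (P n); split; [exact: Hb n|]; exact: (tri_kernel tf (Hk n) Hy (Hb n) T).
  have [r' [_ T']] := jP n.+1.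
  by apply: (tri_ker T'); rewrite /= -compA (tri_comp0 T) comp0r.
have [r [_ T]] := jP N; have [r' [_ T']] := jP N.+1.
have [|v vE] := tri_coker (u := P N) T'.
  by change (P N \oc j N.+1 = 0); rewrite ww compA (tri_comp0 T) comp0l.
have [x [i [q [Hx x0 T2]]]] := imP (b N).
have e : v \oc im (b N) = idm _.
  apply/eqP; rewrite -subr_eq0; apply/eqP.
  apply: (hrt_epi tf T (proj1 (Hk _)) (proj2 (Hb _))).
  by rewrite compBl -compA -[im _ \oc P N]/(P N.+1) -vE comp_idl subrr.
apply: x0; apply: (tri_f0_hrt tf T2 (proj1 Hx) (proj2 (Hb N.+1))).
by rewrite -(comp_idl i) -e -compA (tri_comp0 T2) comp0r.
Qed.

Lemma simple_tri x s z : simple H s -> H x -> H z -> tri x s z ->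
  is_zero x \/ is_zero z.
Proof.
move=> [Hs s0 Hsim] Hx Hz [f [g [h T]]].
have [|x0|fi] := Hsim x f Hx; [|by left|right].
  by apply: kernel_mono; exact: (tri_kernel tf Hx Hs Hz T).
apply: (tri_g0_hrt tf T (proj1 Hx) (proj2 Hz)).
case: fi => f' [_ e]; rewrite -(comp_idr g) -e compA (tri_comp0 T); exact: comp0l.
Qed.

Lemma nonsimple_tri y : H y -> ~ is_zero y -> ~ simple H y ->
  exists x z, [/\ H x, H z, ~ is_zero x, ~ is_zero z & tri x y z].
Proof.
move=> Hy y0 ns; apply: contrapT => no; apply: ns; split=> // x i Hx im.
have [c [p [r [Hc T]]]] := mono_tri tf Hx Hy im.
have [x0|x0] := pselect (is_zero x); [by left|right].
apply: (tri_zero_r T); apply: contrapT => c0; apply: no.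
by exists x, c; split=> //; exists i, p, r.
Qed.

Lemma simple_strict x y : isomorphic x y -> simple H x -> simple H y.
Proof.
move=> xy sx; apply: contrapT => nsy.
have Hy : H y by apply: (hrt_strict tf xy); case: sx.
have y0 : ~ is_zero y.
  move=> y0; case: sx => _ x0 _; apply: x0.
  exact: isomorphic_zero y0 (isomorphic_sym xy).
have [a [b [Ha Hb a0 b0 T]]] := nonsimple_tri Hy y0 nsy.
have T' : tri a x b.
  apply: (tri_iso T); try exact: isomorphic_refl; exact: isomorphic_sym.
by have [] := simple_tri sx Ha Hb T'.
Qed.

Lemma simple_quotient y : noetherian H -> H y -> ~ is_zero y ->
  exists x s, [/\ H x, simple H s & tri x y s].
Proof.
move=> noe; move: y; apply: (noetherian_ind noe) => y Hy IH y0.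
have [sy|nsy] := pselect (simple H y).
  have [z Hz] := has_zero C; exists z, y; split=> //; first exact: (hrt0 tf).
  exact: tri_idr.
have [x [z [Hx Hz x0 z0 T]]] := nonsimple_tri Hy y0 nsy.
have [x' [s [Hx' ss T']]] := IH x z Hx Hz x0 T z0.
have [y' T1 T2] := oct_fib_obj T T'.
by exists y', s; split=> //; exact: (hrt_ext tf T2).
Qed.

Lemma length_ind (Q : C -> Prop) : finite_length H ->
  (forall x, is_zero x -> Q x) ->
  (forall x y s, H x -> H y -> simple H s -> tri x y s -> Q x -> Q y) ->
  forall y, H y -> Q y.
Proof.
move=> [art noe] Q0 QS; apply: (artinian_ind art) => y Hy IH.
have [y0|y0] := pselect (is_zero y); first exact: Q0.
have [x [s [Hx ss T]]] := simple_quotient noe Hy y0.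
apply: (QS x y s) => //; apply: (IH x s) => //; by case: ss.
Qed.

Lemma schur s s' (f : hom s s') : simple H s -> simple H s' -> f <> 0 -> is_iso f.
Proof.
move=> Ss Ss' f0; have Hs : H s by case: Ss. have Hs' : H s' by case: Ss'.
have [k [i [c [j [e [q [m [p [r [[Hk Hi Hc] [T1 T2 me]]]]]]]]]]] :=
  hrt_factor tf f Hs Hs'.
have i0 : ~ is_zero i.
  by move=> i0; apply: f0; rewrite -me (to_zero e i0) comp0r.
have [|k0|//] := simple_tri Ss Hk Hi; first by exists j, e, q.
have [|//|c0] := simple_tri Ss' Hi Hc; first by exists m, p, r.
rewrite -me; apply: is_iso_comp; first exact: tri_zero_r T2 c0.
exact: tri_zero_l T1 k0.
Qed.

Lemma simple_epi x s (f : hom x s) : H x -> simple H s -> f <> 0 ->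
  exists k (j : hom k x) q, H k /\ triangle j f q.
Proof.
move=> Hx Ss f0; have Hs : H s by case: Ss.
have [k [i [c [j [e [q [m [p [r [[Hk Hi Hc] [T1 T2 me]]]]]]]]]]] :=
  hrt_factor tf f Hx Hs.
have i0 : ~ is_zero i.
  by move=> i0; apply: f0; rewrite -me (to_zero e i0) comp0r.
have [|//|c0] := simple_tri Ss Hi Hc; first by exists m, p, r.
have [m' [m1 m2]] := tri_zero_r T2 c0.
exists k, j, (q \oc m'); split=> //.
apply: (TR1_iso T1 (u := idm _) (v := idm _) (w := m)); try exact: is_iso_id.
- by exists m'.
- by rewrite comp_idl comp_idr.
- by rewrite comp_idr.
- by rewrite -compA m1 shiftm_id comp_idl comp_idr.
Qed.

Lemma simple_mono s y (f : hom s y) : H y -> simple H s -> f <> 0 ->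
  exists c (p : hom y c) q, H c /\ triangle f p q.
Proof.
move=> Hy Ss f0; have Hs : H s by case: Ss.
have [k [i [c [j [e [q [m [p [r [[Hk Hi Hc] [T1 T2 me]]]]]]]]]]] :=
  hrt_factor tf f Hs Hy.
have i0 : ~ is_zero i.
  by move=> i0; apply: f0; rewrite -me (to_zero e i0) comp0r.
have [|k0|//] := simple_tri Ss Hk Hi; first by exists j, e, q.
have [e' [e1 e2]] := tri_zero_l T1 k0.
exists c, p, (shiftm e' \oc r); split=> //.
apply: (TR1_iso T2 (u := e') (v := idm _) (w := idm _)); try exact: is_iso_id.
- by exists e.
- by rewrite -me -compA e2 comp_idr comp_idl.
- by rewrite comp_idl comp_idr.
- by rewrite comp_idr.
Qed.

Lemma mono_iso x x' y (f : hom x y) (f' : hom x' y) z g h z' g' h'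
    (a : hom x x') (b : hom x' x) :
  H x -> H x' -> H z -> H z' ->
  @triangle C x y z f g h -> @triangle C x' y z' f' g' h' ->
  f = f' \oc a -> f' = f \oc b -> isomorphic x x'.
Proof.
move=> Hx Hx' Hz Hz' T T' fa fb; exists a, b; split;
    apply/eqP; rewrite -subr_eq0; apply/eqP.
  apply: (hrt_mono tf T (proj1 Hx) (proj2 Hz)).
  by rewrite compBr compA -fb -fa comp_idr subrr.
apply: (hrt_mono tf T' (proj1 Hx') (proj2 Hz')).
by rewrite compBr compA -fa -fb comp_idr subrr.
Qed.

(** [g'] factors through [g], and by Schur's lemma the factor is an isomorphism; hence each of [f],
    [f'] factors through the other. *)
Lemma simple_quotient_same x y s x' s' (f : hom x y) (g : hom y s) h
    (f' : hom x' y) (g' : hom y s') h' :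
  H x -> H x' -> simple H s -> simple H s' ->
  triangle f g h -> triangle f' g' h' -> g' \oc f = 0 ->
  [/\ isomorphic x x', isomorphic s s' & g \oc f' = 0].
Proof.
move=> Hx Hx' Ss Ss' T T' gf.
have Hs : H s by case: Ss. have Hs' : H s' by case: Ss'.
have [t tg] := tri_coker T gf; have [a fa] := tri_ker T' gf.
have t0 : t <> 0.
  move=> t0; case: (Ss') => _ []; apply: (tri_g0_hrt tf T' (proj1 Hx') (proj2 Hs')).
  by rewrite tg t0 comp0l.
have tiso := schur Ss Ss' t0.
have gf' : g \oc f' = 0.
  case: tiso => t' [t1 _]; rewrite -(comp_idl g) -t1 -(compA t') -tg -compA.
  by rewrite (tri_comp0 T') comp0r.
have [b fb] := tri_ker T gf'; split=> //; last by exists t.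
exact: (mono_iso Hx Hx' Hs Hs' T T' fa fb).
Qed.

Section JordanHoelder.
Hypothesis flH : finite_length H.
Variables (V : zmodType) (w : C -> V).
Hypothesis w_iso : forall s s', simple H s -> isomorphic s s' -> w s = w s'.

(** [series k v y]: a composition series of [y] with [k] simple factors of total weight [v]. *)
Inductive series : nat -> V -> C -> Prop :=
| series0 x : is_zero x -> series 0 0 x
| seriesS k v x y s : series k v x -> H x -> H y -> simple H s -> tri x y s ->
    series k.+1 (v + w s) y.

Lemma series_iso k v x y : isomorphic x y -> series k v x -> series k v y.
Proof.
move=> xy se; case: se xy => {k v x} [x x0 xy|k v x x' s se Hx Hx' Ss T xy].
  by constructor; exact: isomorphic_zero x0 xy.
apply: (@seriesS k v x y s) => //; first exact: (hrt_strict tf xy).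
by apply: (tri_iso T) => //; exact: isomorphic_refl.
Qed.

Lemma series_exists y : H y -> exists k v, series k v y.
Proof.
move: y; apply: (length_ind flH) => [x x0|x y s Hx Hy Ss T [k [v se]]].
  by exists 0%N, 0; constructor.
by exists k.+1, (v + w s); exact: seriesS se Hx Hy Ss T.
Qed.

Lemma series_inv0 k v x : is_zero x -> series k v x -> k = 0%N /\ v = 0.
Proof.
move=> x0 se; case: se x0 => // {}k {}v z y s _ Hz _ [Hs s0 _] [f [g [h T]]] y0.
by case: s0; apply: (tri_g0_hrt tf T (proj1 Hz) (proj2 Hs)); exact: zero_to.
Qed.

(** Induction on the length. Two different maximal subobjects [x] and [x'] are compared through
    their intersection, represented by [k0] and by [k0']; it has quotient [s'] in [x] and [s] in
    [x']. *)
Lemma series_uniq k v y : series k v y -> forall k' v', series k' v' y ->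
  k = k' /\ v = v'.
Proof.
elim: k v y => [|k IH] v y se k' v' se'.
  have [y0 v0] : is_zero y /\ v = 0 by inversion se.
  by have [-> ->] := series_inv0 y0 se'; rewrite v0.
inversion se as [|k1 u x y1 s sx Hx Hy Ss [f [g [h T]]] e1 e2 e3].
subst k1 y1 v; inversion se' as [x1 y0 e1 e2 e3|k1 u' x' y1 s' sx' Hx' _ Ss' [f' [g' [h' T']]] e1 e2 e3].
  by have [] := series_inv0 y0 se.
subst k' v' y1.
have [gf|gf] := pselect (g' \oc f = 0).
  have [xx ss _] := simple_quotient_same Hx Hx' Ss Ss' T T' gf.
  by have [-> ->] := IH _ _ (series_iso xx sx) _ _ sx'; rewrite (w_iso Ss ss).
have gf' : g \oc f' <> 0.
  move=> gf'; apply: gf.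
  by have [_ _] := simple_quotient_same Hx' Hx Ss' Ss T' T gf'.
have [k0 [j [q [Hk T2]]]] := simple_epi Hx Ss' gf.
have [k0' [j' [q' [Hk' T2']]]] := simple_epi Hx' Ss gf'.
have kk : isomorphic k0 k0'.
  have [|a fa] := tri_ker T' (u := f \oc j); first by rewrite compA (tri_comp0 T2).
  have [|b fb] := tri_ker T2' (u := a).
    by rewrite -compA -fa compA (tri_comp0 T) comp0l.
  have [|a' fa'] := tri_ker T (u := f' \oc j'); first by rewrite compA (tri_comp0 T2').
  have [|b' fb'] := tri_ker T2 (u := a').
    by rewrite -compA -fa' compA (tri_comp0 T') comp0l.
  have [z [e [d [T3 T4]]]] := oct_cof T2 T.
  have [z' [e' [d' [T3' T4']]]] := oct_cof T2' T'.
  have Hz : H z by apply: (hrt_ext tf T4); [case: Ss'|case: Ss].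
  have Hz' : H z' by apply: (hrt_ext tf T4'); [case: Ss|case: Ss'].
  apply: (mono_iso Hk Hk' Hz Hz' T3 T3' (a := b) (b := b')).
    by rewrite fa fb compA.
  by rewrite fa' fb' compA.
have [l [t st]] := series_exists Hk.
have se1 : series l.+1 (t + w s') x by apply: (seriesS st Hk Hx Ss'); exists j, (g' \oc f), q.
have se2 : series l.+1 (t + w s) x'.
  by apply: (seriesS (series_iso kk st) Hk' Hx' Ss); exists j', (g \oc f'), q'.
have [ek ->] := IH _ _ sx _ _ se1.
rewrite -ek in se2; have [-> <-] := IH _ _ se2 _ _ sx'.
by rewrite addrAC.
Qed.

Lemma jordan_hoelder : exists f : C -> V,
  (forall x y z, H x -> H y -> H z -> tri x y z -> f y = f x + f z) /\
  (forall s, simple H s -> f s = w s).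
Proof.
pose f y := xget 0 [set v | exists k, series k v y].
have fE k v y : series k v y -> f y = v.
  move=> se; have : [set v | exists k, series k v y] (f y).
    by apply: xgetPex; exists v, k.
  by move=> [k' se']; have [_ ->] := series_uniq se se'.
have fS x y s : H x -> H y -> simple H s -> tri x y s -> f y = f x + w s.
  move=> Hx Hy Ss T; have [k [v se]] := series_exists Hx.
  by rewrite (fE _ _ _ se) (fE _ _ _ (seriesS se Hx Hy Ss T)).
have f0 x : is_zero x -> f x = 0 by move=> x0; apply: (fE 0%N); constructor.
have f_iso x y : H x -> isomorphic x y -> f x = f y.
  move=> Hx xy; have [k [v se]] := series_exists Hx.
  by rewrite (fE _ _ _ se) (fE _ _ _ (series_iso xy se)).
exists f; split=> [x y z Hx Hy Hz|s Ss]; last first.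
  have [z Hz] := has_zero C; have Hs : H s by case: Ss.
  by rewrite (fS z s s)// ?f0 ?add0r//; [exact: (hrt0 tf)|exact: tri_idr].
move: z Hz x y Hx Hy; apply: (length_ind flH) => [z z0|z' z s Hz' Hz Ss T IH] x y Hx Hy T'.
  rewrite (f0 _ z0) addr0; apply/esym/f_iso => //.
  by case: T' => u [g [h T']]; exists u; exact: tri_zero_r T' z0.
have [y' T1 T2] := oct_fib_obj T' T.
have Hy' : H y' by exact: (hrt_ext tf T2).
by rewrite (fS _ _ _ Hy' Hy Ss T1) (IH _ _ Hx Hy' T2) (fS _ _ _ Hz' Hz Ss T) addrA.
Qed.

End JordanHoelder.
End FiniteLength.

(** * Cohomology and additive functions *)

Section Cohomology.
Variable C : triangulated_category.
Variables L Rr : int -> set C.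
Hypothesis tf : t_family L Rr.
Implicit Types (x y z c a : C) (n m : int).
Notation H := (hrt L Rr).

Lemma trunc_uniq n c x y x' y' : tri x c y -> tri x' c y' ->
  L n x -> L n x' -> Rr n y -> Rr n y' -> isomorphic x x' /\ isomorphic y y'.
Proof.
move=> [f [g [h T]]] [f' [g' [h' T']]] Lx Lx' Ry Ry'.
have RS w : Rr n w -> Rr (n + 1) w by exact: (tf_incR tf).
have [a fa] := tri_ker T' (tf_hom tf Lx Ry' (g' \oc f)).
have [b fb] := tri_ker T (tf_hom tf Lx' Ry (g \oc f')).
have [a' ga] := tri_coker T (tf_hom tf Lx Ry' (g' \oc f)).
have [b' gb] := tri_coker T' (tf_hom tf Lx' Ry (g \oc f')).
split; [exists a, b; split|exists a', b'; split]; apply/eqP; rewrite -subr_eq0; apply/eqP.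
- apply: (hrt_mono tf T Lx (RS _ Ry)).
  by rewrite compBr compA -fb -fa comp_idr subrr.
- apply: (hrt_mono tf T' Lx' (RS _ Ry')).
  by rewrite compBr compA -fa -fb comp_idr subrr.
- apply: (hrt_epi tf T Lx (RS _ Ry)).
  by rewrite compBl -compA -ga -gb comp_idl subrr.
- apply: (hrt_epi tf T' Lx' (RS _ Ry')).
  by rewrite compBl -compA -gb -ga comp_idl subrr.
Qed.

(* [b] tells whether the values of [G] change sign under the shift: [true] for
   functions on the Grothendieck group, [false] for heights. *)
Variables (V : zmodType) (b : bool).
Definition sgn_op (v : V) := if b then - v else v.
Notation e := sgn_op.
Variables (G : int -> C -> V) (N : V -> Prop).
Hypothesis GA : forall n x y z, H n x -> H n y -> H n z -> tri x y z ->
  G n y = G n x + G n z.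
Hypothesis Gs : forall n x, H n x -> G (n + 1) (shift x) = e (G n x).
Hypothesis N0 : N 0.
Hypothesis ND : forall u v, N u -> N v -> N (u + v).
Hypothesis Ne : forall v, N v -> N (e v).
Hypothesis NG : forall n x, H n x -> N (G n x).

Lemma sgn_opD u v : e (u + v) = e u + e v.
Proof. by rewrite /e; case: b => //; rewrite opprD. Qed.

Lemma sgn_opK v : e (e v) = v.
Proof. by rewrite /e; case: b => //; rewrite opprK. Qed.

Lemma G_zero n x : is_zero x -> G n x = 0.
Proof.
move=> x0; have Hx := hrt0 tf n x0; apply: (addrI (G n x)).
by rewrite addr0 -(GA Hx Hx Hx (tri_id x x0)).
Qed.

Lemma G_iso n x y : H n x -> isomorphic x y -> G n x = G n y.
Proof.
move=> Hx xy; have [z z0] := has_zero C.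
have T : tri x y z.
  apply: (tri_iso (tri_id x z0)) => //; exact: isomorphic_refl.
rewrite (GA Hx (hrt_strict tf xy Hx) (hrt0 tf n z0) T) (G_zero n z0).
by rewrite addr0.
Qed.

(** [coh c v]: splitting off top cohomologies one after the other, [v] is the sum of [G] over them.
    Levels may be skipped and pieces may be zero, so derivations are not unique. *)
Inductive coh : C -> V -> Prop :=
| coh0 x : is_zero x -> coh x 0
| cohS n c' c a v : L (n + 1) c' -> H n a -> tri c' c a -> coh c' v ->
    coh c (v + G n a).

(** If two derivations start at different levels, the piece at the lower level is zero and is
    dropped; at equal levels the truncation is unique. *)
Lemma coh_uniq c v c1 v1 : coh c v -> coh c1 v1 -> isomorphic c c1 -> v = v1.
Proof.
have top n m c' a x : L (n + 1) c' -> H n a -> tri c' x a -> L m x -> n < m ->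
    isomorphic c' x /\ G n a = 0.
  move=> Lc Ha T Lx nm; suff a0 : is_zero a.
    split; last exact: G_zero.
    by case: T => f [g [h T]]; exists f; exact: tri_zero_r T a0.
  apply: (tf_zero tf (n := n + 1)); last by case: Ha.
  apply: (tf_coneL tf T); first by apply: (tf_leL tf) Lx; lia.
  by apply: (tf_leL tf) Lc; lia.
have lev n c' a x : L (n + 1) c' -> H n a -> tri c' x a -> L n x.
  move=> Lc [La _] T; apply: (tf_extL tf T) => //.
  by apply: (tf_leL tf) Lc; lia.
move=> co; elim: co c1 v1 => {c v} [x x0|n c' c a v Lc Ha T co IH] c1 v1 co1.
  elim: co1 => {c1 v1} [//|n c' c a v Lc Ha T co IH xc].
  have Lx : L (n + 1) c by apply: (tf_L0 tf); exact: isomorphic_zero x0 xc.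
  have [|e1 ->] := top _ (n + 1) _ _ _ Lc Ha T Lx; first by lia.
  rewrite addr0; apply: IH; exact: isomorphic_trans xc (isomorphic_sym e1).
elim: co1 => {c1 v1} [y y0 cy|m d' d a' w Ld Ha' T' co' IH' cd].
  have Lx : L (n + 1) c.
    by apply: (tf_L0 tf); apply: (isomorphic_zero y0); exact: isomorphic_sym.
  have [|e1 ->] := top _ (n + 1) _ _ _ Lc Ha T Lx; first by lia.
  rewrite addr0; apply: (IH y); first by constructor.
  exact: isomorphic_trans e1 cy.
have Lc0 := lev _ _ _ _ Lc Ha T; have Ld0 := lev _ _ _ _ Ld Ha' T'.
have [nm|mn|nm] := ltgtP n m.
- have Lcm : L m c by apply: (tf_isoL tf (isomorphic_sym cd)).
  have [e1 ->] := top _ _ _ _ _ Lc Ha T Lcm nm.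
  rewrite addr0; apply: (IH d); first by apply: (cohS Ld Ha' T').
  exact: isomorphic_trans e1 cd.
- have Ldn : L n d by apply: (tf_isoL tf cd).
  have [e1 ->] := top _ _ _ _ _ Ld Ha' T' Ldn mn.
  rewrite addr0; apply: IH'; exact: isomorphic_trans cd (isomorphic_sym e1).
- subst m; have T2 : tri d' c a'.
    apply: (tri_iso T'); try exact: isomorphic_refl; exact: isomorphic_sym.
  have [i1 i2] := trunc_uniq T T2 Lc Ld (proj2 Ha) (proj2 Ha').
  by rewrite (G_iso Ha i2) (IH _ _ co' i1).
Qed.

Lemma coh_exists c : exists v, coh c v.
Proof.
have [n Lc] := tf_bndL tf c; have [m Rc] := tf_bndR tf c.
have {}Rc : Rr (n + `|m - n|%N%:Z) c by apply: (tf_leR tf) Rc; lia.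
move: `|m - n|%N Rc => d Rc; elim: d n c Lc Rc => {m} [|d IH] n c Lc Rc.
  exists 0; constructor; apply: (tf_zero tf Lc); by rewrite addr0 in Rc.
have [x [a [Lx Ha T]]] := tf_truncL tf Lc.
have [||v co] := IH (n + 1) x => //.
  apply: (tf_fibR tf T); first by apply: (tf_leR tf) Rc; lia.
  by apply: (tf_leR tf) (proj2 Ha); lia.
by exists (v + G n a); exact: cohS co.
Qed.

Definition Tco c := sval (cid (coh_exists c)).

Lemma TcoE c v : coh c v -> Tco c = v.
Proof.
by move=> co; apply: (coh_uniq (svalP (cid (coh_exists c))) co); exact: isomorphic_refl.
Qed.

Lemma coh_Tco c : coh c (Tco c).
Proof. exact: svalP (cid (coh_exists c)). Qed.

Lemma Tco0 x : is_zero x -> Tco x = 0.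
Proof. by move=> x0; apply: TcoE; constructor. Qed.

Lemma Tco_tri n c' c a : L n c' -> H n a -> tri c' c a -> Tco c = Tco c' + G n a.
Proof.
move=> Lc Ha T; have [x [a' [Lx Ha' T']]] := tf_truncL tf Lc.
have [v T1 T2] := oct_cof_obj T' T.
have Hv : H n v by exact: (hrt_ext tf T2).
rewrite (TcoE (cohS Lx Hv T1 (coh_Tco x))) (TcoE (cohS Lx Ha' T' (coh_Tco x))).
by rewrite (GA Ha' Hv Ha T2) addrA.
Qed.

Lemma Tco_hrt n a : H n a -> Tco a = G n a.
Proof.
move=> Ha; have [z z0] := has_zero C.
by rewrite (Tco_tri (tf_L0 tf n z0) Ha (tri_idr a z0)) Tco0// add0r.
Qed.

Lemma Tco_shift c : Tco (shift c) = e (Tco c).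
Proof.
apply: TcoE; elim: (coh_Tco c) => {c} [x x0|n c' c a v Lc Ha T co IH].
  rewrite (_ : e 0 = 0); first by constructor; exact/is_zero_shift.
  by rewrite /e; case: b; rewrite ?oppr0.
rewrite sgn_opD -(Gs Ha); apply: (cohS _ _ (tri_shifted T) IH).
  exact/(tf_shiftL tf).
exact/(hrt_shift tf).
Qed.

(* The long exact cohomology sequence, read off in terms of the sums p, q and r
   of the values of G on the images of its three kinds of maps. It is produced
   by splitting off top cohomologies and rotating the remaining triangle. *)
Lemma long_exact x y z : tri x y z -> exists p q r,
  [/\ N p, N q & N r] /\ [/\ Tco x = p + q, Tco y = q + r & Tco z = r + e p].
Proof.
suff key K (dx dy dz : nat) n x' y' z' : (dx + dy + dz <= K)%N -> tri x' y' z' ->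
    [/\ L n x', L n y' & L n z'] ->
    [/\ Rr (n + dx%:Z) x', Rr (n + dy%:Z) y' & Rr (n + dz%:Z) z'] ->
    exists p q r, [/\ N p, N q & N r] /\
      [/\ Tco x' = p + q, Tco y' = q + r & Tco z' = r + e p].
  move=> T; have [n1 L1] := tf_bndL tf x; have [n2 L2] := tf_bndL tf y.
  have [n3 L3] := tf_bndL tf z; have [m1 R1] := tf_bndR tf x.
  have [m2 R2] := tf_bndR tf y; have [m3 R3] := tf_bndR tf z.
  pose n := Num.min n1 (Num.min n2 n3).
  apply: (key _ `|m1 - n|%N `|m2 - n|%N `|m3 - n|%N n) T _ _; first exact: leqnn.
    by split; [apply: (tf_leL tf) L1|apply: (tf_leL tf) L2|apply: (tf_leL tf) L3]; lia.
  by split; [apply: (tf_leR tf) R1|apply: (tf_leR tf) R2|apply: (tf_leR tf) R3]; lia.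
elim: K dx dy dz n x' y' z' {x y z} => [|K IH] dx dy dz n x y z dK T [Lx Ly Lz] [Rx Ry Rz].
all: have [/andP[/eqP dy0 /eqP dz0]|dyz] := boolP ((dy == 0%N) && (dz == 0%N)).
1,3: have y0 : is_zero y by apply: (tf_zero tf Ly); rewrite dy0 addr0 in Ry.
1,2: have z0 : is_zero z by apply: (tf_zero tf Lz); rewrite dz0 addr0 in Rz.
1,2: have x0 : is_zero x
  by (case: T => f [g [h T]]; apply: (isomorphic_zero y0); apply: isomorphic_sym;
      exists f; exact: tri_zero_r T z0).
1,2: by exists 0, 0, 0; rewrite !Tco0// /e; case: b; rewrite ?oppr0 addr0.
  by move: dyz dK; rewrite leqn0 !addn_eq0 -andbA => /negPf ->; rewrite andbF.
have [z' [c0 [Lz' Hc0 Tz]]] := tf_truncL tf Lz.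
have [y' Ty Txyz] := oct_fib_obj T Tz.
have Ly' : L n y'.
  by apply: (tf_extL tf Txyz) => //; apply: (tf_leL tf) Lz'; lia.
have [y'' [b0 [Ly'' Hb Ty']]] := tf_truncL tf Ly'.
have [z1 zz1] := shift_surj_iso z'.
have T1 : tri z1 x y'.
  apply: tri_unrotate; apply: (tri_iso Txyz) => //; exact: isomorphic_refl.
have [x' Tx T2] := oct_fib_obj T1 Ty'.
have T3 : tri y'' z' (shift x').
  apply: (tri_iso (tri_rotate (tri_rotate T2))); try exact: isomorphic_refl.
  exact: isomorphic_sym.
have Lx' : L (n + 1) (shift x').
  by apply: (tf_coneL tf T3) => //; apply: (tf_leL tf) Ly''; lia.
have RH d a : H n a -> Rr (n + d%:Z + 1) a.
  by move=> [_ Ra]; apply: (tf_leR tf) Ra; lia.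
have Rx' : Rr (n + 1 + dx%:Z) (shift x').
  rewrite addrAC; apply/(tf_shiftR tf); apply: (tf_fibR tf Tx) => //; exact: RH.
have Rz' : Rr (n + 1 + dz.-1%:Z) z'.
  suff Rz' : Rr (n + dz%:Z) z' by apply: (tf_leR tf) Rz'; lia.
  by apply: (tf_fibR tf Tz) => //; exact: RH.
have Ry'' : Rr (n + 1 + dy.-1%:Z) y''.
  suff Ry'' : Rr (n + dy%:Z) y'' by apply: (tf_leR tf) Ry''; lia.
  apply: (tf_fibR tf Ty'); last exact: RH.
  by apply: (tf_fibR tf Ty) => //; exact: RH.
(* The widths of [y] and [z] decrease by one unless already zero, and that of [x] is kept; as [dy]
   and [dz] are not both zero, the sum decreases. *)
have dK' : (dy.-1 + dz.-1 + dx <= K)%N.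
  by move: dyz dK; case: (dy) => [|?]; case: (dz) => [|?] //=; lia.
have [p [q [r [[Np Nq Nr] [Ep Eq Er]]]]] := IH _ _ _ (n + 1) y'' z' (shift x')
  dK' T3 (And3 Ly'' Lz' Lx') (And3 Ry'' Rz' Rx').
have Ex : Tco x' = e r + p.
  by rewrite -[LHS]sgn_opK -Tco_shift Er sgn_opD sgn_opK.
have Nb := NG Hb; have Nc := NG Hc0.
(* Rotation permutes the three kinds of images. At level [n] the new contributions are [b0], the
   image of the cohomology of [x] in that of [y], and [c0], the whole cohomology of [z]. *)
exists (e r), (G n b0 + p), (q + G n c0); split.
  by split; [exact: Ne|exact: ND|exact: ND].
have Lx1 : L n x' by exact/(tf_shiftL tf).
rewrite (Tco_tri Lx1 Hb Tx) (Tco_tri Ly' Hc0 Ty) sgn_opK.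
have Ly''n : L n y'' by apply: (tf_leL tf) Ly''; lia.
have Lz'n : L n z' by apply: (tf_leL tf) Lz'; lia.
rewrite (Tco_tri Ly''n Hb Ty') (Tco_tri Lz'n Hc0 Tz) Ex Ep Eq; split.
- by rewrite -addrA [p + _]addrC.
- by rewrite [p + q + _]addrC !addrA.
- by rewrite addrAC.
Qed.

End Cohomology.

Section Suspension.
Variable C : triangulated_category.
Implicit Types (x y z : C) (n : int).

Definition unshift x : C := sval (cid (shift_ess_surj x)).

Lemma unshiftP x : isomorphic (shift (unshift x)) x.
Proof. exact: svalP (cid (shift_ess_surj x)). Qed.

(** The shift [n] on objects. Negative powers use chosen preimages, so the laws hold only up to
    isomorphism. *)
Definition susp n x : C :=
  match n with Posz k => iter k shift x | Negz k => iter k.+1 unshift x end.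

Lemma susp_succ n x : isomorphic (susp (n + 1) x) (shift (susp n x)).
Proof.
case: n => [k|[|k]].
- by rewrite -PoszD addn1; exact: isomorphic_refl.
- exact/isomorphic_sym/unshiftP.
- have -> : Negz k.+1 + 1 = Negz k by rewrite !NegzE; lia.
  exact/isomorphic_sym/unshiftP.
Qed.

Lemma susp_shift n x : isomorphic (susp n (shift x)) (susp (n + 1) x).
Proof.
elim/translate_ind: n => [|n IH|n IH]; first exact: isomorphic_refl.
  apply: isomorphic_trans (susp_succ _ _) _.
  apply: isomorphic_trans _ (isomorphic_sym (susp_succ _ _)).
  exact/isomorphic_shift.
apply/isomorphic_shift.
apply: isomorphic_trans (isomorphic_sym (susp_succ _ _)) _.
exact: isomorphic_trans IH (susp_succ _ _).
Qed.

Lemma susp_tri n x y z : tri x y z -> tri (susp n x) (susp n y) (susp n z).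
Proof.
move=> T; elim/translate_ind: n => [//|n IH|n IH].
  by apply: (tri_iso (tri_shifted IH)); exact/isomorphic_sym/susp_succ.
by apply: tri_of_rot; apply: (tri_iso IH); exact: susp_succ.
Qed.

End Suspension.

Section AdditiveExtension.
Variable C : triangulated_category.
Variables L Rr : int -> set C.
Hypothesis tf : t_family L Rr.
Notation H := (hrt L Rr).

Lemma hrt_susp (n m : int) x : H n x -> H (n + m) (susp m x).
Proof.
move=> Hx; elim/translate_ind: m => [|m IH|m IH]; first by rewrite addr0.
  rewrite addrA; apply: (hrt_strict tf (isomorphic_sym (susp_succ m x))).
  exact/(hrt_shift tf).
apply/(hrt_shift tf); rewrite -addrA.
exact: (hrt_strict tf (susp_succ m x)) IH.
Qed.

Variable V : zmodType.

Definition zsign (n : int) (v : V) := if odd `|n|%N then - v else v.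

Lemma zsignS (n : int) v : zsign (n + 1) v = - zsign n v.
Proof.
rewrite /zsign; have -> : odd (absz (n + 1)) = ~~ odd `|n|%N.
  by case: n => [k|[|k]] //; [rewrite -PoszD addn1|rewrite !NegzE; lia].
by case: (odd _) => //=; rewrite opprK.
Qed.

Lemma zsignD (n : int) u v : zsign n (u + v) = zsign n u + zsign n v.
Proof. by rewrite /zsign; case: (odd _); rewrite ?opprD. Qed.

Lemma zsignK (n : int) v : zsign n (zsign n v) = v.
Proof. by rewrite /zsign; case: (odd _); rewrite ?opprK. Qed.

Lemma additive_susp (f : C -> V) (n : int) x : tri_additive f -> f (susp n x) = zsign n (f x).
Proof.
move=> fA; elim/translate_ind: n => [//|n IH|n].
  by rewrite (additive_iso fA (susp_succ n x)) (additive_shift fA) IH zsignS.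
by rewrite (additive_iso fA (susp_succ n x)) (additive_shift fA) zsignS => /oppr_inj.
Qed.

(** The extension is the alternating sum of [f] over the cohomologies, moved back to level 0. In the
    long exact sequence the images of the connecting maps enter [x] and [z] with opposite signs and
    cancel. *)
Lemma additive_extension (f : C -> V) :
  (forall x y z, H 0 x -> H 0 y -> H 0 z -> tri x y z -> f y = f x + f z) ->
  exists F : C -> V, tri_additive F /\ forall x, H 0 x -> F x = f x.
Proof.
move=> fA; pose G n x := zsign n (f (susp (- n) x)).
have H0 n x : H n x -> H 0 (susp (- n) x).
  by move=> /(hrt_susp (- n)); rewrite subrr.
have GA n x y z : H n x -> H n y -> H n z -> tri x y z -> G n y = G n x + G n z.
  move=> Hx Hy Hz /(susp_tri (- n)) T.
  by rewrite /G (fA _ _ _ (H0 _ _ Hx) (H0 _ _ Hy) (H0 _ _ Hz) T) zsignD.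
have f0 x : is_zero x -> f x = 0.
  move=> x0; have Hx := hrt0 tf 0 x0; apply: (addrI (f x)).
  by rewrite addr0 -(fA _ _ _ Hx Hx Hx (tri_id x x0)).
have f_iso x y : H 0 x -> isomorphic x y -> f x = f y.
  move=> Hx xy; have [z z0] := has_zero C.
  have T : tri x y z.
    apply: (tri_iso (tri_id x z0)) => //; exact: isomorphic_refl.
  rewrite (fA _ _ _ Hx (hrt_strict tf xy Hx) (hrt0 tf 0 z0) T) (f0 z z0).
  by rewrite addr0.
have Gs n x : H n x -> G (n + 1) (shift x) = sgn_op true (G n x).
  move=> Hx; rewrite /G zsignS /sgn_op; congr (- zsign n _).
  rewrite opprD; apply/esym/f_iso; first exact: H0.
  rewrite -{1}(addrNK 1 (- n)); apply: isomorphic_sym; exact: susp_shift.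
exists (Tco tf G); split=> [x y z T|x Hx]; last first.
  by rewrite (Tco_hrt tf GA Hx) /G /zsign.
have [p [q [r [_ [-> -> ->]]]]] := long_exact tf GA Gs (N := fun=> True)
  Logic.I (fun _ _ _ _ => Logic.I) (fun _ _ => Logic.I) (fun _ _ _ => Logic.I) T.
by rewrite /sgn_op [p + q]addrC addrACA subrr addr0.
Qed.

End AdditiveExtension.

(** * Tilting *)

Section SuspensionHom.
Variable C : triangulated_category.
Implicit Types (x y z : C) (n m : int).

Lemma isomorphic_susp n x y : isomorphic x y -> isomorphic (susp n x) (susp n y).
Proof.
move=> xy; elim/translate_ind: n => [//|n IH|n IH].
  apply: isomorphic_trans (susp_succ _ _) _.
  apply: isomorphic_trans _ (isomorphic_sym (susp_succ _ _)).
  exact/isomorphic_shift.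
apply/isomorphic_shift.
apply: isomorphic_trans (isomorphic_sym (susp_succ _ _)) _.
exact: isomorphic_trans IH (susp_succ _ _).
Qed.

Lemma suspD n m x : isomorphic (susp n (susp m x)) (susp (n + m) x).
Proof.
elim/translate_ind: n => [|n IH|n IH]; first by rewrite add0r; exact: isomorphic_refl.
  apply: isomorphic_trans (susp_succ _ _) _; rewrite addrAC.
  apply: isomorphic_trans _ (isomorphic_sym (susp_succ _ _)).
  exact/isomorphic_shift.
apply/isomorphic_shift.
apply: isomorphic_trans (isomorphic_sym (susp_succ _ _)) _.
by apply: isomorphic_trans IH _; rewrite addrAC; exact: susp_succ.
Qed.

Lemma suspK n x : isomorphic (susp n (susp (- n) x)) x.
Proof.
by apply: isomorphic_trans (suspD _ _ _) _; rewrite subrr; exact: isomorphic_refl.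
Qed.

Lemma hom_iso x x' y y' : isomorphic x x' -> isomorphic y y' ->
  (forall f : hom x y, f = 0) -> forall f : hom x' y', f = 0.
Proof.
move=> xx [d [d' [d1 d2]]] xy; apply: (hom_iso_l xx) => f.
by rewrite -(comp_idl f) -d2 -compA (xy (d' \oc f)) comp0r.
Qed.

Lemma hom_susp n x y : (forall f : hom x y, f = 0) ->
  forall f : hom (susp n x) (susp n y), f = 0.
Proof.
move=> xy; elim/translate_ind: n => [//|n IH|n IH].
  apply: (hom_iso (isomorphic_sym (susp_succ _ _)) (isomorphic_sym (susp_succ _ _))).
  exact: hom_shift.
by apply: hom_unshift; apply: (hom_iso (susp_succ _ _) (susp_succ _ _)).
Qed.

End SuspensionHom.

(** A torsion theory with triangles in place of short exact sequences, the form to which the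
    octahedral axiom applies. *)
Definition torsion_tri (C : triangulated_category) (A T : set C) : Prop :=
  [/\ strict T, T `<=` A
    & forall a, A a -> exists t f, [/\ T t, (A `&` right_perp T) f & tri t a f]].

Section Tilt.
Variable C : triangulated_category.
Variables L Rr : int -> set C.
Hypothesis tf : t_family L Rr.
Implicit Types (x y z t f : C) (n : int) (T : set C).
Notation H := (hrt L Rr).
Notation A := (hrt L Rr 0).

Lemma torsion_theory_tri T : torsion_theory A T -> torsion_tri A T.
Proof.
move=> [sT TA dT]; split=> // a /dT [t [f [i [p [Tt Tf se]]]]].
exists t, f; split=> //; last exact: (short_exact_tri tf se).
by split=> //; case: se.
Qed.

Section TorsionTheory.
Variable T : set C.
Hypothesis TT : torsion_tri A T.
Notation F := (A `&` right_perp T).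

Lemma torsion_left_perp a : A a -> (forall f, F f -> forall u : hom a f, u = 0) -> T a.
Proof.
move=> Aa Ha; case: TT => sT TA /(_ _ Aa) [t [f [Tt Ff [i [p [q Tr]]]]]].
apply: (sT t) => //; exists i; apply: (tri_zero_r Tr).
by apply: (tri_g0_hrt tf Tr (proj1 (TA _ Tt)) (proj2 (proj1 Ff))); exact: Ha.
Qed.

Lemma torsion_quotient x y z : A x -> A z -> tri x y z -> T y -> T z.
Proof.
move=> Ax Az [f [g [h Tr]]] Ty; apply: torsion_left_perp => // w [Aw Tw] u.
by apply: (hrt_epi tf Tr (proj1 Ax) (proj2 Aw)); exact: Tw.
Qed.

Lemma right_perp_sub_object x y z : A x -> A z -> tri x y z ->
  right_perp T y -> right_perp T x.
Proof.
move=> Ax Az [f [g [h Tr]]] Ty w Tw u; case: TT => _ TA _.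
by apply: (hrt_mono tf Tr (proj1 (TA _ Tw)) (proj2 Az)); exact: Ty.
Qed.

Lemma torsion_ext x y z : tri x y z -> T x -> T z -> T y.
Proof.
case: (TT) => _ TA _ Tr Tx Tz; apply: torsion_left_perp.
  by apply: (hrt_ext tf Tr); exact: TA.
by move=> f [_ Ff]; apply: (hom_ext_l Tr) => u; exact: Ff.
Qed.

Lemma torsion_zero x : is_zero x -> T x.
Proof.
move=> x0; apply: torsion_left_perp; first exact: (hrt0 tf).
by move=> f _ u; exact: zero_to.
Qed.

Lemma torsion_ext_closure S : S `<=` T -> ext_closure S `<=` T.
Proof.
move=> ST; apply: ext_closure_sub => //.
- exact: torsion_zero.
- by case: TT.
- exact: torsion_ext.
Qed.

Definition Tn n : set C := [set x | T (susp (- n) x)].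
Definition Fn n : set C := [set x | F (susp (- n) x)].

Lemma strictF : strict F.
Proof.
by move=> x y xy [Ax Fx]; split; [exact: (hrt_strict tf xy)|exact: strict_right_perp Fx].
Qed.

Lemma strict_susp n (S : set C) : strict S -> strict [set x | S (susp n x)].
Proof. by move=> sS x y /(isomorphic_susp n); exact: sS. Qed.

Lemma susp_shiftN (S : set C) n x : strict S ->
  S (susp (- (n + 1)) (shift x)) <-> S (susp (- n) x).
Proof.
have xx : isomorphic (susp (- (n + 1)) (shift x)) (susp (- n) x).
  by apply: isomorphic_trans (susp_shift _ _) _; rewrite opprD addrNK; exact: isomorphic_refl.
by move=> sS; split; apply: sS => //; exact: isomorphic_sym.
Qed.

Lemma Tn_hrt n x : Tn n x -> H n x.
Proof.
case: TT => _ TA _ /TA /(hrt_susp tf n); rewrite add0r.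
by apply: (hrt_strict tf); exact: suspK.
Qed.

Lemma Fn_hrt n x : Fn n x -> H n x.
Proof.
move=> [+ _] => /(hrt_susp tf n); rewrite add0r.
by apply: (hrt_strict tf); exact: suspK.
Qed.

Lemma Tn_Fn n x y : Tn n x -> Fn n y -> forall u : hom x y, u = 0.
Proof.
move=> Tx [_ Fy]; apply: (hom_iso (suspK n x) (suspK n y)).
by apply: hom_susp; exact: Fy.
Qed.

Lemma Tn_Fn_tri n a : H n a -> exists t f, [/\ Tn n t, Fn n f & tri t a f].
Proof.
move=> /(hrt_susp tf (- n)); rewrite subrr => Ha.
case: (TT) => sT _ /(_ _ Ha) [t [f [Tt Ff Tr]]].
have NK (x : C) : isomorphic (susp (- n) (susp n x)) x.
  by have := suspK (- n) x; rewrite opprK.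
exists (susp n t), (susp n f); split.
- by apply: sT Tt; apply: isomorphic_sym; exact: NK.
- by apply: strictF Ff; apply: isomorphic_sym; exact: NK.
- apply: (tri_iso (susp_tri n Tr)); try exact: isomorphic_refl; exact: suspK.
Qed.

(** The aisle and co-aisle of the Happel-Reiten-Smalø tilt. The cohomology at level [n - 1] is
    divided: its torsion part T[n - 1] joins the aisle, its torsion-free part F[n - 1] the
    co-aisle. *)
Definition tiltL n : set C :=
  [set x | exists l t, [/\ L n l, Tn (n - 1) t & tri l x t]].
Definition tiltR n : set C :=
  [set y | exists f r, [/\ Fn (n - 1) f, Rr (n - 1) r & tri f y r]].

Lemma strictT : strict T. Proof. by case: TT. Qed.

Lemma Tn0 n x : is_zero x -> Tn n x.
Proof.
move=> x0; apply: torsion_zero.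
by elim/translate_ind: (- n) => [//|m IH|m IH];
  [apply: isomorphic_zero (isomorphic_sym (susp_succ m x)); exact/is_zero_shift
  |apply/is_zero_shift; exact: isomorphic_zero IH (susp_succ m x)].
Qed.

Lemma Fn0 n x : is_zero x -> Fn n x.
Proof.
move=> x0; have s0 : is_zero (susp (- n) x).
  elim/translate_ind: (- n) => [//|m IH|m IH].
    by apply: isomorphic_zero (isomorphic_sym (susp_succ m x)); exact/is_zero_shift.
  by apply/is_zero_shift; exact: isomorphic_zero IH (susp_succ m x).
by split; [exact: (hrt0 tf)|move=> d _ u; exact: to_zero].
Qed.

Lemma tiltL_L n x : L n x -> tiltL n x.
Proof.
move=> Lx; have [z z0] := has_zero C.
by exists x, z; split=> //; [exact: Tn0|exact: tri_id].
Qed.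

Lemma tiltR_R n x : Rr (n - 1) x -> tiltR n x.
Proof.
move=> Rx; have [z z0] := has_zero C.
by exists z, x; split=> //; [exact: Fn0|exact: tri_idr].
Qed.

Lemma tiltL_sub n x : tiltL n x -> L (n - 1) x.
Proof.
move=> [l [t [Ll /Tn_hrt[Lt _] Tr]]]; apply: (tf_extL tf Tr) => //.
by apply: (tf_leL tf) Ll; lia.
Qed.

Lemma tiltR_sub n x : tiltR n x -> Rr n x.
Proof.
move=> [f [r [/Fn_hrt[_ Rf] Rx Tr]]]; apply: (tf_extR tf Tr).
  by rewrite subrK in Rf.
by apply: (tf_leR tf) Rx; lia.
Qed.

Lemma tilt_family : t_family tiltL tiltR.
Proof.
split.
- move=> n x y xy [l [t [Ll Tt Tr]]]; exists l, t; split=> //.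
  by apply: (tri_iso Tr) => //; exact: isomorphic_refl.
- move=> n x y xy [f [r [Ff Rf Tr]]]; exists f, r; split=> //.
  by apply: (tri_iso Tr) => //; exact: isomorphic_refl.
- move=> n x; split=> -[l [t [Ll Tt Tr]]].
    have [l0 ll0] := shift_surj_iso l; have [t0 tt0] := shift_surj_iso t.
    exists l0, t0; split.
    + by apply/(tf_shiftL tf); exact: (tf_isoL tf) Ll.
    + apply/(susp_shiftN (n - 1) t0 strictT); rewrite subrK; rewrite addrK in Tt.
      by apply: (strict_susp strictT tt0).
    + by apply: tri_of_rot; apply: (tri_iso Tr) => //; exact: isomorphic_refl.
  exists (shift l), (shift t); split; first exact/(tf_shiftL tf).
    rewrite /Tn /= addrK; move/(susp_shiftN (n - 1) t strictT) : Tt => Tt.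
    by rewrite subrK in Tt.
  exact: tri_shifted.
- move=> n x; split=> -[f [r [Ff Rf Tr]]].
    have [f0 ff0] := shift_surj_iso f; have [r0 rr0] := shift_surj_iso r.
    exists f0, r0; split.
    + apply/(susp_shiftN (n - 1) f0 strictF); rewrite subrK; rewrite addrK in Ff.
      by apply: (strict_susp strictF ff0).
    + apply/(tf_shiftR tf); rewrite subrK; rewrite addrK in Rf.
      exact: (tf_isoR tf) Rf.
    + by apply: tri_of_rot; apply: (tri_iso Tr) => //; exact: isomorphic_refl.
  exists (shift f), (shift r); split; last exact: tri_shifted.
    rewrite /Fn /= addrK; move/(susp_shiftN (n - 1) f strictF) : Ff => Ff.
    by rewrite subrK in Ff.
  by rewrite addrK -(subrK 1 n); apply/(tf_shiftR tf).
- by move=> n x /tiltL_sub; rewrite addrK; exact: tiltL_L.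
- by move=> n x /tiltR_sub Rx; apply: tiltR_R; rewrite addrK.
- move=> n x y [l [t [Ll Tt Tx]]] [f [r [Ff Rr' Ty]]].
  have [Lt _] := Tn_hrt Tt; have [_] := Fn_hrt Ff; rewrite subrK => Rf.
  apply: (hom_ext_l Tx); apply: (hom_ext_r Ty).
  + exact: (tf_hom tf Ll Rf).
  + by apply: (tf_hom_le tf Ll Rr'); lia.
  + exact: (Tn_Fn Tt Ff).
  + exact: (tf_hom tf Lt Rr').
- move=> n c; have [u [v [Lu Rv T1]]] := tf_tri tf (n - 1) c.
  have [u0 [a [Lu0 Ha T2]]] := tf_truncL tf Lu; rewrite subrK in Lu0.
  (* The cohomology [a] at level [n - 1] is cut by the torsion theory; two octahedra attach [t] to
     [u0] and [f] to [v]. *)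
  have [t [f [Tt Ff T3]]] := Tn_Fn_tri Ha.
  have [u' T4 T5] := oct_fib_obj T2 T3.
  have [w T6 T7] := oct_cof_obj T4 T1.
  by exists u', w; split=> //; [exists u0, t|exists f, v].
- by move=> c; have [n Lc] := tf_bndL tf c; exists n; exact: tiltL_L.
- move=> c; have [n Rc] := tf_bndR tf c; exists (n + 1); apply: tiltR_R.
  by rewrite addrK.
Qed.

(** The triangle is the one provided by [tiltL 0]. Its first term is torsion free because [T] lies
    in [tiltL 1] and so has no maps to [b]. *)
Lemma hrt_tilt_tri b : hrt tiltL tiltR 0 b ->
  exists f t, [/\ F f, T (shift t) & tri f b t].
Proof.
move=> [[l [t [Ll Tt Tr]]] [f [r [Ff Rr' Tr']]]].
exists l, t; split=> //; case: (TT) => _ TA _.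
have Ht := Tn_hrt Tt.
have Al : A l.
  split=> //; apply: (tf_fibR tf Tr).
    by apply: (tiltR_sub (n := 0 + 1)); exists f, r.
  by apply: (tf_leR tf) (proj2 Ht); lia.
split=> // d Td u; case: Tr => [i [p [q Tr]]].
have Lt : L 0 d by case: (TA _ Td).
apply: (hrt_mono tf Tr Lt); first by apply: (tf_leR tf) (proj2 Ht); lia.
have Ld : tiltL (0 + 1) d.
  have [z z0] := has_zero C; exists z, d; split; last exact: tri_idr.
    exact: (tf_L0 tf).
  by rewrite addrK.
apply: (tf_hom tilt_family Ld); by exists f, r.
Qed.

Lemma left_tilt_hrt : left_tilt A T = hrt tiltL tiltR 0.
Proof.
have [sT TA _] := TT; have [z z0] := has_zero C.
apply/seteqP; split=> [|b /hrt_tilt_tri [f [t [Ff Tt Tr]]]]; last first.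
  by apply: (ext_closure_tri Tr); apply: ext_gen; [left|right].
apply: ext_closure_sub.
- move=> x [[Ax Fx]|Tx].
    split; first by apply: tiltL_L; case: Ax.
    by exists x, z; rewrite addrK; split=> //; [exact: (tf_R0 tf)|exact: tri_id].
  have Tx' : T (shift x) by [].
  split; first by exists z, x; split=> //; [exact: (tf_L0 tf)|exact: tri_idr].
  apply: tiltR_R; rewrite addrK -(subrK 1 0); apply/(tf_shiftR tf).
  by case: (TA _ Tx'); rewrite subrK.
- exact: (hrt0 tilt_family).
- exact: (hrt_strict tilt_family).
- by move=> x y w; exact: (hrt_ext tilt_family).
Qed.

End TorsionTheory.

(** A nonzero map from [s] is a monomorphism; noetherian induction divides out copies of [s] until
    no map from [s] is left. *)
Lemma simple_torsion s : noetherian A -> simple A s ->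
  torsion_tri A (ext_closure [set s]).
Proof.
move=> noe Ss; have As : A s by case: Ss.
split; first by move=> x y; exact: ext_iso.
  apply: ext_closure_sub; first by move=> x ->.
  - exact: (hrt0 tf).
  - exact: (hrt_strict tf).
  - by move=> x y w; exact: (hrt_ext tf).
apply: (noetherian_ind tf noe) => a Aa IH.
have [z z0] := has_zero C.
have [sa|/existsNP [u u0]] := pselect (forall u : hom s a, u = 0).
  exists z, a; split; first exact: ext_zero; last exact: tri_idr.
  split=> // d; suff : ext_closure [set s] `<=` [set d | forall u : hom d a, u = 0] by apply.
  apply: ext_closure_sub => [x ->//|x x0 u|x y xy|x y w Tr xa wa] /=.
  - exact: zero_to.
  - exact: hom_iso_l.
  - exact: (hom_ext_l Tr).
have [c [p [q [Ac Tr]]]] := simple_mono tf Aa Ss u0.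
have T1 : tri s a c by exists u, p, q.
have [|t [f [Tt Ff T2]]] := IH s c As Ac _ T1; first by case: Ss.
have [y T3 T4] := oct_fib_obj T1 T2.
exists y, f; split=> //; apply: (ext_closure_tri T4) => //; exact: ext_gen.
Qed.

Lemma left_tilt0 T : T `<=` A -> (forall t, T t -> is_zero t) -> left_tilt A T = A.
Proof.
move=> TA T0; apply/seteqP; split=> [|a Aa]; last first.
  by apply: ext_gen; left; split=> // d /T0 d0 u; exact: zero_to.
apply: ext_closure_sub.
- move=> x [[]//|Tx]; apply: (hrt0 tf); apply/is_zero_shift; exact: T0.
- exact: (hrt0 tf).
- exact: (hrt_strict tf).
- by move=> x y w; exact: (hrt_ext tf).
Qed.

(* Tilting at a torsion theory containing the simple s can be done by first
   tilting at s and then at the torsion objects without maps from s. *)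
Section TiltStep.
Variables (T : set C) (s : C).
Hypothesis TT : torsion_tri A T.
Hypothesis noe : noetherian A.
Hypothesis Ss : simple A s.
Hypothesis Ts : T s.
Notation S := (ext_closure [set s]).
Notation A1 := (simple_left_tilt A s).
Notation T' := (T `&` right_perp S).

Let ST := simple_torsion noe Ss.
Let A1E : A1 = hrt (tiltL S) (tiltR S) 0 := left_tilt_hrt ST.
Lemma simple_closure_sub : S `<=` T.
Proof. by apply: (torsion_ext_closure TT) => x ->. Qed.

Lemma right_perp_step f : right_perp T f -> right_perp S f.
Proof. exact: right_perp_sub simple_closure_sub _. Qed.

Lemma hom_shift_down x y : A x -> T (shift y) -> forall u : hom x y, u = 0.
Proof.
case: TT => _ TA _ [Lx _] /TA [_ Ry]; apply: (tf_hom tf Lx).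
exact/(tf_shiftR tf).
Qed.

(** An object [b] of [A1] is an extension of some [sg] in <s>[-1] by an object [f1] of [A] without
    maps from [s]; the torsion part of [b] for [T'] is the torsion part of [f1] for [T]. *)
Lemma tilt_step_torsion : torsion_tri A1 T'.
Proof.
have [sT TA dT] := TT; split.
- by move=> x y xy [Tx Sx]; split; [exact: sT Tx|exact: strict_right_perp Sx].
- by move=> x [Tx Sx]; apply: ext_gen; left; split=> //; exact: TA.
- rewrite A1E => b /(hrt_tilt_tri ST) [f1 [sg [[Af1 Sf1] Ssg Tr]]].
  have [t [f [Tt [Af Ff] T1]]] := dT _ Af1.
  have [e T2 T3] := oct_cof_obj T1 Tr.
  exists t, e; split=> //.
    by split=> //; apply: (right_perp_sub_object ST (TA _ Tt) Af T1 Sf1).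
  rewrite -A1E; split.
    apply: (ext_closure_tri T3); apply: ext_gen; last by right.
    by left; split=> //; exact: right_perp_step.
  move=> d [Td Sd]; apply: (hom_ext_r T3) => u; first exact: Ff.
  by apply: hom_shift_down; [exact: TA|exact: simple_closure_sub].
Qed.

(** The generators are compared. Objects of T[-1] are cut along the torsion theory <s>. Conversely,
    if [x] in [A1] has no maps from [T'], the torsion part of its subobject [f1] belongs to [T'] and
    hence vanishes. *)
Lemma tilt_step : left_tilt A T = left_tilt A1 T'.
Proof.
have [sT TA dT] := TT; apply/seteqP; split.
  apply: ext_closure_mono => x [[Ax Fx]|Tx].
    apply: ext_gen; left; split; last by move=> d [Td _]; exact: Fx.
    by apply: ext_gen; left; split=> //; exact: right_perp_step.
  have Tx' : T (shift x) by []; case: ST => _ _ /(_ _ (TA _ Tx')).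
  move=> [sg0 [t0 [Sg0 [At0 St0] T1]]].
  have [sg sg1] := shift_surj_iso sg0; have [t tt0] := shift_surj_iso t0.
  have Ssg : S (shift sg) by exact: ext_iso sg1 Sg0.
  have T2 : tri sg x t.
    by apply: tri_of_rot; apply: (tri_iso T1) => //; exact: isomorphic_refl.
  apply: (ext_closure_tri T2).
    apply: ext_gen; left; split; first by apply: ext_gen; right.
    move=> d [Td _] u; apply: hom_shift_down; first exact: TA.
    exact: simple_closure_sub.
  apply: ext_gen; right; split; last exact: strict_right_perp tt0 St0.
  apply: (sT _ _ tt0); apply: (torsion_quotient TT _ At0 T1 Tx').
  by apply: TA; exact: simple_closure_sub.
apply: ext_closure_mono => x [[]|[Tx _]]; last by apply: ext_gen; right.
rewrite A1E => /(hrt_tilt_tri ST) [f1 [sg [[Af1 Sf1] Ssg Tr]]] T'x.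
apply: (ext_closure_tri Tr); last by apply: ext_gen; right; exact: simple_closure_sub.
have [t [f [Tt [Af Ff] T1]]] := dT _ Af1.
have T't : T' t.
  by split=> //; apply: (right_perp_sub_object ST (TA _ Tt) Af T1 Sf1).
have t0 : is_zero t.
  case: T1 Tr => [i [p [q T1]]] [i' [p' [q' Tr]]].
  apply: (tri_f0_hrt tf T1 (proj1 (TA _ Tt)) (proj2 Af)).
  have Rsg : Rr (0 + 1) sg.
    apply: (tf_incR tf); apply/(tf_shiftR tf).
    by case: (TA _ (simple_closure_sub Ssg)).
  apply: (hrt_mono tf Tr (proj1 (TA _ Tt)) Rsg); exact: T'x.
apply: ext_gen; left; split=> //.
case: T1 => [i [p [q T1]]].
have ff : isomorphic f f1 by apply: isomorphic_sym; exists p; exact: tri_zero_l T1 t0.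
exact: strict_right_perp ff Ff.
Qed.

(** A decomposition in [A] of an object of [T'] also lives in [A1]: the summands are subobjects, so
    they have no maps from [s]. *)
Lemma tilt_step_indecomposable :
  indecomposable A1 `&` T' `<=` indecomposable A `&` T.
Proof.
have [sT TA dT] := TT; move=> x [[_ x0 Hx] [Tx Sx]]; split=> //; split=> //.
  exact: TA.
have sub y z : A y -> A z -> is_biproduct y z x -> A1 y.
  move=> Ay Az yz; apply: ext_gen; left; split=> //.
  exact: (right_perp_sub_object ST Ay Az (biproduct_triangle yz)).
move=> y z Ay Az yz; apply: Hx => //; first exact: (sub y z).
by apply: (sub z y) => //; exact: biproduct_sym.
Qed.

End TiltStep.

Lemma simple_indecomposable s : simple A s -> indecomposable A s.
Proof.
move=> Ss; case: (Ss) => As s0 _; split=> // y z Ay Az /biproduct_triangle Tr.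
exact: (simple_tri tf Ss Ay Az Tr).
Qed.

End Tilt.

(** Induction on the number [n] of representatives of the indecomposables in [T]. A simple quotient
    [s] of a nonzero torsion object is torsion and indecomposable; its representative is omitted
    after the tilt at [s], since the identity of [s] keeps [s] out of the new torsion class. *)
Lemma left_tilt_simple_tilts (C : triangulated_category) (A : set C) :
  (forall B, simple_tilts A B -> finite_length B) ->
  forall (n : nat) (r : 'I_n -> C) (B T : set C) (L Rr : int -> set C),
    simple_tilts A B -> t_family L Rr -> B = hrt L Rr 0 -> torsion_tri B T ->
    (forall x, indecomposable B x -> T x -> exists i, isomorphic x (r i)) ->
    simple_tilts A (left_tilt B T).
Proof.
move=> fl; elim=> [|n IH] r B T L Rr AB tf BE TT ind.
all: have [T0|/existsNP[t /not_implyP[Tt t0]]] := pselect (forall t, T t -> is_zero t).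
1,3: by rewrite BE (left_tilt0 tf)// -?BE//; case: TT.
all: have [_ noe] := fl _ AB; rewrite BE in noe TT ind AB *.
all: have At : hrt L Rr 0 t by (case: TT => _ TA _; exact: TA).
all: have [x [s [Ax Ss Tr]]] := simple_quotient tf noe At t0.
all: have As : hrt L Rr 0 s by case: Ss.
all: have Ts : T s by exact: (torsion_quotient tf TT Ax As Tr Tt).
all: have [i0 si0] := ind s (simple_indecomposable tf Ss) Ts.
  by case: i0 si0.
rewrite (tilt_step tf TT noe Ss Ts).
have ST := simple_torsion tf noe Ss.
apply: (IH (fun i => r (lift i0 i)) _ _ _ _ _ (tilt_family tf ST)).
- exact: simple_tilts_left.
- exact: left_tilt_hrt.
- exact: tilt_step_torsion.
- move=> y Iy Ty; have [Iy' Ty'] := tilt_step_indecomposable tf TT noe Ss (conj Iy Ty).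
  have [i yi] := ind _ Iy' Ty'.
  case: (unliftP i0 i) => [j ij|ij]; first by exists j; rewrite -ij.
  have ys : isomorphic y s by apply: isomorphic_trans yi _; rewrite ij; exact: isomorphic_sym.
  case: Ty => _ /(strict_right_perp ys) /(_ s (ext_gen _)) sp.
  by case: Ss => _ []; rewrite /is_zero; apply: sp.
Qed.

(** * Stability conditions *)

Section Filtrations.
Variables (R : realType) (C : triangulated_category) (P : R -> set C).
Implicit Types (x y z c a : C) (phi psi t : R) (s : seq (R * C)).

Lemma filtration_rconsP s phi a x : filtration P (rcons s (phi, a)) x ->
  exists y, [/\ filtration P s y, tri y x a, P phi a & ~ is_zero a].
Proof.
move e: (rcons _ _) => s' F; case: F e => [z _|{}s' y z psi b f g h Fy T Pb b0].
  by case: s.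
move=> /rcons_inj [es ep ea]; subst; exists y; split=> //.
by exists f, g, h.
Qed.

Lemma filtration_iso s x y : isomorphic x y -> filtration P s x -> filtration P s y.
Proof.
move=> xy F; case: F xy => [z z0 zy|s' w z psi b f g h Fw T Pb b0 zy].
  by constructor; exact: isomorphic_zero z0 zy.
have [f' [g' T']] := tri_isom T zy.
exact: filtration_rcons Fw T' Pb b0.
Qed.

Lemma filtration_rcons_tri s x y phi a : filtration P s x -> tri x y a ->
  P phi a -> ~ is_zero a -> filtration P (rcons s (phi, a)) y.
Proof. by move=> F [f [g [h T]]] Pa a0; exact: filtration_rcons F T Pa a0. Qed.

Lemma filtration_cat s1 s2 x y z : filtration P s1 x -> tri x y z ->
  filtration P s2 z -> filtration P (s1 ++ s2) y.
Proof.
elim/last_ind: s2 y z => [|s2 [phi a] IH] y z F1 T F2.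
  have z0 : is_zero z.
    by move e: [::] F2 => s2 F2; case: F2 e => // ? ? ? ? ? ? ? ? _ _ _ _; case: (s in rcons s).
  rewrite cats0; apply: filtration_iso F1.
  by case: T => f [g [h T]]; exists f; exact: tri_zero_r T z0.
have [z' [F3 T3 Pa a0]] := filtration_rconsP F2.
have [y' T4 T5] := oct_fib_obj T T3.
rewrite -rcons_cat; apply: (filtration_rcons_tri _ T4) => //; exact: IH F1 T5 F3.
Qed.

Lemma filtration_split s1 s2 y : filtration P (s1 ++ s2) y ->
  exists x z, [/\ filtration P s1 x, filtration P s2 z & tri x y z].
Proof.
elim/last_ind: s2 y => [|s2 [phi a] IH] y.
  rewrite cats0 => F; have [z z0] := has_zero C; exists y, z; split=> //.
    exact: filtration_nil.
  exact: tri_id.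
rewrite -rcons_cat => /filtration_rconsP [y' [/IH [x [z [F1 F2 T1]]] T Pa a0]].
have [w T2 T3] := oct_cof_obj T1 T.
by exists x, w; split=> //; exact: filtration_rcons_tri F2 T3 Pa a0.
Qed.

Lemma filtration_ind (E : set C) s x : (forall x, is_zero x -> E x) ->
  (forall x y z, tri x y z -> E x -> E z -> E y) ->
  (forall u, u \in unzip1 s -> P u `<=` E) ->
  filtration P s x -> E x.
Proof.
move=> E0 EE; elim/last_ind: s x => [|s [phi a] IH] x Es F.
  move: F; move e: [::] => s F; case: F e => [z /E0//|].
  by move=> {}s ? ? ? ? ? ? ? _ _ _ _; case: s.
have [y [Fy T Pa _]] := filtration_rconsP F.
apply: (EE _ _ _ T).
  by apply: IH Fy => u us; apply: Es; rewrite /unzip1 map_rcons mem_rcons in_cons us orbT.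
by apply: (Es phi) => //; rewrite /unzip1 map_rcons mem_rcons in_cons eqxx.
Qed.

Lemma gtr_trans : transitive (fun x y : R => y < x).
Proof. by move=> y x z xy yz; exact: lt_trans yz xy. Qed.

Lemma sorted_split (b : R) s : sorted (fun x y : R => y < x) (unzip1 s) ->
  exists s1 s2, [/\ s = s1 ++ s2, forall u, u \in unzip1 s1 -> b < u
    & forall u, u \in unzip1 s2 -> u <= b].
Proof.
elim: s => [|u s IH] so; first by exists [::], [::].
have [bu|ub] := ltP b u.1.
  have [s1 [s2 [-> H1 H2]]] := IH (path_sorted so).
  exists (u :: s1), s2; split=> // v; rewrite /= in_cons => /orP[/eqP->//|].
  exact: H1.
exists [::], (u :: s); split=> // v; rewrite /= in_cons => /orP[/eqP->//|vs].
move: so; rewrite /= (path_sortedE gtr_trans) => /andP[/allP/(_ _ vs) vu _].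
exact: le_trans (ltW vu) ub.
Qed.

Lemma filtration0 x : filtration P [::] x -> is_zero x.
Proof.
by move=> F; apply: (filtration_ind (s := [::]) (E := @is_zero C)) F => // y a b T y0 b0;
  case: T => f [g [h T]]; apply: (isomorphic_zero y0); exists f; exact: tri_zero_r T b0.
Qed.

End Filtrations.

(** * Slicings: vanishing of morphisms and truncation *)

Section Slicing.
Variables (R : realType) (C : triangulated_category) (sg : stability_condition R C).
Implicit Types (x y z c a : C) (phi psi t : R) (I J : set R) (s : seq (R * C)).
Notation P := (P sg).

(** The subcategory P(I), for an arbitrary set [I] of phases. *)
Definition pin I : set C := ext_closure [set x | exists2 phi, I phi & P phi x].

Lemma pin_sub I J : I `<=` J -> pin I `<=` pin J.
Proof.
by move=> IJ; apply: ext_closure_mono => x [phi /IJ Jp Px]; apply: ext_gen; exists phi.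
Qed.

Lemma pin_P I phi x : I phi -> P phi x -> pin I x.
Proof. by move=> Ip Px; apply: ext_gen; exists phi. Qed.

Lemma pin_iso I x y : isomorphic x y -> pin I x -> pin I y.
Proof. exact: ext_iso. Qed.

Lemma pin_ext I x y z : tri x y z -> pin I x -> pin I z -> pin I y.
Proof. exact: ext_closure_tri. Qed.

Lemma strict_P phi : strict (P phi).
Proof. by case: (P_additive sg phi). Qed.

Lemma hom_pin I J x y : (forall phi psi, I phi -> J psi -> psi < phi) ->
  pin I x -> pin J y -> forall f : hom x y, f = 0.
Proof.
move=> IJ Ix; suff : pin J `<=` [set y | forall f : hom x y, f = 0] by apply.
apply: ext_closure_sub => [{}y [psi Jp Py]|{}y y0 f|{}y z yz|{}y z w T] /=.
- suff : pin I `<=` [set x | forall f : hom x y, f = 0] by apply.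
  apply: ext_closure_sub => [{Ix}x [phi Ip Px]|{Ix}x x0 f|{Ix}x z xz|{Ix}x z w T] /=.
  + by apply: (P_hom Px Py); exact: IJ.
  + exact: zero_to.
  + by move=> H; apply: (hom_iso xz (isomorphic_refl _)).
  + by move=> Hx Hw; exact: (hom_ext_l T).
- exact: to_zero.
- by move=> H; apply: (hom_iso (isomorphic_refl _) yz).
- by move=> Hx Hw; exact: (hom_ext_r T).
Qed.

Lemma P_shiftE phi x : P (phi + 1) (shift x) <-> P phi x.
Proof. by rewrite P_shift; apply: shift_up_shift; exact: strict_P. Qed.

Lemma pin_shift I x : pin [set phi | I (phi - 1)] (shift x) <-> pin I x.
Proof.
split=> [|Ix].
  suff : pin [set phi | I (phi - 1)] `<=` [set y | forall x, isomorphic y (shift x) -> pin I x].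
    by move=> /(_ (shift x)) H /H; apply; exact: isomorphic_refl.
  apply: ext_closure_sub => [y [phi /= Ip Py] {}x yx|y y0 {}x yx|y z yz Hy {}x zx|y z w T Hy Hw {}x zx].
  - by apply: pin_P Ip _; apply/P_shiftE; rewrite subrK; exact: strict_P Py.
  - by apply: ext_zero; apply/is_zero_shift; exact: isomorphic_zero y0 yx.
  - by apply: Hy; exact: isomorphic_trans yz zx.
  - have [y' yy'] := shift_surj_iso y; have [w' ww'] := shift_surj_iso w.
    by apply: (pin_ext (x := y') (z := w')); [apply: tri_of_rot; exact: (tri_iso T)|exact: Hy|exact: Hw].
suff : pin I `<=` [set x | pin [set phi | I (phi - 1)] (shift x)] by apply.
apply: ext_closure_sub => [{Ix}x [phi Ip Px]|{Ix}x x0|{Ix}x y xy Hx|{Ix}x y z T Hx Hz].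
- by apply: (@pin_P _ (phi + 1)); rewrite /= ?addrK//; apply/P_shiftE.
- by apply: ext_zero; apply/is_zero_shift.
- by apply: pin_iso Hx; apply/isomorphic_shift.
- exact: (pin_ext (tri_shifted T)).
Qed.

Lemma filtration_pin I s x : filtration P s x ->
  (forall u, u \in unzip1 s -> I u) -> pin I x.
Proof.
move=> F Is; apply: (filtration_ind (s := s) (E := pin I)) F.
- exact: ext_zero.
- exact: pin_ext.
- by move=> u /Is Iu y; exact: pin_P.
Qed.

Lemma HN_nonempty s c : ~ is_zero c -> HN_filtration P s c ->
  exists u s', s = u :: s'.
Proof. by move=> c0 [F _]; case: s F => [/filtration0//|u s' _]; exists u, s'. Qed.

(** The inclusion [f] of the first factor is nonzero: otherwise the identity of [a] would be carried
    by a map from [shift a], of phase [u.1 + 1], to [c'], whose phases are smaller. Through such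
    maps the largest phase is detected by morphisms. *)
Lemma HN_first u s c : HN_filtration P (u :: s) c ->
  exists a c' (f : hom a c) g h,
  [/\ P u.1 a, ~ is_zero a, pin [set psi | psi < u.1] c', @triangle C a c c' f g h & f <> 0].
Proof.
move=> [F so]; case: u F so => phi a /= F so.
have [x [c' [F1 F2 T]]] : exists x z, [/\ filtration P (rcons [::] (phi, a)) x,
  filtration P s z & tri x c z] by exact: filtration_split.
have [z [/filtration0 z0 T1 Pa a0]] := filtration_rconsP F1.
have xa : isomorphic x a by case: T1 => f [g [h T1]]; exists g; exact: tri_zero_l T1 z0.
have [f [g [h T2]]] : tri a c c' by apply: (tri_iso T) => //; exact: isomorphic_refl.
have c'P : pin [set psi | psi < phi] c'.
  apply: (filtration_pin F2) => v vs /=.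
  by move: so; rewrite (path_sortedE (@gtr_trans R)) => /andP[/allP/(_ _ vs)].
exists a, c', f, g, h; split=> // f0; apply: a0; apply: (tri_f0 T2 f0).
apply: (hom_pin (I := [set phi + 1]) (J := [set psi | psi < phi])) => //.
  by move=> _ psi -> /= /lt_le_trans; apply; rewrite lerDl.
by apply: (@pin_P _ (phi + 1)) => //; apply/P_shiftE.
Qed.

Lemma HN_last u s c : HN_filtration P (rcons s u) c ->
  exists c' a (f : hom c' c) (g : hom c a) h,
  [/\ P u.1 a, ~ is_zero a, pin [set psi | u.1 < psi] c', @triangle C c' c a f g h & g <> 0].
Proof.
move=> [F so]; case: u F so => phi a /= F so.
have [c' [F1 [f [g [h T]]] Pa a0]] := filtration_rconsP F.
have c'P : pin [set psi | phi < psi] c'.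
  apply: (filtration_pin F1) => v vs /=.
  move: so; rewrite /unzip1 map_rcons -cats1 sorted_pairwise; last exact: (@gtr_trans R).
  by rewrite pairwise_cat allrel1r => /and3P[/allP/(_ _ vs)].
exists c', a, f, g, h; split=> // g0; apply: a0; apply: (tri_g0 T g0).
apply: (hom_pin (I := [set psi | phi < psi - 1]) (J := [set phi])) => //.
- by move=> psi _ /= ? ->; lra.
- by apply/(pin_shift [set psi | phi < psi]).
- exact: (@pin_P _ phi).
Qed.

Lemma HN_mem s c u : HN_filtration P s c -> u \in unzip1 s ->
  last 0 (unzip1 s) <= u <= head 0 (unzip1 s).
Proof.
move=> [_]; rewrite sorted_pairwise; last exact: (@gtr_trans R).
move: (unzip1 s) => {}s so us; apply/andP; split.
  elim/last_ind: s so us => [//|s v _] so; rewrite last_rcons mem_rcons in_cons.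
  move=> /orP[/eqP ->//|us]; apply: ltW.
  by move: so; rewrite -cats1 pairwise_cat allrel1r => /and3P[/allP/(_ _ us)].
case: s so us => [//|v s] /=; rewrite in_cons => /andP[/allP vs _] /orP[/eqP ->//|/vs].
exact: ltW.
Qed.

Lemma HN_head_ex I s c : ~ is_zero c -> HN_filtration P s c -> pin I c ->
  exists2 phi, I phi & head 0 (unzip1 s) <= phi.
Proof.
move=> c0 HN Ic; have [u [s' se]] := HN_nonempty c0 HN; subst s => /=.
have [a [c' [f [g [h [Pa a0 _ _ f0]]]]]] := HN_first HN.
apply: contrapT => no; apply: f0.
apply: (hom_pin (I := [set u.1]) (J := I)) => //; last exact: (@pin_P _ u.1).
by move=> _ psi -> Ip; rewrite ltNge; apply/negP => up; apply: no; exists psi.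
Qed.

Lemma HN_last_ex I s c : ~ is_zero c -> HN_filtration P s c -> pin I c ->
  exists2 phi, I phi & phi <= last 0 (unzip1 s).
Proof.
move=> c0 HN Ic; have [u [s' se]] := HN_nonempty c0 HN.
move: HN; rewrite {}se lastI => HN; move: (belast _ _) (last _ _) HN => {s'}s' {}u HN.
rewrite /unzip1 map_rcons last_rcons.
have [c' [a [f [g [h [Pa a0 _ _ g0]]]]]] := HN_last HN.
apply: contrapT => no; apply: g0.
apply: (hom_pin (I := I) (J := [set u.1])) => //; last exact: (@pin_P _ u.1).
by move=> phi _ Ip ->; rewrite ltNge; apply/negP => up; apply: no; exists phi.
Qed.

Lemma HN_pin_mem I s c u : ~ is_zero c -> HN_filtration P s c -> pin I c ->
  u \in unzip1 s -> exists phi psi, [/\ I phi, I psi & phi <= u <= psi].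
Proof.
move=> c0 HN Ic us; have /andP[lu uh] := HN_mem HN us.
have [psi Ip hp] := HN_head_ex c0 HN Ic; have [phi Iq ql] := HN_last_ex c0 HN Ic.
by exists phi, psi; split=> //; rewrite (le_trans ql lu) (le_trans uh hp).
Qed.

Lemma HN_exists c : exists s, HN_filtration P s c.
Proof.
have [c0|/(P_HN sg)//] := pselect (is_zero c).
by exists [::]; split=> //; exact: filtration_nil.
Qed.

Section TruncationFamily.
Variable t : R.

(** The t-structure with aisle P(>t), whose heart is P(t, t + 1]. The parameter [t] is the direction
    in Crofton's formula. *)
Definition gtL (n : int) : set C := pin [set phi | t + n%:~R < phi].
Definition leR (n : int) : set C := pin [set phi | phi <= t + n%:~R].

Lemma slicing_family : t_family gtL leR.
Proof.
have sh (n : int) : t + (n + 1)%:~R = t + n%:~R + 1 :> R by rewrite intrD addrA.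
split.
- by move=> n x y; exact: pin_iso.
- by move=> n x y; exact: pin_iso.
- move=> n x; rewrite /gtL sh.
  have -> : [set phi : R | t + n%:~R + 1 < phi] = [set phi | [set phi | t + n%:~R < phi] (phi - 1)].
    by apply/seteqP; split=> phi /=; rewrite ltrBrDr.
  exact: pin_shift.
- move=> n x; rewrite /leR sh.
  have -> : [set phi : R | phi <= t + n%:~R + 1] = [set phi | [set phi | phi <= t + n%:~R] (phi - 1)].
    by apply/seteqP; split=> phi /=; rewrite lerBlDr.
  exact: pin_shift.
- by move=> n; apply: pin_sub => phi /=; rewrite sh => /(lt_trans _); apply; rewrite ltrDl.
- by move=> n; apply: pin_sub => phi /=; rewrite sh => /le_trans; apply; rewrite lerDl.
- move=> n x y; apply: hom_pin => phi psi /= a b; exact: le_lt_trans b a.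
- move=> n c; have [c0|c0] := pselect (is_zero c).
    by exists c, c; split; [exact: ext_zero|exact: ext_zero|exact: tri_id].
  have [s [F so]] := P_HN sg c0.
  have [s1 [s2 [se Hs1 Hs2]]] := sorted_split (t + n%:~R) so.
  rewrite se in F; have [x [y [F1 F2 T]]] := filtration_split F.
  by exists x, y; split=> //; [apply: (filtration_pin F1)|apply: (filtration_pin F2)].
- move=> c; have [c0|c0] := pselect (is_zero c); first by exists 0; exact: ext_zero.
  have [s HN] := P_HN sg c0; pose l := last 0 (unzip1 s).
  exists (Num.floor (l - t) - 1); apply: filtration_pin (proj1 HN) _ => u us /=.
  have /andP[lu _] := HN_mem HN us; apply: lt_le_trans lu.
  rewrite intrD -ltrBrDl; apply: lt_le_trans (floor_le_tmp (l - t)).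
  by rewrite gtrDl ltrN10.
- move=> c; have [c0|c0] := pselect (is_zero c); first by exists 0; exact: ext_zero.
  have [s HN] := P_HN sg c0; pose l := head 0 (unzip1 s).
  exists (Num.floor (l - t) + 1); apply: filtration_pin (proj1 HN) _ => u us /=.
  have /andP[_ lu] := HN_mem HN us; apply: le_trans lu _.
  by rewrite -lerBlDl ltW// floorD1_gt.
Qed.

End TruncationFamily.

End Slicing.

(** * Charges in polar form *)

Section Polar.
Variable R : realType.
Implicit Types (z w : R[i]) (phi psi m : R).

(* [cr z phi] is the imaginary part of [exp (- i pi phi) z]. *)
Definition cr z phi : R := complex.Im z * cos (pi * phi) - complex.Re z * sin (pi * phi).
Definition pol m phi : R[i] := (m * cos (pi * phi) +i* (m * sin (pi * phi)))%C.

Lemma cr0 phi : cr 0 phi = 0. Proof. by rewrite /cr /= !mul0r subrr. Qed.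

Lemma crD z w phi : cr (z + w) phi = cr z phi + cr w phi.
Proof. by case: z w => [a b] [c d]; rewrite /cr /=; ring. Qed.

Lemma crN z phi : cr (- z) phi = - cr z phi.
Proof. by case: z => [a b]; rewrite /cr /=; ring. Qed.

Lemma cr_pol m psi phi : cr (pol m psi) phi = m * sin (pi * (psi - phi)).
Proof. by rewrite /cr /= mulrBr sinB; ring. Qed.

Lemma pol_shift m phi : pol m (phi + 1) = - pol m phi.
Proof.
by rewrite /pol mulrDr mulr1 cosDpi sinDpi; apply/eqP; rewrite eq_complex /= !mulrN !eqxx.
Qed.

Lemma cr_shift z phi : cr (- z) (phi + 1) = cr z phi.
Proof. by case: z => [a b]; rewrite /cr /= mulrDr mulr1 cosDpi sinDpi; ring. Qed.

Lemma pi0 : 0 < (pi : R). Proof. exact: pi_gt0. Qed.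

Lemma sin_pi_gt0 (d : R) : 0 < d < 1 -> 0 < sin (pi * d).
Proof.
move=> /andP[d0 d1]; apply: sin_gt0_pi; rewrite mulr_gt0 ?pi0//=.
by rewrite gtr_pMr ?pi0.
Qed.

Lemma sin_pi_ge0 (d : R) : 0 <= d <= 1 -> 0 <= sin (pi * d).
Proof.
move=> /andP[d0 d1]; apply: sin_ge0_pi; have p0 := ltW pi0.
by rewrite mulr_ge0//= ler_piMr.
Qed.

Lemma sin_pi_nonneg (d : R) : -1 < d -> 0 <= sin (pi * d) -> 0 <= d.
Proof.
move=> d1 sd; rewrite leNgt; apply/negP => d0.
have : 0 < sin (pi * - d) by apply: sin_pi_gt0; lra.
by rewrite mulrN sinN; lra.
Qed.

Lemma pol_ge m psi phi : 0 < m -> -1 < psi - phi -> 0 <= cr (pol m psi) phi -> phi <= psi.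
Proof.
by move=> m0 d; rewrite cr_pol pmulr_rge0// => /(sin_pi_nonneg d); rewrite subr_ge0.
Qed.

Lemma pol_le m psi phi : 0 < m -> psi - phi < 1 -> cr (pol m psi) phi <= 0 -> psi <= phi.
Proof.
move=> m0 d; rewrite cr_pol pmulr_rle0// => sd.
suff : 0 <= phi - psi by rewrite subr_ge0.
by apply: sin_pi_nonneg; [lra|rewrite -opprB mulrN sinN oppr_ge0].
Qed.

Lemma polar_exists z : 0 < complex.Im z \/ (complex.Im z = 0 /\ complex.Re z < 0) ->
  exists phi m, [/\ 0 < phi <= 1, 0 < m & z = pol m phi].
Proof.
case: z => a b /= ab.
have n0 : 0 < a ^+ 2 + b ^+ 2.
  case: ab => [b0|[b0 a0]].
    by rewrite ltr_wpDl ?sqr_ge0// exprn_gt0.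
  by rewrite ltr_pwDl ?sqr_ge0// expr2 nmulr_rgt0.
pose m := Num.sqrt (a ^+ 2 + b ^+ 2); have m0 : 0 < m by rewrite sqrtr_gt0.
have m2 : m ^+ 2 = a ^+ 2 + b ^+ 2 by rewrite sqr_sqrtr// ltW.
have b0 : 0 <= b by case: ab => [/ltW//|[-> _]].
have am : -1 <= a / m <= 1.
  rewrite ler_pdivlMr// ler_pdivrMr// mulN1r mul1r -ler_norml.
  by rewrite -sqrtr_sqr ler_wsqrtr// lerDl sqr_ge0.
have pn0 : (pi : R) != 0 by rewrite gt_eqF ?pi0.
have ce : cos (pi * (acos (a / m) / pi)) = a / m.
  by rewrite mulrC divfK// acosK.
have se : sin (pi * (acos (a / m) / pi)) = b / m.
  rewrite mulrC divfK// sin_acos//.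
  have -> : 1 - (a / m) ^+ 2 = (b / m) ^+ 2.
    rewrite !expr_div_n m2; field; exact: lt0r_neq0.
  by rewrite sqrtr_sqr ger0_norm// divr_ge0// ltW.
exists (acos (a / m) / pi), m; split=> //; last first.
  by rewrite /pol ce se ![m * _]mulrC !divfK ?gt_eqF.
rewrite ler_pdivrMr ?pi0// mul1r acos_lepi// andbT divr_gt0 ?pi0//.
rewrite lt_neqAle eq_sym acos_ge0// andbT; apply/eqP => a0.
case: ab => [bp|[_ an]].
  by move: se; rewrite a0 mul0r mulr0 sin0 => /esym/eqP; rewrite mulf_eq0 invr_eq0 !gt_eqF.
move: ce; rewrite a0 mul0r mulr0 cos0 => /esym/(congr1 (fun t => t * m)).
by rewrite divfK ?gt_eqF// mul1r => am'; move: an m0; rewrite am'; lra.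
Qed.

Lemma zsign_pol (n : int) m phi : zsign n (pol m phi) = pol m (phi + n%:~R).
Proof.
elim/translate_ind: n => [|n IH|n IH]; first by rewrite addr0.
  by rewrite zsignS IH intrD addrA pol_shift.
apply: oppr_inj; rewrite -zsignS IH -[RHS]opprK opprK -pol_shift intrD addrA.
by [].
Qed.

Lemma cr_zsign (n : int) z phi : cr (zsign n z) (phi + n%:~R) = cr z phi.
Proof.
elim/translate_ind: n => [|n IH|n IH]; first by rewrite addr0.
  by rewrite zsignS intrD addrA cr_shift.
by rewrite -cr_shift -zsignS -addrA -intrD1.
Qed.

End Polar.

Section HeartQuotients.
Variable C : triangulated_category.
Variables L Rr : int -> set C.
Hypothesis tf : t_family L Rr.
Variable n : int.
Implicit Types (x y z c a b k r : C).
Notation Hn := (hrt L Rr n).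

(* The image i in r of x and the cokernel c of i are quotients of x and y. *)
Lemma quotient_of_extension x b y k r : Hn x -> Hn b -> Hn y -> Hn k -> Hn r ->
  tri x b y -> tri k b r -> exists i c k1 k2,
    [/\ Hn i, Hn c, Hn k1 & Hn k2] /\ [/\ tri k1 x i, tri k2 y c & tri i r c].
Proof.
move=> Hx Hb Hy Hk Hr [f [g [h T1]]] [j [q [w T2]]].
have [k1 [i [c [j1 [e [q1 [m [p [r1 [[Hk1 Hi Hc] [T3 T4 me]]]]]]]]]]] :=
  hrt_factor tf (q \oc f) Hx Hr.
have [|v vE] := tri_coker (u := p \oc q) T1.
  by rewrite -compA -me compA (tri_comp0 T4) comp0l.
have [k2 [i2 [c2 [j2 [e2 [q2 [m2 [p2 [r2 [[Hk2 Hi2 Hc2] [T5 T6 me2]]]]]]]]]]] :=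
  hrt_factor tf v Hy Hc.
have p20 : p2 = 0.
  apply: (hrt_epi tf T4 (proj1 Hi) (proj2 Hc2)).
  apply: (hrt_epi tf T2 (proj1 Hk) (proj2 Hc2)).
  by rewrite -compA vE -me2 !compA (tri_comp0 T6) !comp0l.
have c20 : is_zero c2 by apply: (tri_g0_hrt tf T6 (proj1 Hi2) (proj2 Hc2)).
exists i, c, k1, k2; split=> //; split; last by exists m, p, r1.
  by exists j1, e, q1.
have ic : isomorphic i2 c by exists m2; exact: tri_zero_r T6 c20.
have T7 : tri k2 y i2 by exists j2, e2, q2.
by apply: (tri_iso T7) => //; exact: isomorphic_refl.
Qed.

End HeartQuotients.

(** * The stability condition of a heart with central charge [W] and length [ell] *)

Section FromHeart.
Variables (R : realType) (C : triangulated_category).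
Variables L Rr : int -> set C.
Hypothesis tf : t_family L Rr.
Variables (W : C -> R[i]) (ell : C -> int).
Notation H := (hrt L Rr).
Hypothesis WA : tri_additive W.
Hypothesis ellA : tri_additive ell.
Hypothesis W_upper : forall x, H 0 x -> ~ is_zero x ->
  0 < complex.Im (W x) \/ (complex.Im (W x) = 0 /\ complex.Re (W x) < 0).
Hypothesis ell_gt0 : forall x, H 0 x -> ~ is_zero x -> 0 < ell x.
Hypothesis W_finite : forall N : nat, exists s : seq R[i],
  forall x, H 0 x -> ell x <= N%:Z -> W x \in s.
Implicit Types (x y z c a b k r : C) (n : int) (phi psi m : R).

Lemma crWA phi : tri_additive (fun x => cr (W x) phi).
Proof. by move=> x y z /WA ->; rewrite crD. Qed.

Lemma susp_hrt0 n x : H n x -> H 0 (susp (- n) x).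
Proof. by move=> /(hrt_susp tf (- n)); rewrite subrr. Qed.

Lemma zsignN (V : zmodType) n (v : V) : zsign (- n) v = zsign n v.
Proof. by rewrite /zsign abszN. Qed.

Lemma susp_nonzero n x : ~ is_zero x -> ~ is_zero (susp n x).
Proof.
move=> x0; elim/translate_ind: n => [//|n IH|n IH] s0; apply: IH.
  by apply/is_zero_shift; exact: isomorphic_zero s0 (susp_succ n x).
by apply: isomorphic_zero (isomorphic_sym (susp_succ n x)); exact/is_zero_shift.
Qed.

Lemma phase_exists n x : H n x -> ~ is_zero x ->
  exists psi m, [/\ n%:~R < psi <= n%:~R + 1, 0 < m & W x = pol m psi].
Proof.
move=> Hx x0; have H0 := susp_hrt0 Hx.
have [psi [m [/andP[p0 p1] m0 We]]] := polar_exists (W_upper H0 (susp_nonzero x0)).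
exists (psi + n%:~R), m; split=> //; first by apply/andP; split; lra.
by rewrite -zsign_pol -We (additive_susp _ _ WA) zsignN zsignK.
Qed.

Lemma ell_sign_gt0 n x : H n x -> ~ is_zero x -> 0 < zsign n (ell x).
Proof.
move=> /susp_hrt0 H0 /(susp_nonzero (n := - n)) x0.
by have := ell_gt0 H0 x0; rewrite (additive_susp _ _ ellA) zsignN.
Qed.

Lemma absz_zsign n (v : int) : absz (zsign n v) = absz v.
Proof. by rewrite /zsign; case: (odd _); rewrite ?abszN. Qed.

Lemma ell_sign_ge0 n x : H n x -> 0 <= zsign n (ell x).
Proof.
move=> Hx; have [x0|x0] := pselect (is_zero x); last exact/ltW/ell_sign_gt0.
by rewrite (additive_zero ellA x0) /zsign; case: (odd _).
Qed.

Lemma len_add n x y z : H n x -> H n z -> tri x y z ->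
  absz (ell y) = (absz (ell x) + absz (ell z))%N.
Proof.
move=> Hx Hz /ellA e; rewrite -(absz_zsign n (ell y)) e zsignD.
rewrite -(absz_zsign n (ell x)) -(absz_zsign n (ell z)).
by have := ell_sign_ge0 Hx; have := ell_sign_ge0 Hz; lia.
Qed.

Lemma len_gt0 n x : H n x -> ~ is_zero x -> (0 < absz (ell x))%N.
Proof. by move=> Hx x0; rewrite -(absz_zsign n); have := ell_sign_gt0 Hx x0; lia. Qed.

Definition lvl phi : int := Num.ceil phi - 1.

Lemma lvlP phi : (lvl phi)%:~R < phi <= (lvl phi)%:~R + 1.
Proof. by have := ceil_itv phi; rewrite /lvl intrD /= subrK. Qed.

Lemma lvl_uniq n phi : n%:~R < phi <= n%:~R + 1 -> lvl phi = n.
Proof.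
move=> /andP[a b]; rewrite /lvl (_ : Num.ceil phi = n + 1) ?addrK//.
by apply: ceil_def; rewrite addrK intrD a b.
Qed.

Lemma lvl_shift phi : lvl (phi + 1) = lvl phi + 1.
Proof.
by apply: lvl_uniq; have := lvlP phi; rewrite intrD => /andP[a b]; apply/andP; split; lra.
Qed.

(** Semistability is tested on quotients [r] in the shifted heart: the phases there lie in an
    interval of length 1, so [0 <= cr (W r) phi] means that [r] is zero or has phase at least
    [phi]. *)
Definition Pss phi : set C := [set x | [/\ H (lvl phi) x, cr (W x) phi = 0
  & forall k r, H (lvl phi) k -> H (lvl phi) r -> tri k x r -> 0 <= cr (W r) phi]].

Lemma Pss_hrt n phi x : n%:~R < phi <= n%:~R + 1 -> Pss phi x -> H n x.
Proof. by move=> /lvl_uniq <- []. Qed.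

Lemma cr_zero x phi : is_zero x -> cr (W x) phi = 0.
Proof. exact: (additive_zero (crWA phi)). Qed.

Lemma Pss_strict phi : strict (Pss phi).
Proof.
move=> x y xy [Hx Wx qx]; split; first exact: (hrt_strict tf xy).
  by rewrite -(additive_iso WA xy).
move=> k r Hk Hr T; apply: (qx k) => //; apply: (tri_iso T); try exact: isomorphic_refl.
exact: isomorphic_sym.
Qed.

Lemma hrt_zero_ext n x y z : H n x -> H n z -> tri x y z -> is_zero y -> is_zero z.
Proof.
move=> Hx Hz [f [g [h T]]] y0; apply: (tri_g0_hrt tf T (proj1 Hx) (proj2 Hz)).
exact: zero_to.
Qed.

Lemma Pss0 phi x : is_zero x -> Pss phi x.
Proof.
move=> x0; split; [exact: (hrt0 tf)|exact: cr_zero|move=> k r Hk Hr T].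
by rewrite cr_zero//; exact: hrt_zero_ext Hk Hr T x0.
Qed.

Lemma Pss_ext phi x y z : tri x y z -> Pss phi x -> Pss phi z -> Pss phi y.
Proof.
move=> T [Hx Wx qx] [Hz Wz qz]; have Hy := hrt_ext tf T Hx Hz; split=> //.
  by rewrite (crWA phi T) Wx Wz addr0.
move=> k r Hk Hr T'.
have [i [c [k1 [k2 [[Hi Hc Hk1 Hk2] [T1 T2 T3]]]]]] :=
  quotient_of_extension tf Hx Hy Hz Hk Hr T T'.
rewrite (crWA phi T3); apply: addr_ge0; first exact: qx T1.
exact: qz T2.
Qed.

Lemma Pss_additive phi : additive_subcategory (Pss phi).
Proof.
split; first exact: Pss_strict.
  by have [z z0] := has_zero C; exists z => //; exact: Pss0.
by move=> x y b Px Py /biproduct_triangle T; exact: Pss_ext T Px Py.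
Qed.

Lemma Pss_phase phi c : Pss phi c -> ~ is_zero c ->
  exists2 m : R, 0 < m & W c = pol m phi.
Proof.
move=> [Hc Wc _] c0; have [psi [m [/andP[p0 p1] m0 We]]] := phase_exists Hc c0.
exists m => //; have /andP[l0 l1] := lvlP phi.
suff <- : psi = phi by [].
by apply/eqP; rewrite eq_le; apply/andP; split;
  [apply: (pol_le m0); [lra|rewrite -We Wc]|apply: (pol_ge m0); [lra|rewrite -We Wc]].
Qed.

Lemma Pss_shift1 phi x : Pss (phi + 1) (shift x) <-> Pss phi x.
Proof.
rewrite /Pss /= lvl_shift; split=> -[Hx Wx qx]; split.
- exact/(hrt_shift tf).
- by rewrite -cr_shift -(additive_shift WA).
- move=> k r Hk Hr T; rewrite -cr_shift -(additive_shift WA).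
  by apply: (qx (shift k)); [exact/(hrt_shift tf)|exact/(hrt_shift tf)|exact: tri_shifted].
- exact/(hrt_shift tf).
- by rewrite (additive_shift WA) cr_shift.
- move=> k r Hk Hr T.
  have [k' kk'] := shift_surj_iso k; have [r' rr'] := shift_surj_iso r.
  rewrite (additive_iso WA rr') (additive_shift WA) cr_shift; apply: (qx k').
  + by apply/(hrt_shift tf); exact: (hrt_strict tf kk').
  + by apply/(hrt_shift tf); exact: (hrt_strict tf rr').
  + by apply: tri_of_rot; apply: (tri_iso T) => //; exact: isomorphic_refl.
Qed.

Lemma Pss_shift phi : Pss (phi + 1) = translate 1 (Pss phi).
Proof.
apply/seteqP; split=> y.
  have [x yx] := shift_surj_iso y => Py; exists x => //.
  by apply/Pss_shift1; exact: Pss_strict Py.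
move=> [x Px yx]; apply: (Pss_strict (isomorphic_sym yx)); exact/Pss_shift1.
Qed.

(** Within one shifted heart, a nonzero image would have phase at least [phi] as a quotient of [c]
    and at most [psi] as a subobject of [d]. Between different shifts the t-structure gives the
    vanishing. *)
Lemma Pss_hom phi psi c d : Pss phi c -> Pss psi d -> psi < phi ->
  forall f : hom c d, f = 0.
Proof.
move=> [Hc Wc qc] [Hd Wd qd] pp f.
have /andP[l0 l1] := lvlP phi; have /andP[k0 k1] := lvlP psi.
have lk : lvl psi <= lvl phi.
  rewrite -ltzD1 -(ltr_int R) intrD; lra.
have [e|ne] := eqVneq (lvl psi) (lvl phi); last first.
  apply: (tf_hom_le tf (proj1 Hc) (proj2 Hd)); move: ne lk; lia.
rewrite e in k0 k1 Hd qd.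
have [k [i [r [j [g [q [m [p [w [[Hk Hi Hr] [T1 T2 mg]]]]]]]]]]] := hrt_factor tf f Hc Hd.
have [i0|i0] := pselect (is_zero i); first by rewrite -mg (to_zero g i0) comp0r.
exfalso; have [th [u [/andP[t0 t1] u0 Wi]]] := phase_exists Hi i0.
have : phi <= th.
  apply: (pol_ge u0); first lra.
  by rewrite -Wi; apply: (qc k) => //; exists j, g, q.
have : th <= psi.
  apply: (pol_le u0); first lra.
  have T3 : tri i d r by exists m, p, w.
  rewrite -Wi -Wd (crWA psi T3) lerDl; exact: (qd i).
by move: pp; lra.
Qed.

Lemma cr_finite n (N : nat) : exists s : seq R[i],
  forall x, H n x -> (absz (ell x) <= N)%N -> W x \in s.
Proof.
have [s Hs] := W_finite N; exists [seq zsign n w | w <- s] => x Hx xN.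
have := Hs _ (susp_hrt0 Hx); rewrite (additive_susp _ _ ellA) (additive_susp _ _ WA) !zsignN.
move=> Hs'; apply/mapP; exists (zsign n (W x)); last by rewrite zsignK.
by apply: Hs'; move: xN; rewrite -(absz_zsign n); have := ell_sign_ge0 Hx; lia.
Qed.

Lemma min_finite (V : eqType) (s : seq V) (Q : V -> R -> Prop) :
  (forall v t t', Q v t -> Q v t' -> t = t') ->
  (exists v t, v \in s /\ Q v t) ->
  exists v t, [/\ v \in s, Q v t & forall v' t', v' \in s -> Q v' t' -> t <= t'].
Proof.
move=> Qu; elim: s => [|v s IH]; first by move=> [? [? []]].
have [/IH [v1 [t1 [vs Q1 min1]]] _|no] := pselect (exists v t, v \in s /\ Q v t).
  have [[t Qt]|nv] := pselect (exists t, Q v t); last first.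
    exists v1, t1; split=> // [|v' t']; first by rewrite in_cons vs orbT.
    rewrite in_cons => /orP[/eqP->|]; last exact: min1.
    by move=> Q'; case: nv; exists t'.
  have [tt|tt] := leP t t1.
    exists v, t; split=> // [|v' t']; first by rewrite in_cons eqxx.
    rewrite in_cons => /orP[/eqP-> /(Qu _ _ _ Qt)->//|vs' Q'].
    exact: le_trans tt (min1 _ _ vs' Q').
  exists v1, t1; split=> // [|v' t']; first by rewrite in_cons vs orbT.
  rewrite in_cons => /orP[/eqP-> /(Qu _ _ _ Qt) <-|]; [exact: ltW|exact: min1].
move=> [v1 [t1 []]]; rewrite in_cons => /orP[/eqP-> Q1|vs Q1]; last first.
  by case: no; exists v1, t1.
exists v, t1; split=> // [|v' t']; first by rewrite in_cons eqxx.
rewrite in_cons => /orP[/eqP-> /(Qu _ _ _ Q1)->//|vs Q'].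
by case: no; exists v', t'.
Qed.

(** Quotients of [y] are at most as long as [y], so their charges take finitely many values and a
    least phase is attained. A quotient attaining it is semistable because its quotients are again
    quotients of [y]. *)
Lemma min_quotient n y : H n y -> ~ is_zero y -> exists x q phi,
  [/\ H n x, H n q, tri x y q & ~ is_zero q] /\
  [/\ n%:~R < phi <= n%:~R + 1, Pss phi q &
   forall k r, H n k -> H n r -> tri k y r -> 0 <= cr (W r) phi].
Proof.
move=> Hy y0; have [s Hs] := cr_finite n (absz (ell y)).
pose Q (w : R[i]) t := exists k r m, [/\ H n k, H n r, tri k y r & ~ is_zero r] /\
  [/\ n%:~R < t <= n%:~R + 1, 0 < m, W r = w & w = pol m t].
have Qu w t t' : Q w t -> Q w t' -> t = t'.
  move=> [_ [_ [m [_ [/andP[a b] m0 _ wm]]]]] [_ [_ [m' [_ [/andP[a' b'] m0' _ wm']]]]].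
  have c1 : cr w t = 0 by rewrite wm cr_pol subrr mulr0 sin0 mulr0.
  by apply/eqP; rewrite eq_le; apply/andP; split;
    [apply: (pol_ge m0')|apply: (pol_le m0')]; rewrite -?wm' ?c1//; lra.
have Qin k r : H n k -> H n r -> tri k y r -> ~ is_zero r -> exists t, Q (W r) t /\ W r \in s.
  move=> Hk Hr T r0; have [t [m [tn m0 Wr]]] := phase_exists Hr r0.
  exists t; split; first by exists k, r, m.
  by apply: Hs => //; rewrite (len_add Hk Hr T) leq_addl.
have [|w [phi [ws [x [q [m [[Hx Hq T q0] [pn m0 Wq wm]]]]] mn]]] := min_finite Qu (s := s).
  have [z z0] := has_zero C; have Hz := hrt0 tf n z0.
  by have [t [Qt ts]] := Qin z y Hz Hy (tri_idr y z0) y0; exists (W y), t.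
have qmin k r : H n k -> H n r -> tri k y r -> 0 <= cr (W r) phi.
  move=> Hk Hr Tk; have [r0|r0] := pselect (is_zero r); first by rewrite cr_zero.
  have [t [Qt /mn /(_ Qt) pt]] := Qin k r Hk Hr Tk r0.
  case: Qt => _ [_ [m' [_ [/andP[tn t1] m0' _ ->]]]].
  rewrite cr_pol; apply: mulr_ge0; first exact: ltW.
  by apply: sin_pi_ge0; move: pn => /andP[a b]; apply/andP; split; lra.
exists x, q, phi; split=> //; split=> //; rewrite /Pss /= (lvl_uniq pn); split=> //.
  by rewrite Wq wm cr_pol subrr mulr0 sin0 mulr0.
move=> k r Hk Hr T'; have [k' T1 T2] := oct_fib_obj T T'.
by apply: (qmin k') => //; exact: (hrt_ext tf T2).
Qed.

Lemma filtration_hrt n s x : filtration Pss s x ->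
  (forall u, u \in unzip1 s -> n%:~R < u <= n%:~R + 1) -> H n x.
Proof.
move=> F Hs; apply: (filtration_ind (s := s) _ _ _ F).
- exact: (hrt0 tf).
- by move=> a b c; exact: (hrt_ext tf).
- by move=> u /Hs un y; exact: Pss_hrt.
Qed.

Lemma sorted_rcons_gt (s : seq R) u : sorted (fun x y : R => y < x) s ->
  (forall v, v \in s -> u < v) -> sorted (fun x y : R => y < x) (rcons s u).
Proof.
case: s => [//|v s] /= so us; rewrite rcons_path so /=; apply: us; exact: mem_last.
Qed.

(* The last factor is a quotient of least phase. It need not be the largest one:
   if the filtration of the kernel ends in the same phase, the two last factors
   are merged. *)
Lemma HN_hrt n y : H n y -> ~ is_zero y -> exists s, HN_filtration Pss s y /\
  forall u, u \in unzip1 s -> n%:~R < u <= n%:~R + 1.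
Proof.
move: {2}(absz _) (leqnn (absz (ell y))) => N.
elim: N y => [|N IH] y yN Hy y0; first by have := len_gt0 Hy y0; lia.
have [x [q [phi [[Hx Hq T q0] [pn Pq qmin]]]]] := min_quotient Hy y0.
have qz := len_gt0 Hq q0.
have [x0|x0] := pselect (is_zero x).
  exists [:: (phi, q)]; split; last by move=> u; rewrite inE => /eqP ->.
  split=> //; rewrite -[[:: _]]/(rcons [::] (phi, q)).
  by apply: filtration_rcons_tri T Pq q0; exact: filtration_nil.
have [|s [[F so] sn]] := IH x _ Hx x0; first by have := len_add Hx Hq T; lia.
case/lastP: s F so sn => [/filtration0//|s [psi a]] F so sn.
have [x' [F' T' Pa a0]] := filtration_rconsP F.
have an : n%:~R < psi <= n%:~R + 1.
  by apply: sn; rewrite /unzip1 map_rcons mem_rcons in_cons eqxx.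
have sn' u : u \in unzip1 s -> n%:~R < u <= n%:~R + 1.
  by move=> us; apply: sn; rewrite /unzip1 map_rcons mem_rcons in_cons us orbT.
have Hx' : H n x' by exact: filtration_hrt F' sn'.
have Ha := Pss_hrt an Pa.
have so' : pairwise (fun x y : R => y < x) (rcons (unzip1 s) psi).
  by rewrite -sorted_pairwise; [rewrite /unzip1 map_rcons in so|exact: gtr_trans].
have s_gt v : v \in unzip1 s -> psi < v.
  by move: so'; rewrite -cats1 pairwise_cat allrel1r => /and3P[/allP + _ _]; apply.
have [v T1 T2] := oct_cof_obj T' T.
have Hv := hrt_ext tf T2 Ha Hq.
have cra : 0 <= cr (W a) phi.
  have := qmin _ _ Hx' Hv T1; rewrite (crWA phi T2).
  by case: Pq => _ -> _; rewrite addr0.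
have pp : phi <= psi.
  have [m m0 Wa] := Pss_phase Pa a0; apply: (pol_ge m0); last by rewrite -Wa.
  by move: an pn => /andP[? ?] /andP[? ?]; lra.
have [e|ne] := eqVneq phi psi; last first.
  exists (rcons (rcons s (psi, a)) (phi, q)); split.
    split; first exact: filtration_rcons_tri F T Pq q0.
    rewrite /unzip1 map_rcons; apply: sorted_rcons_gt => // u.
    rewrite map_rcons mem_rcons in_cons => /orP[/eqP ->|/s_gt]; last exact: le_lt_trans.
    by rewrite lt_neqAle ne.
  move=> u; rewrite /unzip1 map_rcons mem_rcons in_cons => /orP[/eqP ->//|]; exact: sn.
subst psi; exists (rcons s (phi, v)); split.
  split; last by move: so; rewrite /unzip1 !map_rcons.
  apply: filtration_rcons_tri F' T1 _ _; first exact: Pss_ext T2 Pa Pq.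
  by move=> v0; apply: q0; exact: hrt_zero_ext Ha Hq T2 v0.
by move=> u; rewrite /unzip1 map_rcons => us; apply: sn; rewrite /unzip1 map_rcons.
Qed.

(** Filtrations of the cohomologies are concatenated; they stay sorted because the phases in [H n]
    are at most [n + 1] and those of the remaining part exceed [n + 1]. *)
Lemma Pss_HN c : ~ is_zero c -> exists s, HN_filtration Pss s c.
Proof.
have [n Lc] := tf_bndL tf c; have [m Rc] := tf_bndR tf c.
have {}Rc : Rr (n + `|m - n|%N%:Z) c by apply: (tf_leR tf) Rc; lia.
suff key d : forall n c, L n c -> Rr (n + d%:Z) c -> ~ is_zero c ->
    exists s, HN_filtration Pss s c /\ forall u, u \in unzip1 s -> n%:~R < u.
  by move=> c0; have [s [HN _]] := key _ n c Lc Rc c0; exists s.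
elim: d {n c m Lc Rc} => [|d IH] n c Lc Rc c0.
  by case: c0; apply: (tf_zero tf Lc); rewrite addr0 in Rc.
have [x [a [Lx Ha T]]] := tf_truncL tf Lc.
have Rx : Rr (n + 1 + d%:Z) x.
  apply: (tf_fibR tf T); first by apply: (tf_leR tf) Rc; lia.
  by apply: (tf_leR tf) (proj2 Ha); lia.
have [x0|x0] := pselect (is_zero x).
  have ca : isomorphic c a by case: T => f [g [h T]]; exists g; exact: tri_zero_l T x0.
  have [s [HN sn]] := HN_hrt (hrt_strict tf (isomorphic_sym ca) Ha) c0.
  by exists s; split=> // u /sn /andP[].
have [s [[Fx sox] snx]] := IH _ _ Lx Rx x0.
have snx' u : u \in unzip1 s -> n%:~R + 1 < u by move=> /snx; rewrite intrD.
have [a0|a0] := pselect (is_zero a).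
  have xc : isomorphic x c by case: T => f [g [h T]]; exists f; exact: tri_zero_r T a0.
  exists s; split; first by split=> //; exact: filtration_iso Fx.
  by move=> u /snx' ?; lra.
have [s' [[Fa soa] sna]] := HN_hrt Ha a0.
exists (s ++ s'); split; last first.
  move=> u; rewrite /unzip1 map_cat mem_cat => /orP[/snx'|/sna /andP[//]]; lra.
split; first exact: filtration_cat Fx T Fa.
rewrite /unzip1 map_cat sorted_pairwise; last exact: gtr_trans.
rewrite pairwise_cat -!sorted_pairwise; try exact: gtr_trans.
rewrite sox soa !andbT; apply/allrelP => u v /snx' un /sna /andP[_ vn]; lra.
Qed.

Lemma Pss_Z_phase phi c : Pss phi c -> ~ is_zero c ->
  exists2 m : R, 0 < m & W c = (m * cos (pi * phi) +i* (m * sin (pi * phi)))%C.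
Proof. exact: Pss_phase. Qed.

Lemma W_add x y z (f : hom x y) (g : hom y z) (h : hom z (shift x)) :
  triangle f g h -> W y = W x + W z.
Proof. by move=> T; apply: WA; exists f, g, h. Qed.

Definition stability_from_heart : stability_condition R C :=
  @StabilityCondition R C W W_add Pss Pss_additive Pss_Z_phase Pss_shift Pss_hom Pss_HN.
Notation sg := stability_from_heart.

Lemma heart_of_stability : heart_of sg = H 0.
Proof.
apply/seteqP; split=> [|x Hx]; last first.
  have [x0|x0] := pselect (is_zero x); first exact: ext_zero.
  have [s [[F _] sn]] := HN_hrt Hx x0.
  apply: (filtration_pin (sg := sg) (I := [set phi | 0 < phi <= 1]) F) => u /sn.
  by rewrite /= add0r.
apply: ext_closure_sub.
- by move=> x [phi pp Px]; apply: (Pss_hrt (phi := phi)) => //; rewrite add0r.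
- exact: (hrt0 tf).
- exact: (hrt_strict tf).
- by move=> x y z; exact: (hrt_ext tf).
Qed.

Lemma simple_semistable x phi m : simple (H 0) x -> 0 < phi <= 1 -> 0 < m ->
  W x = pol m phi -> P sg phi x.
Proof.
move=> Sx p01 m0 Wx; rewrite /= /Pss /= (lvl_uniq (n := 0)) ?add0r//.
have Hx : H 0 x by case: Sx.
have crx : cr (W x) phi = 0 by rewrite Wx cr_pol subrr mulr0 sin0 mulr0.
split=> // k r Hk Hr T.
have [k0|r0] := simple_tri tf Sx Hk Hr T; last by rewrite cr_zero.
by have := crWA phi T; rewrite /= (cr_zero phi k0) crx add0r => <-.
Qed.

Section LocallyFinite.
Variable th0 : R.
Hypothesis th0_01 : 0 < th0 < 1.
Hypothesis W_cone : forall x, H 0 x -> 0 <= cr (W x) th0.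

Lemma phase_gap n phi x : n%:~R < phi < n%:~R + th0 -> P sg phi x -> is_zero x.
Proof.
move=> /andP[p0 p1] Px; apply: contrapT => x0.
have /andP[t0 t1] := th0_01.
have pn : n%:~R < phi <= n%:~R + 1 by apply/andP; split; lra.
have Hx := Pss_hrt pn Px; have [m m0 Wx] := Pss_phase Px x0.
have := W_cone (susp_hrt0 Hx); rewrite (additive_susp _ _ WA) zsignN.
rewrite -(cr_zsign n) zsignK Wx => /(pol_ge m0); lra.
Qed.

(* No phase lies in ]m, m + th0[ for m an integer, so a window of length th0
   meets the phases of a single shift of the heart. *)
Lemma P_itv_hrt t : exists n, P_itv sg (t - th0 / 2) (t + th0 / 2) `<=` H n.
Proof.
have /andP[t0 t1] := th0_01; exists (Num.floor (t - th0 / 2)).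
have fl := floor_le_tmp (t - th0 / 2); have fu := floorD1_gt (t - th0 / 2).
rewrite intrD in fu.
apply: ext_closure_sub.
- move=> x [phi /andP[p0 p1] Px].
  have [pn|pn] := lerP phi ((Num.floor (t - th0 / 2))%:~R + 1).
    by apply: Pss_hrt Px; apply/andP; split=> //; lra.
  apply: (hrt0 tf); apply: (phase_gap (n := Num.floor (t - th0 / 2) + 1)) Px.
  by rewrite intrD; apply/andP; split; lra.
- exact: (hrt0 tf).
- exact: (hrt_strict tf).
- by move=> x y z; exact: (hrt_ext tf).
Qed.

(** A strict monomorphism is a kernel only inside [P_itv sg a b]. The kernel [k] of [p] in the heart
    may have phases at most [a]; its part [k1] with phases above [a] lies in [P_itv sg a b], is a
    subobject of [e] in the heart, and [i] factors through it by a split monomorphism. *)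
Lemma strict_mono_mono n (a b : R) x e (i : hom x e) :
  P_itv sg a b `<=` H n -> P_itv sg a b x -> P_itv sg a b e ->
  strict_mono (P_itv sg a b) i -> mono (H n) i.
Proof.
move=> EH Ex Ee [z [p [Ez [p_i ker]]]].
have [k [i' [c [j [g [q [m [p' [r [[Hk Hi Hc] [T1 T2 mg]]]]]]]]]]] :=
  hrt_factor tf p (EH _ Ee) (EH _ Ez).
have [s [[F so] sn]] : exists s, HN_filtration Pss s k /\
    forall u, u \in unzip1 s -> n%:~R < u <= n%:~R + 1.
  have [k0|k0] := pselect (is_zero k); last exact: HN_hrt.
  by exists [::]; split=> //; split=> //; exact: filtration_nil.
have [s1 [s2 [es s1a s2a]]] := sorted_split a so; subst s.
have [k1 [k2 [F1 F2 [f1 [g1 [h1 T3]]]]]] := filtration_split F.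
move: so sn; rewrite /unzip1 map_cat => so sn.
have Hk1 : H n k1 by apply: filtration_hrt F1 _ => u us; apply: sn; rewrite mem_cat us.
have Hk2 : H n k2 by apply: filtration_hrt F2 _ => u us; apply: sn; rewrite mem_cat us orbT.
have [v [e' [k' [T4 T5]]]] := oct_cof T3 T1.
have Hv : H n v by exact: (hrt_ext tf T5).
have jf1_mono w (u : hom w k1) : L n w -> j \oc f1 \oc u = 0 -> u = 0.
  by move=> Lw; apply: (hrt_mono tf T4 Lw (proj2 Hv)).
have HN1 : HN_filtration (P sg) s1 k1.
  split=> //; move: so; rewrite sorted_pairwise; last exact: gtr_trans.
  by rewrite pairwise_cat -sorted_pairwise; [case/and3P|exact: gtr_trans].
(* All phases of [k1] are below [b], since its first factor has a nonzero map to [e]. *)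
have Ek1 : P_itv sg a b k1.
  apply: (filtration_pin (sg := sg) (I := [set phi | a < phi < b]) F1) => u us /=.
  rewrite s1a//=; have /andP[_ uh] := HN_mem HN1 us; apply: le_lt_trans uh _.
  case: s1 us F1 HN1 sn {so F s1a} => [//|[psi c1] s1] _ F1 HN1 sn /=.
  have [a1 [c' [f [g' [h [/= Pa a0 _ _ f0]]]]]] := HN_first HN1.
  rewrite ltNge; apply/negP => bp; apply: f0; apply: jf1_mono.
    suff : H n a1 by case.
    by apply: (Pss_hrt (phi := psi)) => //; apply: sn; rewrite /= mem_head.
  apply: (hom_pin (sg := sg) (I := [set psi]) (J := [set phi | a < phi < b])) => //.
    by move=> phi v1 -> /andP[_ ub]; exact: lt_le_trans bp.
  exact: (@pin_P _ _ sg _ psi).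
have jf1 : p \oc (j \oc f1) = 0.
  by rewrite -mg -compA (compA g) (tri_comp0 T1) comp0l comp0r.
have [w [iw _]] := ker k1 (j \oc f1) Ek1 jf1.
have [|u iu] := tri_ker (u := i) T1.
  by apply: (hrt_mono tf T2 (proj1 (EH _ Ex)) (proj2 Hc)); rewrite compA mg.
have [|be ube] := tri_ker (u := u) T3.
  apply: (hom_pin (sg := sg) (I := [set phi | a < phi < b]) (J := [set phi | phi <= a])) => //.
    by move=> phi psi /= /andP[ap _] /le_lt_trans; apply.
  exact: (filtration_pin (sg := sg) F2).
have wbe : w \oc be = idm x.
  have [v' [_ uniq]] := ker x i Ex p_i.
  rewrite -(uniq (w \oc be)) ?(uniq (idm x))//; first exact: comp_idr.
  by rewrite compA iw -compA -ube -iu.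
move=> d ud Hd iud; rewrite -(comp_idl ud) -wbe -compA.
rewrite (jf1_mono _ (be \oc ud)) ?comp0r//; first by case: Hd.
by rewrite compA -(compA j) -ube -iu.
Qed.

Lemma nonincreasing_stable (f : nat -> nat) : (forall n : nat, f n.+1 <= f n)%N ->
  exists N : nat, forall n : nat, (N <= n)%N -> f n.+1 = f n.
Proof.
move=> df; have ex : exists v, `[< exists n : nat, f n = v >] by exists (f 0%N); apply/asboolP; exists 0%N.
case: (ex_minnP ex) => v /asboolP[N fN] vmin; exists N => n Nn.
have fle : (f n <= v)%N.
  rewrite -fN; elim: n Nn => [|n IH]; first by rewrite leqn0 => /eqP ->.
  by rewrite leq_eqVlt => /orP[/eqP ->//|/IH]; exact: leq_trans.
by apply/eqP; rewrite eqn_leq df (leq_trans fle)//; apply: vmin; apply/asboolP; exists n.+1.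
Qed.

Lemma mono_len n x y (f : hom x y) : H n x -> H n y -> mono (H n) f ->
  (absz (ell x) <= absz (ell y))%N /\ (absz (ell x) = absz (ell y) -> is_iso f).
Proof.
move=> Hx Hy fm; have [c [p [r [Hc T]]]] := mono_tri tf Hx Hy fm.
have e : absz (ell y) = (absz (ell x) + absz (ell c))%N.
  by apply: (len_add Hx Hc); exists f, p, r.
split=> [|exy]; first by rewrite e leq_addr.
apply: (tri_zero_r T); apply: contrapT => c0.
by have := len_gt0 Hc c0; lia.
Qed.

(** In a chain of strict subobjects of [e] the lengths are monotone and at most that of [e]; where
    the length is constant the inclusion is an isomorphism. *)
Lemma stability_locally_finite : locally_finite sg.
Proof.
have /andP[t0 t1] := th0_01.
exists (th0 / 2); split; first by apply/andP; split; lra.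
move=> t; have [n EH] := P_itv_hrt t.
have mono_comp x y e (i : hom x e) (j : hom y e) (w : hom x y) :
    mono (H n) i -> i = j \oc w -> mono (H n) w.
  by move=> im iw z u Hz wu; apply: im => //; rewrite iw -compA wu comp0r.
split=> e x i Ee Hx fac.
- have Hxm (m : nat) := strict_mono_mono EH (proj1 (Hx m)) Ee (proj2 (Hx m)).
  pose w (m : nat) := sval (cid (fac m)); have wE (m : nat) := svalP (cid (fac m)).
  have wl (m : nat) := mono_len (EH _ (proj1 (Hx m.+1))) (EH _ (proj1 (Hx m)))
    (mono_comp _ _ _ _ _ _ (Hxm m.+1) (wE m)).
  have [N HN] := nonincreasing_stable (fun m : nat => proj1 (wl m)).
  exists N => m Nm; have [w' [w1 w2]] := proj2 (wl m) (HN m Nm).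
  by exists w'; rewrite (wE m) -compA w2 comp_idr.
- have Hxm (m : nat) := strict_mono_mono EH (proj1 (Hx m)) Ee (proj2 (Hx m)).
  pose w (m : nat) := sval (cid (fac m)); have wE (m : nat) := svalP (cid (fac m)).
  have wl (m : nat) := mono_len (EH _ (proj1 (Hx m))) (EH _ (proj1 (Hx m.+1)))
    (mono_comp _ _ _ _ _ _ (Hxm m) (wE m)).
  have xe (m : nat) := proj1 (mono_len (EH _ (proj1 (Hx m))) (EH _ Ee) (Hxm m)).
  have [|N HN] := @nonincreasing_stable (fun m : nat => absz (ell e) - absz (ell (x m)))%N.
    by move=> m; have := proj1 (wl m); lia.
  exists N => m Nm; have [|w' [w1 w2]] := proj2 (wl m).
    by have := HN m Nm; have := xe m; have := xe m.+1; lia.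
  by exists w'; rewrite (wE m) -compA w2 comp_idr.
Qed.

End LocallyFinite.
End FromHeart.

(** * Masses and the metric *)

Section Crofton.
Variable R : realType.
Implicit Types (z w : R[i]) (phi psi m : R).
Notation nc := (@ComplexField.Normc.normc R).

Lemma cr_le_normc z phi : `|cr z phi| <= nc z.
Proof.
case: z => a b; rewrite /cr /nc /= -sqrtr_sqr ler_wsqrtr//.
have -> : a ^+ 2 + b ^+ 2 = (b * cos (pi * phi) - a * sin (pi * phi)) ^+ 2 +
    (a * cos (pi * phi) + b * sin (pi * phi)) ^+ 2.
  transitivity ((a ^+ 2 + b ^+ 2) * (cos (pi * phi) ^+ 2 + sin (pi * phi) ^+ 2)).
    by rewrite cos2Dsin2 mulr1.
  by ring.
by rewrite lerDl sqr_ge0.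
Qed.

Lemma normc_pol m phi : 0 <= m -> nc (pol m phi) = m.
Proof.
move=> m0; rewrite /nc /pol /= !exprMn -mulrDr cos2Dsin2 mulr1 sqrtr_sqr.
by rewrite ger0_norm.
Qed.

(** A Riemann sum, up to normalisation, for the integral of |sin| over the directions [l / (M + 1)]:
    the total height of a unit vector of phase [phi]. *)
Definition sinsum (M : nat) phi : R := \sum_(l < M.+1) `|sin (pi * (phi - l%:R / M.+1%:R))|.

Lemma sinsum_periodic (M : nat) phi : sinsum M (phi + M.+1%:R^-1) = sinsum M phi.
Proof.
rewrite /sinsum big_ord_recl big_ord_recr /= [LHS]addrC; congr (_ + _).
  apply: eq_bigr => i _; rewrite /bump /= add1n.
  have -> : (i.+1%:R : R) = i%:R + 1 by rewrite natr1.
  by congr (`|sin (pi * _)|); ring.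
rewrite mul0r subr0.
have -> : phi + M.+1%:R^-1 = phi - M%:R / M.+1%:R + 1.
  have : M%:R / M.+1%:R + M.+1%:R^-1 = 1 :> R.
    by rewrite -[X in _ + X]mul1r -mulrDl natr1 divff.
  by move: (M%:R / M.+1%:R : R) (M.+1%:R^-1 : R) => u v uv; lra.
by rewrite mulrDr mulr1 sinDpi normrN.
Qed.

Lemma sinsum_periodicz (M : nat) (k : int) phi :
  sinsum M (phi + k%:~R / M.+1%:R) = sinsum M phi.
Proof.
elim/translate_ind: k => [|k IH|k IH]; first by rewrite mul0r addr0.
  by rewrite intrD mulrDl mul1r addrA sinsum_periodic.
by rewrite -sinsum_periodic -addrA -[X in _ + (_ + X)]mul1r -mulrDl -intrD1.
Qed.

(** For [phi] in the first cell of the grid all signs of the sines are known; multiplication by the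
    sine of half a grid step makes the sum telescope. *)
Lemma sinsum_fundamental (M : nat) phi : 0 <= phi < M.+1%:R^-1 ->
  sinsum M phi * sin (pi * (M.+1%:R^-1 / 2)) = cos (pi * (phi - M.+1%:R^-1 / 2)).
Proof.
rewrite /sinsum; set N : R := M.+1%:R.
have N0 : 0 < N by rewrite ltr0n.
have N1 : N^-1 <= 1 by rewrite invf_le1// ler1n.
have NE : M%:R = N - 1 by rewrite /N -natr1 addrK.
clearbody N; set d := N^-1 / 2 => /andP[p0 p1].
have tele (x : R) : sin (pi * x) * sin (pi * d) * 2 = cos (pi * (x - d)) - cos (pi * (x + d)).
  rewrite (mulrBr pi x d) (mulrDr pi x d) cosB (cosD (pi * x)); ring.
have lN (l : nat) : (l < M)%N -> l.+1%:R / N <= 1 - N^-1.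
  move=> lM; rewrite -(ler_pM2r N0) mulrBl divfK ?gt_eqF// mul1r mulVf ?gt_eqF//.
  by rewrite -NE ler_nat.
rewrite big_ord_recl /= mul0r subr0 ger0_norm; last first.
  by apply: sin_pi_ge0; apply/andP; split=> //; lra.
have -> : \sum_(i < M) `|sin (pi * (phi - (bump 0 i)%:R / N))| =
    \sum_(0 <= i < M) sin (pi * (i.+1%:R / N - phi)).
  rewrite big_mkord; apply: eq_bigr => i _; rewrite /bump /= add1n -normrN -sinN -mulrN opprB.
  rewrite ger0_norm//; apply: sin_pi_ge0; have := lN _ (ltn_ord i) => lN'.
  apply/andP; split; last by lra.
  rewrite subr_ge0; apply: le_trans (ltW p1) _.
  by apply: ler_peMl; [rewrite invr_ge0; exact: ltW|rewrite ler1n].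
suff S : (\sum_(0 <= i < M) sin (pi * (i.+1%:R / N - phi))) * sin (pi * d) * 2 =
    cos (pi * (d - phi)) + cos (pi * (phi + d)).
  apply: (mulIf (_ : (2 : R) != 0)); first by rewrite pnatr_eq0.
  rewrite mulrDl mulrDl S tele.
  have -> : cos (pi * (d - phi)) = cos (pi * (phi - d)) by rewrite -opprB mulrN cosN.
  ring.
pose g (i : nat) := - cos (pi * (i%:R / N - phi + d)).
rewrite !mulr_suml (eq_big_nat _ _ (F2 := fun i => g i.+1 - g i)); last first.
  move=> i _; rewrite tele /g opprK addrC; congr (_ + cos (pi * _)).
  by rewrite -natr1 mulrDl mul1r /d; field; rewrite gt_eqF.
rewrite telescope_sumr// /g opprK addrC mul0r sub0r [- phi + d]addrC; congr (_ + _).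
have -> : M%:R / N - phi + d = - (phi + d) + 1.
  by rewrite NE mulrBl divff ?gt_eqF// /d; field; rewrite gt_eqF.
by rewrite mulrDr mulr1 cosDpi opprK mulrN cosN.
Qed.

(** Periodicity moves [phi] to the first cell, where its distance to the midpoint of the cell is at
    most half a grid step. *)
Lemma sinsum_bounds (M : nat) phi :
  cos (pi * (M.+1%:R^-1 / 2)) <= sinsum M phi * sin (pi * (M.+1%:R^-1 / 2)) <= 1.
Proof.
have := @sinsum_fundamental M; have := @sinsum_periodicz M.
set N : R := M.+1%:R; have N0 : 0 < N by rewrite ltr0n.
have N1 : N^-1 <= 1 by rewrite invf_le1// ler1n.
clearbody N => periodic fundamental; pose k := Num.floor (phi * N); pose r := phi - k%:~R / N.
have rI : 0 <= r < N^-1.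
  have f1 := floor_le_tmp (phi * N); have f2 := floorD1_gt (phi * N).
  rewrite /r subr_ge0 ler_pdivrMr// f1 ltrBlDl -[X in _ + X]mul1r -mulrDl.
  by rewrite ltr_pdivlMr// -intrD1.
have -> : phi = r + k%:~R / N by rewrite /r subrK.
rewrite periodic fundamental// cos_le1 andbT.
move: rI => /andP[r0 r1]; have p0 := @pi0 R.
have -> : cos (pi * (r - N^-1 / 2)) = cos (pi * `|r - N^-1 / 2|).
  by case: ger0P => // _; rewrite mulrN cosN.
have rN : `|r - N^-1 / 2| <= N^-1 / 2 by rewrite ler_norml; apply/andP; split; lra.
have iN : 0 < N^-1 by rewrite invr_gt0.
have inI (x : R) : 0 <= x <= 1 -> pi * x \in `[0, pi : R].
  move=> /andP[x0 x1]; have p0' := ltW p0; rewrite in_itv/=.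
  apply/andP; split; first exact: mulr_ge0.
  by rewrite ler_piMr.
rewrite leNgt ltr_cos; last 2 first.
- by apply: inI; apply/andP; split; lra.
- by apply: inI; rewrite normr_ge0; lra.
by rewrite -leNgt ler_pM2l.
Qed.

Lemma cos_near0 (e : R) : 0 < e -> exists2 d : R, 0 < d & forall x, `|x| < d -> 1 - e < cos x.
Proof.
move=> e0; have : cos x @[x --> (0 : R)] --> cos (0 : R) by exact: continuous_cos.
rewrite cos0 => /cvgrPdist_lt /(_ e e0).
move=> /nbhs_ballP [d /= d0 H]; exists d => // x xd.
have := H x; rewrite /ball /= sub0r normrN => /(_ xd).
by rewrite ltr_norml => /andP[_]; lra.
Qed.

Lemma cos_grid_limit (a b : R) : 0 <= a ->
  (forall M : nat, a * cos (pi * (M.+1%:R^-1 / 2)) <= b) -> a <= b.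
Proof.
move=> a0 H; apply/ler_addgt0Pr => e e0.
(* The denominator [a + 1] covers the case [a = 0]. *)
have [d d0 cd] := cos_near0 (e := e / (a + 1)) (divr_gt0 e0 (ltr_wpDl a0 ltr01)).
pose M := Num.truncn (pi / d); have p0 := @pi0 R.
have Md : pi / d < M.+1%:R.
  by have := truncnS_gt (pi / d).
have iN : 0 < (M.+1%:R^-1 : R) by rewrite invr_gt0 ltr0n.
have : 1 - e / (a + 1) < cos (pi * (M.+1%:R^-1 / 2)).
  apply: cd; rewrite ger0_norm; last by rewrite mulr_ge0 ?ltW// divr_gt0.
  have : pi * M.+1%:R^-1 < d.
    by rewrite ltr_pdivrMr ?ltr0n// mulrC -ltr_pdivrMr.
  rewrite mulrA; have := mulr_gt0 p0 iN.
  by move: (pi * M.+1%:R^-1 : R) => u u0 ud; lra.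
move=> /ltW /(ler_wpM2l a0); rewrite mulrBr mulr1 => h.
have {}h := le_trans h (H M); rewrite -lerBlDr; apply: le_trans h.
rewrite lerD2l lerN2 mulrA ler_pdivrMr ?ltr_wpDl// mulrC mulrDr mulr1 lerDl.
exact: ltW.
Qed.

End Crofton.

(** * Masses: Crofton's formula and subadditivity *)

Section Mass.
Variables (R : realType) (C : triangulated_category) (sg : stability_condition R C).
Implicit Types (x y z c a : C) (phi psi t : R) (s : seq (R * C)).
Notation P := (P sg).
Notation Z := (Z sg).
Notation nc := (@ComplexField.Normc.normc R).
Notation fm := (filtration_mass sg).

Lemma le_nc_add (z w : R[i]) : nc (z + w) <= nc z + nc w.
Proof. exact: (@le_normcD R z w). Qed.

Lemma Z_tri : tri_additive Z.
Proof. by move=> x y z [f [g [h T]]]; exact: Z_add T. Qed.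

Lemma crZ_tri t : tri_additive (fun x => cr (Z x) t).
Proof. by move=> x y z /Z_tri ->; rewrite crD. Qed.

Lemma Z_pol phi a : P phi a -> ~ is_zero a -> exists2 m : R, 0 < m & Z a = pol m phi.
Proof. exact: Z_phase. Qed.

Lemma cr_zsignE (n : int) (z : R[i]) t : cr (zsign n z) t = zsign n (cr z t).
Proof. by rewrite /zsign; case: (odd _) => //; rewrite crN. Qed.

Lemma hrt_pin t (n : int) x : hrt (gtL sg t) (leR sg t) n x ->
  pin sg [set phi | t + n%:~R < phi <= t + n%:~R + 1] x.
Proof.
move=> [Lx Rx]; have [x0|x0] := pselect (is_zero x); first exact: ext_zero.
have [s HN] := P_HN sg x0; apply: (filtration_pin (proj1 HN)) => u us /=.
have [phi [_ [pI _ /andP[pu _]]]] := HN_pin_mem x0 HN Lx us.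
have [_ [psi [_ qI /andP[_ uq]]]] := HN_pin_mem x0 HN Rx us.
by move: pI qI => /= pI; rewrite intrD addrA => qI; apply/andP; split; lra.
Qed.

Lemma cr_pin_ge0 t (n : int) x : pin sg [set phi | t + n%:~R < phi <= t + n%:~R + 1] x ->
  0 <= zsign n (cr (Z x) t).
Proof.
move: x; apply: ext_closure_sub => [x [phi /= /andP[p0 p1] Px]|x x0|x y xy|x y z T] /=.
- have [x0|x0] := pselect (is_zero x).
    by rewrite (additive_zero (crZ_tri t) x0) /zsign oppr0 if_same.
  have [m m0 ->] := Z_pol Px x0.
  rewrite -cr_zsignE -zsignN zsign_pol cr_pol mulrNz; apply: mulr_ge0; first exact: ltW.
  by apply: sin_pi_ge0; apply/andP; split; lra.
- by rewrite (additive_zero (crZ_tri t) x0) /zsign oppr0 if_same.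
- by rewrite (additive_iso (crZ_tri t) xy).
- by rewrite (crZ_tri t T) zsignD => ? ?; exact: addr_ge0.
Qed.

Definition Gt t (n : int) x : R := zsign n (cr (Z x) t).

Lemma Gt_add t (n : int) x y z : hrt (gtL sg t) (leR sg t) n x ->
  hrt (gtL sg t) (leR sg t) n y -> hrt (gtL sg t) (leR sg t) n z ->
  tri x y z -> Gt t n y = Gt t n x + Gt t n z.
Proof. by move=> _ _ _ /(crZ_tri t) e; rewrite /Gt e zsignD. Qed.

Lemma Gt_shift t (n : int) x : hrt (gtL sg t) (leR sg t) n x ->
  Gt t (n + 1) (shift x) = sgn_op false (Gt t n x).
Proof.
by move=> _; rewrite /Gt (additive_shift (crZ_tri t)) zsignS /sgn_op /zsign;
  case: (odd _); rewrite ?opprK.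
Qed.

(* [ht t c] is the total height, over all cohomologies for the heart P(t,t+1],
   of the central charge above the line of phase t. *)
Definition ht t c : R := Tco (slicing_family sg t) (Gt t) c.

(** Heights do not change sign under the shift, so the images of the connecting maps are counted in
    both [x] and [z]: the defect of the inequality is twice their height [p]. *)
Lemma ht_sub t x y z : tri x y z -> ht t y <= ht t x + ht t z.
Proof.
move=> T; have [p [q [r [[p0 q0 r0] [e1 e2 e3]]]]] :=
  long_exact (slicing_family sg t) (@Gt_add t) (@Gt_shift t) (N := fun v : R => 0 <= v)
    (lexx 0) (@addr_ge0 R) (fun _ v0 => v0) (fun n x Hx => cr_pin_ge0 (hrt_pin Hx)) T.
by rewrite /ht e1 e2 e3 /sgn_op; lra.
Qed.

(** A semistable factor lies in a single shift of the heart P(t, t + 1], so its total height is the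
    modulus of its signed height. *)
Lemma ht_HN t s c : HN_filtration P s c -> ht t c = \sum_(u <- s) `|cr (Z u.2) t|.
Proof.
move=> [F so]; elim/last_ind: s c F so => [|s [phi a] IH] c F so.
  by rewrite big_nil /ht (Tco0 _ (Gt_add (t := t)))//; exact: filtration0 F.
have [c' [F' T Pa a0]] := filtration_rconsP F.
have so' : sorted (fun x y : R => y < x) (unzip1 s).
  move: so; rewrite /unzip1 map_rcons !sorted_pairwise; try exact: gtr_trans.
  by rewrite -cats1 pairwise_cat => /and3P[].
have c'P : pin sg [set psi | phi < psi] c'.
  apply: (filtration_pin F') => u us /=.
  move: so; rewrite /unzip1 map_rcons -cats1 sorted_pairwise; last exact: gtr_trans.
  by rewrite pairwise_cat allrel1r => /and3P[/allP/(_ _ us)].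
pose n : int := Num.ceil (phi - t) - 1.
have /andP[n0 n1] : n%:~R < phi - t <= n%:~R + 1.
  by have := ceil_itv (phi - t); rewrite /n intrD /= subrK.
have Ha : pin sg [set psi | t + n%:~R < psi <= t + n%:~R + 1] a.
  by apply: pin_P Pa => /=; apply/andP; split; lra.
have Hn : hrt (gtL sg t) (leR sg t) n a.
  split; apply: pin_sub Ha => psi /= /andP[// q0 q1].
  by rewrite intrD addrA.
have Lc' : gtL sg t n c' by apply: pin_sub c'P => psi /=; lra.
rewrite -cats1 big_cat big_seq1 /= -(IH _ F' so') /ht.
rewrite (Tco_tri (slicing_family sg t) (@Gt_add t) Lc' Hn T); congr (_ + _).
have ge0 := cr_pin_ge0 Ha; rewrite -[LHS](ger0_norm ge0) /Gt /zsign.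
by case: (odd _); rewrite ?normrN.
Qed.

Lemma fm_rcons s phi a : fm (rcons s (phi, a)) = fm s + nc (Z a).
Proof. by rewrite /filtration_mass -cats1 big_cat big_seq1. Qed.

(** A factor contributes its mass times [sinsum] at its phase, which [sinsum_bounds] encloses after
    normalisation by the sine of half a grid step. *)
Lemma crofton_filtration (M : nat) s c : filtration P s c ->
  let d : R := M.+1%:R^-1 / 2 in
  let S := \sum_(l < M.+1) \sum_(u <- s) `|cr (Z u.2) (l%:R / M.+1%:R)| in
  fm s * cos (pi * d) <= S * sin (pi * d) <= fm s.
Proof.
elim/last_ind: s c => [|s [phi a] IH] c F /=.
  rewrite /filtration_mass big_nil big1 ?mul0r ?lexx// => l _.
  by rewrite big_nil.
have [c' [F' T Pa a0]] := filtration_rconsP F.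
have [m m0 Za] := Z_pol Pa a0.
have /andP[i1 i2] := IH _ F'; rewrite fm_rcons Za normc_pol ?(ltW m0)//.
have -> : \sum_(l < M.+1) \sum_(u <- rcons s (phi, a)) `|cr (Z u.2) (l%:R / M.+1%:R)| =
    \sum_(l < M.+1) \sum_(u <- s) `|cr (Z u.2) (l%:R / M.+1%:R)| + m * sinsum M phi.
  rewrite /sinsum mulr_sumr -big_split /=; apply: eq_bigr => l _.
  rewrite -cats1 big_cat big_seq1 /= Za cr_pol normrM ger0_norm ?(ltW m0)//.
have /andP[b1 b2] := sinsum_bounds M phi.
rewrite (mulrDl (fm s)) (mulrDl _ (m * _)) -(mulrA m).
apply/andP; split; apply: lerD => //.
  by rewrite ler_pM2l.
by rewrite -[X in _ <= X]mulr1 ler_pM2l.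
Qed.

Lemma fm_ge0 s : 0 <= fm s.
Proof.
by apply: sumr_ge0 => u _; case: (Z u.2) => a b /=; exact: sqrtr_ge0.
Qed.

Lemma fm_sub x y z sx sy sz : tri x y z -> HN_filtration P sx x ->
  HN_filtration P sy y -> HN_filtration P sz z -> fm sy <= fm sx + fm sz.
Proof.
move=> T Hx Hy Hz; apply: cos_grid_limit => [|M]; first exact: fm_ge0.
have /andP[y1 _] := crofton_filtration M (proj1 Hy).
have /andP[_ x2] := crofton_filtration M (proj1 Hx).
have /andP[_ z2] := crofton_filtration M (proj1 Hz).
apply: le_trans y1 _; apply: le_trans (lerD x2 z2).
rewrite -mulrDl -big_split /=; apply: ler_wpM2r.
  apply: sin_pi_ge0; have : (M.+1%:R^-1 : R) <= 1 by rewrite invf_le1 ?ltr0n// ler1n.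
  have : 0 < (M.+1%:R^-1 : R) by rewrite invr_gt0 ltr0n.
  by move: (M.+1%:R^-1 : R) => v v0 v1; apply/andP; split; lra.
apply: ler_sum => l _; rewrite -(ht_HN _ Hx) -(ht_HN _ Hy) -(ht_HN _ Hz); exact: ht_sub.
Qed.

(** Subadditivity on the triangle c → c → 0, applied in both directions. *)
Lemma fm_uniq c s s' : HN_filtration P s c -> HN_filtration P s' c -> fm s = fm s'.
Proof.
have key s1 s2 : HN_filtration P s1 c -> HN_filtration P s2 c -> fm s1 <= fm s2.
  move=> H1 H2; have [z z0] := has_zero C.
  have Hz : HN_filtration P [::] z by split=> //; exact: filtration_nil.
  have := fm_sub (tri_id c z0) H2 H1 Hz.
  by rewrite [X in _ + X]/filtration_mass big_nil addr0.
by move=> H H'; apply/eqP; rewrite eq_le !key.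
Qed.

Lemma massE c s : HN_filtration P s c -> mass sg c = fm s.
Proof.
move=> Hs; rewrite /mass; set X := (X in xget _ X).
have : X (xget 0 X) by apply: xgetPex; exists (fm s), s.
by move=> [s' Hs' ->]; exact: fm_uniq Hs' Hs.
Qed.

Lemma mass_tri x y z : tri x y z -> mass sg y <= mass sg x + mass sg z.
Proof.
have [sx Hx] := HN_exists sg x; have [sy Hy] := HN_exists sg y.
have [sz Hz] := HN_exists sg z.
by move=> T; rewrite (massE Hx) (massE Hy) (massE Hz); exact: fm_sub T Hx Hy Hz.
Qed.

Lemma mass_zero x : is_zero x -> mass sg x = 0.
Proof.
move=> x0; rewrite (@massE x [::]); last by split=> //; exact: filtration_nil.
by rewrite /filtration_mass big_nil.
Qed.

Lemma HN_semistable phi a : P phi a -> ~ is_zero a -> HN_filtration P [:: (phi, a)] a.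
Proof.
move=> Pa a0; split=> //; have [z z0] := has_zero C.
rewrite -[[:: _]]/(rcons [::] (phi, a)).
by apply: filtration_rcons_tri (tri_idr a z0) Pa a0; exact: filtration_nil.
Qed.

Lemma mass_semistable phi a : P phi a -> mass sg a = nc (Z a).
Proof.
move=> Pa; have [a0|a0] := pselect (is_zero a).
  by rewrite mass_zero// (additive_zero Z_tri a0) ComplexField.Normc.normc0.
by rewrite (massE (HN_semistable Pa a0)) /filtration_mass big_seq1.
Qed.

Lemma mass_filtration (Q : R -> set C) s c : filtration Q s c ->
  mass sg c <= \sum_(u <- s) mass sg u.2.
Proof.
elim/last_ind: s c => [|s [phi a] IH] c F.
  by rewrite big_nil mass_zero//; exact: filtration0 F.
have [c' [F' T _ _]] := filtration_rconsP F.
rewrite -cats1 big_cat big_seq1 /=; apply: le_trans (mass_tri T) _.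
by rewrite lerD2r; exact: IH.
Qed.

Lemma cos_pi_le (u v : R) : `|u| <= v -> v <= 1 -> cos (pi * v) <= cos (pi * u).
Proof.
move=> uv v1; have p0 := @pi0 R.
have inI (x : R) : 0 <= x <= 1 -> pi * x \in `[0, pi : R].
  move=> /andP[x0 x1]; have p0' := ltW p0; rewrite in_itv/=.
  apply/andP; split; first exact: mulr_ge0.
  by rewrite ler_piMr.
have -> : cos (pi * u) = cos (pi * `|u|) by case: ger0P => // _; rewrite mulrN cosN.
have u0 := normr_ge0 u.
rewrite leNgt ltr_cos; last 2 first.
- by apply: inI; apply/andP; split; lra.
- by apply: inI; apply/andP; split; lra.
by rewrite -leNgt ler_pM2l.
Qed.

(** The line of phase [psi - 1/2] is perpendicular to the direction [psi], so the height above it is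
    the projection to that direction; a factor of mass m and phase phi contributes m cos(pi (phi -
    psi)). *)
Lemma filtration_width psi (eta : R) s c : eta <= 1 -> filtration P s c ->
  (forall u, u \in unzip1 s -> `|u - psi| <= eta) ->
  fm s * cos (pi * eta) <= cr (Z c) (psi - 2^-1).
Proof.
move=> e1; elim/last_ind: s c => [|s [phi a] IH] c F Hs.
  rewrite /filtration_mass big_nil mul0r (additive_zero Z_tri (filtration0 F)).
  by rewrite cr0.
have [c' [F' T Pa a0]] := filtration_rconsP F.
have [m m0 Za] := Z_pol Pa a0.
rewrite fm_rcons (crZ_tri _ T) /= mulrDl; apply: lerD.
  by apply: IH => // u us; apply: Hs; rewrite /unzip1 map_rcons mem_rcons in_cons us orbT.
rewrite Za normc_pol ?(ltW m0)// cr_pol ler_pM2l//.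
have -> : pi * (phi - (psi - 2^-1)) = pi * (phi - psi) + pi / 2 by lra.
rewrite sinDpihalf; apply: cos_pi_le => //; apply: Hs.
by rewrite /unzip1 map_rcons mem_rcons in_cons eqxx.
Qed.

Lemma mass_width psi (eta : R) c : eta <= 1 ->
  pin sg [set phi | `|phi - psi| <= eta] c -> mass sg c * cos (pi * eta) <= nc (Z c).
Proof.
move=> e1 Ic; have [c0|c0] := pselect (is_zero c).
  by rewrite mass_zero// mul0r (additive_zero Z_tri c0) ComplexField.Normc.normc0.
have [s HN] := P_HN sg c0; rewrite (massE HN).
apply: le_trans (le_trans (ler_norm _) (cr_le_normc _ (psi - 2^-1))).
apply: (filtration_width e1 (proj1 HN)) => u us.
have [phi [phi' [/= p1 p2 /andP[q1 q2]]]] := HN_pin_mem c0 HN Ic us.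
by move: p1 p2; rewrite !ler_norml => /andP[? ?] /andP[? ?]; apply/andP; split; lra.
Qed.

Lemma diff_filtration (W : C -> R[i]) (de : R) s c : tri_additive W ->
  (forall phi a, P phi a -> nc (W a - Z a) <= de * nc (Z a)) ->
  filtration P s c -> nc (W c - Z c) <= de * fm s.
Proof.
move=> WA Wd; elim/last_ind: s c => [|s [phi a] IH] c F.
  rewrite /filtration_mass big_nil mulr0 (additive_zero Z_tri (filtration0 F)).
  by rewrite (additive_zero WA (filtration0 F)) subrr ComplexField.Normc.normc0.
have [c' [F' T Pa a0]] := filtration_rconsP F.
rewrite fm_rcons (Z_tri T) (WA _ _ _ T) opprD addrACA mulrDr.
apply: le_trans (le_nc_add _ _) _; apply: lerD; [exact: IH|exact: Wd Pa].
Qed.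

End Mass.

(** * Two stability conditions with compatible hearts and close central charges *)

Section Comparison.
Variables (R : realType) (C : triangulated_category).
Variables (sg tau : stability_condition R C).
Implicit Types (x y z c a b E : C) (phi psi th u : R) (s : seq (R * C)).
Notation nc := (@ComplexField.Normc.normc R).
Variables (ep de : R).
Hypothesis ep_bounds : 0 < ep <= 8^-1.
Hypothesis de_le : de <= sin (pi * ep).
Hypothesis heart_close : forall (n : int) psi b, n%:~R < psi <= n%:~R + 1 ->
  P tau psi b -> pin sg [set phi | n%:~R <= phi <= n%:~R + 1] b.
Hypothesis Z_close : forall phi a, P sg phi a ->
  nc (Z tau a - Z sg a) <= de * nc (Z sg a).

Let W_tri := Z_tri tau.
Lemma sin_lower u : ep <= u <= 1 - ep -> sin (pi * ep) <= sin (pi * u).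
Proof.
move=> /andP[u0 u1]; have /andP[e0 e1] := ep_bounds.
have sc (v : R) : sin (pi * v) = cos (pi * (v - 2^-1)).
  by rewrite mulrBr cosBpihalf.
rewrite !sc -[X in cos X <= _]opprK cosN -mulrN; apply: cos_pi_le; last by lra.
by rewrite ler_norml; apply/andP; split; lra.
Qed.

(** The vector [Z sg a] has distance at least [sin (pi * ep)] times its modulus from the line of
    phase [th], and the perturbation is no larger, so [Z tau a] does not cross that line. *)
Lemma sector_le phi th a : P sg phi a -> ep <= th - phi <= 1 - ep ->
  cr (Z tau a) th <= 0.
Proof.
move=> Pa pt; have [a0|a0] := pselect (is_zero a).
  by rewrite (additive_zero W_tri a0) cr0.
have [m m0 Za] := Z_pol Pa a0.
have := Z_close Pa; rewrite Za normc_pol ?(ltW m0)// => dif.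
have := le_trans (ler_norm _) (le_trans (cr_le_normc _ th) dif).
rewrite crD crN cr_pol -[phi - th]opprB mulrN sinN.
have := sin_lower pt; move: de_le => dl sl.
have /(ler_wpM2l (ltW m0)) := le_trans dl sl; rewrite [m * de]mulrC; lra.
Qed.

Lemma sector_ge phi th a : P sg phi a -> ep <= phi - th <= 1 - ep ->
  0 <= cr (Z tau a) th.
Proof.
move=> Pa pt; have [a0|a0] := pselect (is_zero a).
  by rewrite (additive_zero W_tri a0) cr0.
have [m m0 Za] := Z_pol Pa a0.
have := Z_close Pa; rewrite Za normc_pol ?(ltW m0)// => dif.
have := le_trans (ler_norm _) (le_trans (cr_le_normc (- (Z tau a - pol m phi)) th) _).
rewrite (_ : nc (- (Z tau a - pol m phi)) = nc (Z tau a - pol m phi)); last first.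
  by case: (Z tau a - pol m phi) => p q /=; rewrite !sqrrN.
move=> /(_ _ dif); rewrite crN crD crN cr_pol.
have := sin_lower pt; move: de_le => dl sl.
have /(ler_wpM2l (ltW m0)) := le_trans dl sl; rewrite [m * de]mulrC; lra.
Qed.

Lemma sector_le_pin (I : set R) th b : pin sg I b ->
  (forall phi, I phi -> ep <= th - phi <= 1 - ep) -> cr (Z tau b) th <= 0.
Proof.
move=> Ib It; move: b Ib; apply: ext_closure_sub => [a [phi Ip Pa]|a a0|a b ab|a b c T] /=.
- exact: sector_le Pa (It _ Ip).
- by rewrite (additive_zero W_tri a0) cr0.
- by rewrite (additive_iso W_tri ab).
- by rewrite (W_tri T) crD => ? ?; rewrite -[0]addr0 lerD.
Qed.

Lemma sector_ge_pin (I : set R) th b : pin sg I b ->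
  (forall phi, I phi -> ep <= phi - th <= 1 - ep) -> 0 <= cr (Z tau b) th.
Proof.
move=> Ib It; move: b Ib; apply: ext_closure_sub => [a [phi Ip Pa]|a a0|a b ab|a b c T] /=.
- exact: sector_ge Pa (It _ Ip).
- by rewrite (additive_zero W_tri a0) cr0.
- by rewrite (additive_iso W_tri ab).
- by rewrite (W_tri T) crD => ? ?; rewrite addr_ge0.
Qed.

Lemma pin_tau_le (n : int) b : pin tau [set psi | psi <= n%:~R] b ->
  pin sg [set phi | phi <= n%:~R] b.
Proof.
move: b; apply: ext_closure_mono => a [psi /= pn Pa].
have fp := lvlP psi; apply: pin_sub (heart_close fp Pa) => phi /= /andP[_ p1].
have fn : lvl psi + 1 <= n.
  suff : lvl psi < n by lia.
  by rewrite -(ltr_int R); move: fp => /andP[? ?]; lra.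
by apply: le_trans p1 _; rewrite -intrD1 ler_int.
Qed.

Lemma pin_tau_gt (n : int) b : pin tau [set psi | n%:~R < psi] b ->
  pin sg [set phi | n%:~R <= phi] b.
Proof.
move: b; apply: ext_closure_mono => a [psi /= pn Pa].
have fp := lvlP psi; apply: pin_sub (heart_close fp Pa) => phi /= /andP[p1 _].
have fn : n <= lvl psi.
  suff : n < lvl psi + 1 by lia.
  by rewrite -(ltr_int R) intrD; move: fp => /andP[? ?]; lra.
by apply: le_trans p1; rewrite ler_int.
Qed.

(* If the first tau-factor b of E had phase > phi + 2 ep, then by vanishing of
   morphisms its sigma-phases would be at most phi, so that the central charge
   Z tau b would lie in a half plane excluding that phase. *)
Lemma tau_head_le phi E s : P sg phi E -> ~ is_zero E ->
  HN_filtration (P tau) s E -> head 0 (unzip1 s) <= phi + ep *+ 2.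
Proof.
move=> PE E0 HN; have [[psi b0] [s' es]] := HN_nonempty E0 HN; subst s => /=.
have [b [c' [f [g [h [/= Pb b_0 c'P T f0]]]]]] := HN_first HN.
have fp := lvlP psi; move: (lvl psi) fp => n /andP[n0 n1].
have bI := heart_close (introT andP (conj n0 n1)) Pb.
have np : n%:~R <= phi.
  rewrite leNgt; apply/negP => pn; apply: f0.
  apply: (hom_pin (sg := sg) (J := [set phi])) bI _ _; last exact: (pin_P (phi := phi)).
  by move=> v w /= /andP[nv _] ->; exact: lt_le_trans nv.
have c'I : pin sg [set v | v <= n%:~R + 1] c'.
  rewrite -intrD1; apply: pin_tau_le; apply: pin_sub c'P => v /= vp.
  by rewrite intrD1; apply: le_trans (ltW vp) n1.
have [s1 HN1] := P_HN sg b_0.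
have h1 : head 0 (unzip1 s1) <= phi.
  have [[ph a0] [s1' es1]] := HN_nonempty b_0 HN1; subst s1 => /=.
  have [a [d [f1 [g1 [h1 [/= Pa _ _ _ f10]]]]]] := HN_first HN1.
  rewrite leNgt; apply/negP => pp; apply: f10.
  (* A first sigma-factor [a] of [b] with phase above [phi] dies in [E], so its map to [b] comes
     from a map of [shift a] to [c']. This vanishes, as the sigma-phases of [c'] are at most
     [n + 1], hence at most [phi + 1]. *)
  have [v ve] := tri_ker3 T (P_hom Pa PE pp (f \oc f1)).
  apply: shiftm_inj; rewrite ve shiftm0 (_ : v = 0) ?comp0r//.
  apply: (hom_pin (sg := sg) (I := [set ph + 1])) _ c'I _.
    by move=> p q -> /= qn; move: np pp; lra.
  by apply: (@pin_P _ _ sg _ (ph + 1)) => //; apply/P_shiftE.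
have [l lI ll] := HN_last_ex b_0 HN1 bI.
have bI' : pin sg [set v | n%:~R <= v <= phi] b.
  apply: (filtration_pin (proj1 HN1)) => v vs /=.
  have /andP[v1 v2] := HN_mem HN1 vs.
  by move: lI => /= /andP[l1 _]; apply/andP; split; lra.
rewrite leNgt; apply/negP => big; have /andP[e0 e1] := ep_bounds.
(* The separating line has phase [phi + ep]. The phases in [n, phi] are at least [ep] below it, and
   at most [1 - ep] because phi + 2 ep < psi <= n + 1. *)
have : cr (Z tau b) (phi + ep) <= 0.
  apply: (sector_le_pin bI') => v /= /andP[v0 v1].
  by move: big n1; rewrite mulr2n => big n1; apply/andP; split; lra.
have [m m0 ->] := Z_pol Pb b_0.
rewrite cr_pol pmulr_rle0// leNgt => /negP; apply; apply: sin_pi_gt0.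
by move: big n0 n1; rewrite mulr2n => big n0 n1; apply/andP; split; lra.
Qed.

(** Dual to [tau_head_le]: the last tau-factor is a target of [E], its sigma-phases are at least
    [phi], and the separating line has phase [phi - ep]. *)
Lemma tau_last_ge phi E s : P sg phi E -> ~ is_zero E ->
  HN_filtration (P tau) s E -> phi - ep *+ 2 <= last 0 (unzip1 s).
Proof.
move=> PE E0 HN; have [u0 [s' es]] := HN_nonempty E0 HN.
move: HN; rewrite {}es lastI => HN; move: (belast _ _) (last _ _) HN => {s'}s' [psi b0] HN.
rewrite /unzip1 map_rcons last_rcons /=.
have [c' [b [f [g [h [/= Pb b_0 c'P T g0]]]]]] := HN_last HN.
have fp := lvlP psi; move: (lvl psi) fp => n /andP[n0 n1].
have bI := heart_close (introT andP (conj n0 n1)) Pb.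
have np : phi <= n%:~R + 1.
  rewrite leNgt; apply/negP => pn; apply: g0.
  apply: (hom_pin (sg := sg) (I := [set phi])) _ bI _; last exact: (pin_P (phi := phi)).
  by move=> v w -> /= /andP[_ nv]; exact: le_lt_trans pn.
have c'I : pin sg [set v | n%:~R <= v] c'.
  apply: pin_tau_gt; apply: pin_sub c'P => v /=; exact: lt_trans.
have [s1 HN1] := P_HN sg b_0.
have h1 : phi <= last 0 (unzip1 s1).
  have [u1 [s1' es1]] := HN_nonempty b_0 HN1; subst s1.
  move: HN1; rewrite lastI => HN1; move: (belast _ _) (last _ _) HN1 => {s1'}s1 [ph a0] HN1.
  rewrite /unzip1 map_rcons last_rcons /=.
  have [d [a [f1 [g1 [h1 [/= Pa _ _ _ g10]]]]]] := HN_last HN1.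
  rewrite leNgt; apply/negP => pp; apply: g10.
  have [v ->] := tri_coker2 T (P_hom PE Pa pp (g1 \oc g)).
  rewrite (_ : v = 0) ?comp0l//.
  apply: (hom_pin (sg := sg) (I := [set v | n%:~R <= v - 1]) (J := [set ph])).
  - by move=> p q /= pn ->; move: np pp; lra.
  - exact/(pin_shift sg [set v | n%:~R <= v]).
  - exact: (pin_P (phi := ph)).
have [l lI ll] := HN_head_ex b_0 HN1 bI.
have bI' : pin sg [set v | phi <= v <= n%:~R + 1] b.
  apply: (filtration_pin (proj1 HN1)) => v vs /=.
  have /andP[v1 v2] := HN_mem HN1 vs.
  by move: lI => /= /andP[_ l1]; apply/andP; split; lra.
rewrite leNgt; apply/negP => big; have /andP[e0 e1] := ep_bounds.
have : 0 <= cr (Z tau b) (phi - ep).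
  apply: (sector_ge_pin bI') => v /= /andP[v0 v1].
  by move: big n0; rewrite mulr2n => big n0; apply/andP; split; lra.
have [m m0 ->] := Z_pol Pb b_0.
rewrite cr_pol pmulr_rge0// leNgt => /negP; apply.
rewrite -oppr_gt0 -sinN -mulrN; apply: sin_pi_gt0.
by move: big n0 n1; rewrite mulr2n => big n0 n1; apply/andP; split; lra.
Qed.

Lemma P_sg_pin_tau phi E : P sg phi E -> pin tau [set v | `|v - phi| <= ep *+ 2] E.
Proof.
move=> PE; have [E0|E0] := pselect (is_zero E); first exact: ext_zero.
have [s HN] := P_HN tau E0; apply: (filtration_pin (proj1 HN)) => u us /=.
have /andP[u0 u1] := HN_mem HN us.
have := tau_head_le PE E0 HN; have := tau_last_ge PE E0 HN.
by move=> ? ?; rewrite ler_norml; apply/andP; split; lra.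
Qed.

(** In one direction [c] is built from sigma-factors, each with tau-phases within 2 [ep] of its own
    phase; in the other the first sigma-factor has a nonzero map to [c]. [lasts_close] is dual. *)
Lemma heads_close c s s' : ~ is_zero c -> HN_filtration (P sg) s c ->
  HN_filtration (P tau) s' c -> `|head 0 (unzip1 s) - head 0 (unzip1 s')| <= ep *+ 2.
Proof.
move=> c0 HN HN'; rewrite ler_norml; apply/andP; split.
  have cI : pin tau [set v | v <= head 0 (unzip1 s) + ep *+ 2] c.
    apply: filtration_ind (proj1 HN); [exact: ext_zero|exact: pin_ext|].
    move=> u us a /P_sg_pin_tau; apply: pin_sub => v /=.
    by have /andP[_ uh] := HN_mem HN us; rewrite ler_norml => /andP[_]; lra.
  by have [v /= v1 v2] := HN_head_ex c0 HN' cI; lra.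
have [[phi a0] [s1 es]] := HN_nonempty c0 HN; subst s => /=.
have [a [d [f [g [h [/= Pa _ _ _ f0]]]]]] := HN_first HN.
rewrite leNgt; apply/negP => big; apply: f0.
apply: (hom_pin (sg := tau) (J := [set v | v <= head 0 (unzip1 s')])) (P_sg_pin_tau Pa) _ _.
  by move=> v w /=; rewrite ler_norml => /andP[+ _]; lra.
by apply: (filtration_pin (proj1 HN')) => u /(HN_mem HN') /andP[].
Qed.

Lemma lasts_close c s s' : ~ is_zero c -> HN_filtration (P sg) s c ->
  HN_filtration (P tau) s' c -> `|last 0 (unzip1 s) - last 0 (unzip1 s')| <= ep *+ 2.
Proof.
move=> c0 HN HN'; rewrite ler_norml; apply/andP; split; last first.
  have cI : pin tau [set v | last 0 (unzip1 s) - ep *+ 2 <= v] c.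
    apply: filtration_ind (proj1 HN); [exact: ext_zero|exact: pin_ext|].
    move=> u us a /P_sg_pin_tau; apply: pin_sub => v /=.
    by have /andP[uh _] := HN_mem HN us; rewrite ler_norml => /andP[+ _]; lra.
  by have [v /= v1 v2] := HN_last_ex c0 HN' cI; lra.
have [u1 [s1 es]] := HN_nonempty c0 HN.
move: HN; rewrite {}es lastI => HN; move: (belast _ _) (last _ _) HN => {}s1 [phi a0] HN.
rewrite /unzip1 map_rcons last_rcons /=.
have [d [a [f [g [h [/= Pa _ _ _ g0]]]]]] := HN_last HN.
rewrite leNgt; apply/negP => big; apply: g0.
apply: (hom_pin (sg := tau) (I := [set v | last 0 (unzip1 s') <= v])) _ (P_sg_pin_tau Pa) _.
  by move=> w v /= wl; rewrite ler_norml => /andP[_]; move: big; rewrite /unzip1; lra.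
by apply: (filtration_pin (proj1 HN')) => u /(HN_mem HN') /andP[].
Qed.

(** The hypotheses are not symmetric in [sg] and [tau]; the reverse inclusion follows from the
    comparison of extreme phases at a tau-semistable object. *)
Lemma P_tau_pin_sg psi b : P tau psi b -> pin sg [set v | `|v - psi| <= ep *+ 2] b.
Proof.
move=> Pb; have [b0|b0] := pselect (is_zero b); first exact: ext_zero.
have [s HN] := P_HN sg b0; have HN' := HN_semistable Pb b0.
apply: (filtration_pin (proj1 HN)) => u us /=; have /andP[u0 u1] := HN_mem HN us.
have := heads_close b0 HN HN'; have := lasts_close b0 HN HN'.
rewrite /= !ler_norml => /andP[? ?] /andP[? ?]; apply/andP; split; lra.
Qed.

Lemma filtration_sum (Q : R -> set C) (f g : C -> R) s c : filtration Q s c ->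
  (forall phi a, Q phi a -> f a <= g a) -> \sum_(v <- s) f v.2 <= \sum_(v <- s) g v.2.
Proof.
move=> + fg; elim/last_ind: s c => [|s [phi a] IH] c F; first by rewrite !big_nil.
have [c' [F' _ Pa _]] := filtration_rconsP F.
by rewrite -cats1 !big_cat !big_seq1 /=; apply: lerD; [exact: IH F'|exact: fg Pa].
Qed.

Let eta_le1 : ep *+ 2 <= 1.
Proof. by have /andP[e0 e1] := ep_bounds; rewrite mulr2n; lra. Qed.

Lemma mass_tau_le c : 0 <= cos (pi * (ep *+ 2)) ->
  mass tau c * cos (pi * (ep *+ 2)) <= (1 + de) * mass sg c.
Proof.
move=> cp; have [s HN] := HN_exists sg c.
have := ler_wpM2r cp (mass_filtration tau (proj1 HN)).
move=> /le_trans; apply; rewrite (massE HN) /filtration_mass mulr_suml mulr_sumr.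
apply: (@filtration_sum _ (fun a => mass tau a * cos (pi * (ep *+ 2)))
  (fun a => (1 + de) * nc (Z sg a)) s c (proj1 HN)) => phi a Pa.
apply: le_trans (mass_width eta_le1 (P_sg_pin_tau Pa)) _.
rewrite mulrDl mul1r -{1}[Z tau a](subrK (Z sg a)) addrC.
by apply: le_trans (le_nc_add _ _) _; rewrite lerD2l; exact: Z_close Pa.
Qed.

(** For tau-semistable [b] the closeness of charges is known only through the sigma-factors of [b],
    which gives the error [de * mass sg b]. Moving it to the left side turns the cosine into
    [cos (pi * (ep *+ 2)) - de]. *)
Lemma mass_sg_le c : 0 <= cos (pi * (ep *+ 2)) - de ->
  mass sg c * (cos (pi * (ep *+ 2)) - de) <= mass tau c.
Proof.
move=> cp; have [s HN] := HN_exists tau c.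
have := ler_wpM2r cp (mass_filtration sg (proj1 HN)).
move=> /le_trans; apply; rewrite (massE HN) /filtration_mass mulr_suml.
apply: (@filtration_sum _ (fun b => mass sg b * (cos (pi * (ep *+ 2)) - de))
  (fun b => nc (Z tau b)) s c (proj1 HN)) => psi b Pb.
rewrite mulrBr lerBlDr; apply: le_trans (mass_width eta_le1 (P_tau_pin_sg Pb)) _.
rewrite -{1}[Z sg b](subrK (Z tau b)) addrC.
apply: le_trans (le_nc_add _ _) _; rewrite lerD2l.
have [s1 HN1] := HN_exists sg b.
rewrite -[nc (Z sg b - _)](_ : nc (Z tau b - Z sg b) = _); last first.
  by rewrite -opprB; case: (Z sg b - Z tau b) => p q /=; rewrite !sqrrN.
by rewrite (massE HN1) mulrC; exact: (diff_filtration W_tri Z_close (proj1 HN1)).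
Qed.

End Comparison.

Section Distance.
Variables (R : realType) (C : triangulated_category).
Implicit Types (sg tau : stability_condition R C).
Notation nc := (@ComplexField.Normc.normc R).

Lemma phi_plusP sg c : ~ is_zero c -> exists2 s, HN_filtration (P sg) s c &
  phi_plus sg c = head 0 (unzip1 s).
Proof.
move=> c0; have [s0 HN] := P_HN sg c0; rewrite /phi_plus; set X := (X in xget _ X).
by have : X (xget 0 X) by apply: xgetPex; exists (head 0 (unzip1 s0)), s0.
Qed.

Lemma phi_minusP sg c : ~ is_zero c -> exists2 s, HN_filtration (P sg) s c &
  phi_minus sg c = last 0 (unzip1 s).
Proof.
move=> c0; have [s0 HN] := P_HN sg c0; rewrite /phi_minus; set X := (X in xget _ X).
by have : X (xget 0 X) by apply: xgetPex; exists (last 0 (unzip1 s0)), s0.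
Qed.

Lemma ln_ratio (a b k : R) : 0 < a -> 0 < b -> a * expR (- k) <= b ->
  b * expR (- k) <= a -> `|ln (a / b)| <= k.
Proof.
have key (x y : R) : 0 < x -> 0 < y -> x * expR (- k) <= y -> ln (x / y) <= k.
  move=> x0 y0 xy; rewrite -[k]expRK ler_ln ?posrE ?divr_gt0 ?expR_gt0//.
  rewrite ler_pdivrMr// -(ler_pM2r (expR_gt0 (- k))) mulrAC -expRD subrr expR0 mul1r.
  exact: xy.
move=> a0 b0 ab ba; rewrite ler_norml key// andbT lerNl.
by rewrite -lnV ?posrE ?divr_gt0// invf_div; exact: key.
Qed.

(** The tolerance [de] depends on [k] alone, not on the two stability conditions, so it can be fixed
    before [tau] is constructed. *)
Lemma stab_dist_le (k : R) : 0 < k -> exists2 de : R, 0 < de & forall sg tau,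
  (forall (n : int) psi b, n%:~R < psi <= n%:~R + 1 -> P tau psi b ->
     pin sg [set phi | n%:~R <= phi <= n%:~R + 1] b) ->
  (forall phi a, P sg phi a -> nc (Z tau a - Z sg a) <= de * nc (Z sg a)) ->
  (stab_dist sg tau <= k%:E)%E.
Proof.
(* This makes [1 - io - io] equal to exp(-k). With both [de] and the defect of the cosine at most
   [io], the two mass estimates yield ratios at least exp(-k), by (1 + io)(1 - 2 io) <= 1 - io. *)
move=> k0; pose io := (1 - expR (- k)) / 2.
have ek : expR (- k) < 1 by rewrite -expR0 ltr_expR oppr_lt0.
have ek0 := expR_gt0 (- k).
have io0 : 0 < io by rewrite /io; lra.
have [d d0 cd] := cos_near0 io0; have p0 := @pi0 R.
have dp : 0 < d / pi by rewrite divr_gt0.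
(* The three bounds give phase differences at most [k], the range required of [ep], and a cosine
   above [1 - io]. *)
pose ep := Num.min (k / 2) (Num.min 8^-1 (d / pi / 4)).
have ep0 : 0 < ep by rewrite !lt_min; apply/and3P; split; lra.
have [e1 e2 e3] : [/\ ep <= k / 2, ep <= 8^-1 & ep <= d / pi / 4].
  by rewrite /ep !ge_min !lexx !orbT; split.
have sp : 0 < sin (pi * ep) by apply: sin_pi_gt0; apply/andP; split; lra.
exists (Num.min io (sin (pi * ep))); first by rewrite lt_min io0.
set de := Num.min _ _ => sg tau hc zc.
have de_le : de <= sin (pi * ep) by rewrite /de ge_min lexx orbT.
have de_io : de <= io by rewrite /de ge_min lexx.
have de0 : 0 < de by rewrite lt_min io0.
have epb : 0 < ep <= 8^-1 by rewrite ep0.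
have cosb : 1 - io < cos (pi * (ep *+ 2)).
  apply: cd; rewrite ger0_norm; last by rewrite mulr_ge0 ?ltW// mulrn_wgt0.
  have : ep *+ 2 < d / pi by rewrite mulr2n; lra.
  by rewrite ltr_pdivlMr// mulrC.
have ioE : 1 - io - io = expR (- k) by rewrite /io; lra.
apply: ge_ereal_sup => _ [c /= c0 <-]; rewrite lee_fin /stab_dist_at !ge_max.
have ek2 : ep *+ 2 <= k by rewrite mulr2n; lra.
apply/and3P; split.
- have [s HN ->] := phi_minusP sg c0; have [s' HN' ->] := phi_minusP tau c0.
  exact: le_trans (lasts_close epb de_le hc zc c0 HN HN') ek2.
- have [s HN ->] := phi_plusP sg c0; have [s' HN' ->] := phi_plusP tau c0.
  exact: le_trans (heads_close epb de_le hc zc c0 HN HN') ek2.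
- have ms := mass_gt0 sg c0; have mt := mass_gt0 tau c0.
  apply: ln_ratio => //.
    have /(_ c) := mass_sg_le epb de_le hc zc.
    move: (cos _) cosb => co cosb H; apply: le_trans (H _); last by lra.
    by apply: ler_wpM2l; [exact: ltW|lra].
  have /(_ c) := mass_tau_le epb de_le hc zc.
  move: (cos _) cosb => co cosb H; have {}H : mass tau c * co <= (1 + de) * mass sg c.
    by apply: H; lra.
  have H2 : mass tau c * (1 - io) <= (1 + io) * mass sg c.
    apply: le_trans (ler_wpM2l (ltW mt) (ltW cosb)) _; apply: le_trans H _.
    by apply: ler_wpM2r; [exact: ltW|lra].
  have io1 : 0 < 1 + io by lra.
  rewrite -(ler_pM2l io1); apply: le_trans H2.
  rewrite mulrCA; apply: ler_wpM2l; first exact: ltW.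
  by rewrite -ioE; nra.
Qed.

End Distance.

(** * The closure of the tilted chamber *)

Section Suspensions.
Variables (R : realType) (C : triangulated_category) (sg : stability_condition R C).
Notation nc := (@ComplexField.Normc.normc R).

Lemma P_susp phi (n : int) a : P sg phi a -> P sg (phi + n%:~R) (susp n a).
Proof.
move=> Pa; elim/translate_ind: n => [|n IH|n].
- by rewrite addr0.
- apply: (strict_P (isomorphic_sym (susp_succ n a))).
  by rewrite intrD addrA; apply/P_shiftE.
- by move=> /(strict_P (susp_succ n a)); rewrite intrD addrA => /P_shiftE.
Qed.

Lemma pin_susp (I : set R) (n : int) a : pin sg I a ->
  pin sg [set phi | I (phi - n%:~R)] (susp n a).
Proof.
move=> Ia; elim/translate_ind: n => [|n IH|n IH].
- by apply: pin_sub Ia => phi /=; rewrite subr0.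
- apply: (pin_iso (isomorphic_sym (susp_succ n a))).
  move/(pin_shift sg): IH; apply: pin_sub => phi /=.
  by rewrite intrD opprD addrA addrAC.
- apply/(pin_shift sg); move/(pin_iso (susp_succ n a)): IH.
  by apply: pin_sub => phi /=; rewrite intrD opprD addrA addrAC.
Qed.

Lemma nc_zsign (n : int) z : nc (zsign n z) = nc z.
Proof. by rewrite /zsign; case: (odd _) => //; case: z => a b /=; rewrite !sqrrN. Qed.

Lemma heart_of_P phi a : 0 < phi <= 1 -> P sg phi a -> heart_of sg a.
Proof. by move=> p01 Pa; apply: ext_gen; exists phi. Qed.

Definition upper (z : R[i]) := 0 < complex.Im z \/ (complex.Im z = 0 /\ complex.Re z < 0).

Lemma upperD z w : upper z -> upper w -> upper (z + w).
Proof.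
case: z w => [a b] [c d]; rewrite /upper /= => -[b0|[b0 a0]] [d0|[d0 c0]].
- by left; lra.
- by left; lra.
- by left; lra.
- by right; split; lra.
Qed.

Lemma heart_of_upper a : heart_of sg a -> ~ is_zero a -> upper (Z sg a).
Proof.
suff H : heart_of sg `<=` [set x | is_zero x \/ upper (Z sg x)] by move=> /H [].
apply: ext_closure_sub => [{}a [phi /andP[p0 p1] Pa]|{}a a0|{}a b ab|{}a b c T].
- have [a0|a0] := pselect (is_zero a); [by left|right].
  have [m m0 ->] := Z_pol Pa a0; rewrite /upper /pol /=.
  have [p1'|p1'] := ltP phi 1.
    by left; apply: mulr_gt0 => //; apply: sin_pi_gt0; rewrite p0.
  have -> : phi = 1 by apply/eqP; rewrite eq_le p1.
  by right; rewrite mulr1 sinpi cospi mulr0; split=> //; lra.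
- by left.
- move=> [a0|ua]; [left; exact: isomorphic_zero ab|right].
  by rewrite -(additive_iso (Z_tri sg) ab).
- rewrite /= (Z_tri sg T) => -[a0|ua] [c0|uc].
  + left; case: T => f [g [h T]]; apply: (isomorphic_zero a0).
    by exists f; exact: tri_zero_r T c0.
  + by right; rewrite (additive_zero (Z_tri sg) a0) add0r.
  + by right; rewrite (additive_zero (Z_tri sg) c0) addr0.
  + by right; exact: upperD.
Qed.

End Suspensions.

Section Reduction.
Variables (R : realType) (C : triangulated_category).
Variables (sg tau : stability_condition R C).
Notation nc := (@ComplexField.Normc.normc R).

(** The conditions of the comparison are invariant under the shift, so here and in [Z_close_reduce]
    they need checking only on a heart. *)
Lemma heart_close_reduce : heart_of tau `<=` pin sg [set phi | 0 <= phi <= 1] ->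
  forall (n : int) psi b, n%:~R < psi <= n%:~R + 1 -> P tau psi b ->
  pin sg [set phi | n%:~R <= phi <= n%:~R + 1] b.
Proof.
move=> Ht n psi b /andP[n0 n1] Pb.
have Pb0 : heart_of tau (susp (- n) b).
  apply: ext_gen; exists (psi - n%:~R); first by apply/andP; split; lra.
  by rewrite -mulrNz; exact: P_susp.
have := pin_susp n (Ht _ Pb0); move/(pin_iso (suspK n b)).
by apply: pin_sub => phi /= /andP[p0 p1]; apply/andP; split; lra.
Qed.

Lemma Z_close_reduce (de : R) :
  (forall a, heart_of sg a -> nc (Z tau a - Z sg a) <= de * nc (Z sg a)) ->
  forall phi a, P sg phi a -> nc (Z tau a - Z sg a) <= de * nc (Z sg a).
Proof.
move=> Hd phi a Pa; pose n := lvl phi; have /andP[n0 n1] := lvlP phi.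
have Ha : heart_of sg (susp (- n) a).
  apply: (heart_of_P (phi := phi - n%:~R)); first by apply/andP; split; rewrite /n; lra.
  by rewrite -mulrNz; exact: P_susp.
have := Hd _ Ha; rewrite !(additive_susp _ _ (Z_tri _)).
have -> : zsign (- n) (Z tau a) - zsign (- n) (Z sg a) = zsign (- n) (Z tau a - Z sg a).
  by rewrite /zsign; case: (odd _) => //; rewrite opprD.
by rewrite !nc_zsign.
Qed.

End Reduction.

(** * Hearts of finite length with finitely many simple objects *)

Section FiniteHeart.
Variables (R : realType) (C : triangulated_category).
Variables L Rr : int -> set C.
Hypothesis tf : t_family L Rr.
Notation H := (hrt L Rr 0).
Hypothesis flH : finite_length H.

Lemma additive_of_simples (V : zmodType) (w : C -> V) :
  (forall s s', simple H s -> isomorphic s s' -> w s = w s') ->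
  exists F : C -> V, tri_additive F /\ forall s, simple H s -> F s = w s.
Proof.
move=> w_iso; have [f [fA fs]] := jordan_hoelder tf flH w_iso.
have [F [FA Ff]] := additive_extension tf fA.
by exists F; split=> // s Ss; rewrite Ff ?fs//; case: Ss.
Qed.

Lemma length_function : exists ell : C -> int, [/\ tri_additive ell,
  forall s, simple H s -> ell s = 1, forall x, H x -> 0 <= ell x
  & forall x, H x -> ~ is_zero x -> 0 < ell x].
Proof.
have [|ell [ellA ell1]] := @additive_of_simples int (fun=> 1); first by [].
have ell_pos x : H x -> 0 <= ell x /\ (~ is_zero x -> 0 < ell x).
  move: x; apply: (length_ind tf flH) => [x x0|x y s Hx Hy Ss T [e0 _]].
    by rewrite (additive_zero ellA x0).
  by rewrite (ellA _ _ _ T) (ell1 _ Ss); split=> [|_]; lia.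
by exists ell; split=> // x /ell_pos [].
Qed.

Lemma finite_bound (n : nat) (Q : 'I_n -> R -> Prop) :
  (forall i, exists K, forall K', K <= K' -> Q i K') ->
  exists K, 1 <= K /\ forall i, Q i K.
Proof.
move=> HQ; suff [K [K1 KQ]] : exists K, 1 <= K /\ forall i, i \in enum 'I_n ->
    forall K', K <= K' -> Q i K'.
  by exists K; split=> // i; apply: KQ => //; rewrite mem_enum.
elim: (enum 'I_n) => [|i e [K [K1 KQ]]]; first by exists 1.
have [Ki Hi] := HQ i; exists (Num.max K Ki); split; first by rewrite le_max K1.
move=> j; rewrite in_cons => /orP[/eqP->|je] K'; rewrite ge_max => /andP[a b].
  exact: Hi.
exact: KQ.
Qed.

Hypothesis simples : finite_up_to_iso (simple H).

Lemma simple_bound (Q : C -> R -> Prop) :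
  (forall s s' K, isomorphic s s' -> Q s K -> Q s' K) ->
  (forall s, simple H s -> exists K, forall K', K <= K' -> Q s K') ->
  exists K, 1 <= K /\ forall s, simple H s -> Q s K.
Proof.
move=> Qi HQ; have [n [r Hr]] := simples.
have [|K [K1 KQ]] := @finite_bound n (fun i K => simple H (r i) -> Q (r i) K).
  move=> i; have [Si|nS] := pselect (simple H (r i)); last by exists 0.
  by have [K HK] := HQ _ Si; exists K => K' /HK.
exists K; split=> // s Ss; have [i si] := Hr s Ss.
apply: Qi (isomorphic_sym si) _; apply: KQ; exact: simple_strict si Ss.
Qed.

Lemma finite_values (V : zmodType) (W : C -> V) (ell : C -> int) (N : nat) :
  tri_additive W -> tri_additive ell -> (forall s, simple H s -> ell s = 1) ->
  (forall x, H x -> 0 <= ell x) ->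
  exists s : seq V, forall x, H x -> ell x <= N%:Z -> W x \in s.
Proof.
move=> WA ellA ell1 ell0; have [n [r Hr]] := simples.
pose Lst := fix Lst (N : nat) : seq V := if N is N'.+1 then
  0 :: [seq v + W (r i) | v <- Lst N', i <- enum 'I_n] else [:: 0].
exists (Lst N) => x Hx; move: x Hx N.
apply: (length_ind tf flH) => [x x0 N _|x y s Hx Hy Ss T IH [|N]].
- by rewrite (additive_zero WA x0); case: N => [|N] /=; rewrite in_cons eqxx.
- by rewrite (ellA _ _ _ T) (ell1 _ Ss); have := ell0 _ Hx; lia.
- rewrite (ellA _ _ _ T) (ell1 _ Ss) (WA _ _ _ T) => lN.
  rewrite /= in_cons; apply/orP; right; have [i si] := Hr s Ss.
  apply/allpairsP; exists (W x, i); rewrite mem_enum -(additive_iso WA si); split=> //.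
  by apply: IH; lia.
Qed.

(** Everything is checked on simple objects and propagated by length induction. Finitely many
    simples have phases bounded below by some [th0] = 1 / (K + 1) > 0; this cone condition is
    additive and gives local finiteness. *)
Lemma stab_of_heart (W : C -> R[i]) : tri_additive W ->
  (forall s, simple H s -> upper (W s)) ->
  exists tau : Stab R C, [/\ Z tau = W, heart_of tau = H &
    forall s phi m, simple H s -> 0 < phi <= 1 -> 0 < m -> W s = pol m phi -> P tau phi s].
Proof.
move=> WA Wu; have [ell [ellA ell1 ell0 ellp]] := length_function.
have Wup x : H x -> ~ is_zero x -> upper (W x).
  move=> Hx x0; suff : is_zero x \/ upper (W x) by case.
  move: x Hx {x0}; apply: (length_ind tf flH) => [x|x y s Hx Hy Ss T ux]; first by left.
  right; rewrite (WA _ _ _ T); case: ux => [x0|ux].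
    by rewrite (additive_zero WA x0) add0r; exact: Wu.
  by apply: upperD => //; exact: Wu.
have Wfin N := finite_values N WA ellA ell1 ell0.
have [th0 [th01 thc]] : exists th0 : R, 0 < th0 < 1 /\
    forall x, H x -> 0 <= cr (W x) th0.
  have [||K [K1 KQ]] := @simple_bound (fun s K => 0 <= cr (W s) (K + 1)^-1).
  - by move=> s s' K ss; rewrite (additive_iso WA ss).
  - move=> s Ss; have [psi [m [/andP[p0 p1] m0 Ws]]] := polar_exists (Wu s Ss).
    exists psi^-1 => K' pK; rewrite Ws cr_pol; apply: mulr_ge0; first exact: ltW.
    have i0 : 0 < psi^-1 by rewrite invr_gt0.
    have K0 : 0 < K' + 1 by lra.
    have : (K' + 1)^-1 <= psi by rewrite invf_ple ?posrE//; apply: le_trans pK _; lra.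
    have : 0 < (K' + 1)^-1 by rewrite invr_gt0.
    by move=> ? ?; apply: sin_pi_ge0; apply/andP; split; lra.
  have K0 : 0 < K + 1 by lra.
  exists (K + 1)^-1; split; first by rewrite invr_gt0 K0 invf_lt1//; lra.
  apply: (length_ind tf flH) => [x x0|x y s Hx Hy Ss T cx].
    by rewrite (additive_zero WA x0) cr0.
  by rewrite (WA _ _ _ T) crD addr_ge0// KQ.
exists (MkStab (stability_locally_finite tf WA ellA Wup ellp Wfin th01 thc)).
split=> //=; first exact: heart_of_stability.
by move=> s phi m Ss p01 m0 Ws; exact: (simple_semistable tf WA ellA Wup ellp Wfin Ss p01 m0 Ws).
Qed.

End FiniteHeart.

Section ClosureOfTilt.
Variables (R : realType) (C : triangulated_category).
Variables (L Rr : int -> set C) (T : set C).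
Hypothesis tf : t_family L Rr.
Notation A := (hrt L Rr 0).
Notation B := (left_tilt A T).
Notation nc := (@ComplexField.Normc.normc R).
Hypothesis TT : torsion_tri A T.
Hypothesis flA : finite_length A.
Hypothesis simplesA : finite_up_to_iso (simple A).
Hypothesis flB : finite_length B.
Hypothesis simplesB : finite_up_to_iso (simple B).

Lemma le_nc_ReIm (K : R) (z : R[i]) : 0 <= K ->
  K * complex.Im z - complex.Re z <= (K + 1) * nc z.
Proof.
move=> K0; have Im_le : `|complex.Im z| <= nc z.
  by have := cr_le_normc z 0; rewrite /cr mulr0 cos0 sin0 mulr1 mulr0 subr0.
have Re_le : `|complex.Re z| <= nc z.
  have := cr_le_normc z 2^-1.
  by rewrite /cr cos_pihalf sin_pihalf mulr0 mulr1 sub0r normrN.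
rewrite mulrDl mul1r; apply: lerD.
  by apply: ler_wpM2l => //; exact: le_trans (ler_norm _) Im_le.
by rewrite -normrN in Re_le; exact: le_trans (ler_norm _) Re_le.
Qed.

(* An integral additive function is bounded on the heart by the modulus of a
   central charge, since both are controlled by their values at the simples. *)
Lemma additive_bounded (sg : stability_condition R C) (ell : C -> int) :
  heart_of sg = A -> tri_additive ell ->
  exists K : R, 0 < K /\ forall a, A a -> `|(ell a)%:~R| <= K * nc (Z sg a).
Proof.
move=> hA ellA; have Zt := Z_tri sg.
(* A real linear functional which, for large [K], is positive on the charges of the finitely many
   simples; being additive, it can be followed along composition series. *)
pose lam (K : R) (z : R[i]) := K * complex.Im z - complex.Re z.
have lamD K z w : lam K (z + w) = lam K z + lam K w.
  by case: z w => [a b] [c d]; rewrite /lam /=; ring.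
have [||K [K1 KQ]] := @simple_bound R _ _ _ tf simplesA
    (fun s K => `|(ell s)%:~R| <= K * lam K (Z sg s)).
- by move=> s s' K ss; rewrite (additive_iso Zt ss) (additive_iso ellA ss).
- move=> s Ss; have [As s0 _] := Ss.
  rewrite -hA in As; move: (heart_of_upper As s0); case: (Z sg s) => a b.
  rewrite /upper /lam /= => -[b0|[-> a0]]; set l := `|_|.
    have l0 : 0 <= l by exact: normr_ge0.
    (* For such [K'] one has K' b - a >= 1, and K' itself is at least [l]. *)
    exists (Num.max 1 (Num.max l ((1 + a) / b))) => K'; rewrite !ge_max.
    move=> /and3P[K1 lK]; rewrite ler_pdivrMr// => aK.
    apply: le_trans lK _; rewrite -[leLHS]mulr1; apply: ler_wpM2l; lra.
  exists (l / - a) => K'; rewrite ler_pdivrMr ?oppr_gt0// => lK.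
  by rewrite mulr0 sub0r.
exists (K * (K + 1)); split; first by apply: mulr_gt0; lra.
have key a : A a -> `|(ell a)%:~R| <= K * lam K (Z sg a).
  move: a; apply: (length_ind tf flA) => [x x0|x y s Ax Ay Ss Tr IH].
    rewrite (additive_zero ellA x0) (additive_zero Zt x0) normr0 /lam /=.
    by rewrite mulr0 subr0 mulr0.
  rewrite (ellA _ _ _ Tr) (Zt _ _ _ Tr) lamD mulrDr intrD.
  apply: le_trans (ler_normD _ _) _; apply: lerD => //; exact: KQ.
move=> a /key /le_trans; apply; rewrite -mulrA; apply: ler_wpM2l; first lra.
by apply: le_nc_ReIm; lra.
Qed.

Lemma closure_left_tilt (sg : Stab R C) : heart_of sg = A -> T `<=` pin sg [set 1] ->
  closure (U R B) sg.
Proof.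
move=> hA TP V /nbhs_ballP [e /= e0 eV].
have Bhrt := left_tilt_hrt tf TT; have tfB := tilt_family tf TT.
have := flB; have := simplesB; rewrite Bhrt => simplesB' flB'.
have [ell [ellA ell1 ell0 ellp]] := length_function tfB flB'.
have [K [K0 KA]] := additive_bounded hA ellA.
(* Half the radius, because [stab_dist_le] gives a weak inequality and the ball asks for a strict
   one. *)
have [de de0 dist] := stab_dist_le C (divr_gt0 e0 (ltr0Sn R 1)).
(* With this scale the perturbation [ep * ell a] is at most [de] times the modulus of [Z sg a] on
   [A]. *)
pose ep := de / K; have ep0 : 0 < ep by rewrite divr_gt0.
pose W c := Z sg c + (0 +i* (ep * (ell c)%:~R))%C.
have WA : tri_additive W.
  move=> x y z Tr; rewrite /W (Z_tri sg Tr) (ellA _ _ _ Tr) intrD mulrDr.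
  by case: (Z sg x) (Z sg z) => [a b] [c d]; apply/eqP; rewrite eq_complex /=; apply/andP;
    split; apply/eqP; ring.
have Bpin : B `<=` pin sg [set phi | 0 <= phi <= 1].
  apply: ext_closure_mono => x [[Ax _]|Tx].
    move: Ax; rewrite -hA; apply: pin_sub => phi /= /andP[p0 p1].
    by rewrite (ltW p0).
  suff : pin sg [set 0] x by apply: pin_sub => phi ->; rewrite /= lexx ler01.
  apply/(pin_shift sg [set 0]); apply: pin_sub (TP _ Tx) => phi -> /=.
  by rewrite subrr.
have ImB x : B x -> 0 <= complex.Im (Z sg x).
  move=> /Bpin; move: x; apply: ext_closure_sub => [x [phi /= p01 Px]|x x0|x y xy|x y z Tr] /=.
  - have [x0|x0] := pselect (is_zero x); first by rewrite (additive_zero (Z_tri sg) x0).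
    have [m m0 ->] := Z_pol Px x0.
    by rewrite /pol /=; apply: mulr_ge0; [exact: ltW|exact: sin_pi_ge0].
  - by rewrite (additive_zero (Z_tri sg) x0).
  - by rewrite (additive_iso (Z_tri sg) xy).
  - rewrite (Z_tri sg Tr); case: (Z sg x) (Z sg z) => [a b] [c d] /=; exact: addr_ge0.
have [s Ss|tau [Ztau htau _]] := stab_of_heart tfB flB' simplesB' WA.
  left; have [Bs _ _] := Ss; rewrite -Bhrt in Bs; have := ImB _ Bs.
  by rewrite /W; case: (Z sg s) => a b /= b0; rewrite (ell1 _ Ss) mulr1; lra.
exists tau; split; first exact: htau.
apply: eV; rewrite /ball /= /stab_ball /=.
apply: (@le_lt_trans _ _ (e / 2)%:E); last by rewrite lte_fin; lra.
apply: dist; first by apply: heart_close_reduce; rewrite htau -Bhrt.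
apply: Z_close_reduce => a; rewrite hA => Aa; rewrite Ztau /W addrC addKr.
have -> : nc (0 +i* (ep * (ell a)%:~R))%C = ep * `|(ell a)%:~R|.
  by rewrite /= expr0n /= add0r sqrtr_sqr normrM ger0_norm// ltW.
rewrite /ep -mulrA [K^-1 * _]mulrC mulrA ler_pdivrMr// -mulrA.
apply: ler_wpM2l; first exact: ltW.
by rewrite [_ * K]mulrC; exact: KA.
Qed.

End ClosureOfTilt.

(** * A copy of R^k inside the stratum *)

Section Chart.
Variables (R : realType) (C : triangulated_category).
Variables (L Rr : int -> set C).
Hypothesis tf : t_family L Rr.
Notation A := (hrt L Rr 0).
Notation nc := (@ComplexField.Normc.normc R).
Hypothesis flA : finite_length A.
Hypothesis simplesA : finite_up_to_iso (simple A).
Variables (k : nat) (s : 'I_k -> C).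
Hypothesis simple_s : forall i, simple A (s i).
Hypothesis distinct_s : forall i j, isomorphic (s i) (s j) -> i = j.

(** Only the values at simple objects of [A] matter; [additive_of_simples] extends them to an
    additive function. *)
Definition chart_charge (x : 'rV[R]_k) (a : C) : R[i] :=
  if pselect (exists i, isomorphic a (s i)) is left H
  then (- expR (x ord0 (sval (cid H))) +i* 0)%C else (0 +i* 1)%C.

Lemma chart_charge_s x a i : isomorphic a (s i) ->
  chart_charge x a = (- expR (x ord0 i) +i* 0)%C.
Proof.
move=> ai; rewrite /chart_charge; case: pselect => [H|[]]; last by exists i.
suff -> : sval (cid H) = i by [].
apply: distinct_s; apply: isomorphic_trans ai.
exact: isomorphic_sym (svalP (cid H)).
Qed.

Lemma chart_charge_other x a : (forall i, ~ isomorphic a (s i)) ->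
  chart_charge x a = (0 +i* 1)%C.
Proof. by move=> na; rewrite /chart_charge; case: pselect => // H; case: (na _ (svalP (cid H))). Qed.

Lemma chart_charge_iso x a b : isomorphic a b -> chart_charge x a = chart_charge x b.
Proof.
move=> ab; have [[i bi]|nb] := pselect (exists i, isomorphic b (s i)).
  by rewrite !(@chart_charge_s x _ i)//; exact: isomorphic_trans bi.
rewrite !chart_charge_other// => i ai; apply: nb; exists i => //.
exact: isomorphic_trans (isomorphic_sym ab) ai.
Qed.

Lemma chart_exists (x : 'rV[R]_k) : exists tau : Stab R C,
  [/\ S_ R A s tau, forall a, simple A a -> Z tau a = chart_charge x a
    & forall i, P tau 1 (s i)].
Proof.
have [|W [WA Ws]] := additive_of_simples tf flA (w := chart_charge x).
  by move=> a b _; exact: chart_charge_iso.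
have [a Sa|tau [Zt ht Pt]] := stab_of_heart tf flA simplesA WA.
  rewrite Ws//; have [[i ai]|na] := pselect (exists i, isomorphic a (s i)).
    rewrite (chart_charge_s x ai); right; split=> //=.
    by rewrite oppr_lt0 expR_gt0.
  rewrite chart_charge_other; first by left => /=.
  by move=> i ai; apply: na; exists i.
have Ps i : P tau 1 (s i).
  apply: (Pt _ _ (expR (x ord0 i))) => //; [by rewrite ltr01 lexx|exact: expR_gt0|].
  rewrite Ws// (chart_charge_s x (isomorphic_refl _)) /pol mulr1 cospi sinpi.
  by rewrite mulr0 mulrN1.
exists tau; split=> //; last by move=> a Sa; rewrite Zt Ws.
split; first exact: ht.
split=> // a Sa na; exists 2^-1; first by apply/andP; split; lra.
apply: (Pt _ _ 1) => //; first by apply/andP; split; lra.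
by rewrite Ws// chart_charge_other// /pol cos_pihalf sin_pihalf mulr0 mulr1.
Qed.

Definition chart (x : 'rV[R]_k) : Stab R C := sval (cid (chart_exists x)).

Lemma chartP x : [/\ S_ R A s (chart x),
  forall a, simple A a -> Z (chart x) a = chart_charge x a
  & forall i, P (chart x) 1 (s i)].
Proof. exact: svalP (cid (chart_exists x)). Qed.

Lemma chart_heart x : heart_of (chart x) = A.
Proof. by have [[]] := chartP x. Qed.

Lemma chart_mass x i : mass (chart x) (s i) = expR (x ord0 i).
Proof.
have [_ Zs Ps] := chartP x; rewrite (mass_semistable (Ps i)) Zs//.
rewrite (chart_charge_s x (isomorphic_refl _)) /= expr0n /= addr0 sqrtr_sqr normrN.
by rewrite ger0_norm// expR_ge0.
Qed.

(** The logarithm of the mass ratio at [s i] is exactly [x_i - y_i]. Since the chart does not shrink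
    distances, its inverse on the image is continuous. *)
Lemma chart_expanding (x y : 'rV[R]_k) i :
  (`|x ord0 i - y ord0 i|%:E <= stab_dist (chart x) (chart y))%E.
Proof.
apply: (@le_trans _ _ (stab_dist_at (chart x) (chart y) (s i))%:E); last first.
  by apply: ereal_sup_ubound; exists (s i) => //=; case: (simple_s i).
rewrite lee_fin /stab_dist_at !chart_mass -expRN -expRD expRK.
by rewrite !le_max lexx !orbT.
Qed.

(** The two charges have the same imaginary part on [A], and the difference of their real parts is
    bounded by [de] times [- Re], which is additive along composition series and at most the
    modulus. *)
Lemma chart_close (x y : 'rV[R]_k) (de : R) :
  (forall i, `|expR (y ord0 i) - expR (x ord0 i)| <= de * expR (x ord0 i)) ->
  0 <= de -> forall a, A a ->
  nc (Z (chart y) a - Z (chart x) a) <= de * nc (Z (chart x) a).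
Proof.
move=> dxy de0 a Aa; have [_ Zx _] := chartP x; have [_ Zy _] := chartP y.
have Wx := Z_tri (chart x); have Wy := Z_tri (chart y).
have [e1 e2] : complex.Im (Z (chart y) a) = complex.Im (Z (chart x) a) /\
    `|complex.Re (Z (chart y) a) - complex.Re (Z (chart x) a)| <=
      de * - complex.Re (Z (chart x) a).
  move: a Aa; apply: (length_ind tf flA) => [b b0|b c t Ab Ac St Tr [i1 i2]].
    by rewrite (additive_zero Wx b0) (additive_zero Wy b0) /= subrr normr0 oppr0 mulr0.
  rewrite (Wx _ _ _ Tr) (Wy _ _ _ Tr) (Zx _ St) (Zy _ St).
  case: (Z (chart x) b) (Z (chart y) b) i1 i2 => [p q] [p' q'] /= -> i2.
  have [[i ti]|nt] := pselect (exists i, isomorphic t (s i)).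
    rewrite !(chart_charge_s _ ti) /=; split=> //.
    have -> : p' + - expR (y ord0 i) - (p + - expR (x ord0 i)) =
      (p' - p) - (expR (y ord0 i) - expR (x ord0 i)) by ring.
    apply: le_trans (ler_normB _ _) _; rewrite opprD opprK mulrDr.
    exact: lerD.
  rewrite !chart_charge_other; last 2 first.
  - by move=> i ti; apply: nt; exists i.
  - by move=> i ti; apply: nt; exists i.
  by rewrite /= !addr0.
have -> : nc (Z (chart y) a - Z (chart x) a) =
    `|complex.Re (Z (chart y) a) - complex.Re (Z (chart x) a)|.
  move: e1; case: (Z (chart y) a) (Z (chart x) a) => [p q] [p' q'] /= ->.
  by rewrite subrr expr0n /= addr0 sqrtr_sqr.
apply: le_trans e2 _; apply: ler_wpM2l => //.
have := le_nc_ReIm (Z (chart x) a) (lexx (0 : R)).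
by rewrite mul0r sub0r add0r mul1r.
Qed.

Lemma chart_continuous : continuous chart.
Proof.
move=> x V /nbhs_ballP [e /= e0 eV].
have [de de0 dist] := stab_dist_le C (divr_gt0 e0 (ltr0Sn R 1)).
have [d d0 dP] : exists2 d : R, 0 < d & forall u : R, `|u| < d -> `|expR u - 1| <= de.
  have : expR u @[u --> (0 : R)] --> expR (0 : R) by exact: continuous_expR.
  rewrite expR0 => /cvgrPdist_lt /(_ de de0) /nbhs_ballP [d /= d0 H]; exists d => // u ud.
  by rewrite distrC ltW//; apply: H; rewrite /ball /= sub0r normrN.
apply/nbhs_ballP; exists d => //= y xy; apply: eV.
rewrite /ball /= /stab_ball /=.
apply: (@le_lt_trans _ _ (e / 2)%:E); last by rewrite lte_fin; lra.
apply: dist.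
  apply: heart_close_reduce; rewrite chart_heart -(chart_heart x).
  by apply: pin_sub => phi /= /andP[p0 p1]; rewrite (ltW p0).
apply: Z_close_reduce => a; rewrite chart_heart => Aa.
apply: chart_close => // [i|]; last exact: ltW.
have ex := expR_gt0 (x ord0 i).
have -> : expR (y ord0 i) - expR (x ord0 i) =
    (expR (y ord0 i - x ord0 i) - 1) * expR (x ord0 i).
  by rewrite mulrBl mul1r -expRD subrK.
rewrite normrM (ger0_norm (ltW ex)); apply: ler_wpM2r; first exact: ltW.
by apply: dP; rewrite distrC; exact: (proj2 xy ord0 i).
Qed.

Lemma chart_embedding : embedding chart.
Proof.
split; last 2 first.
- exact: chart_continuous.
- move=> V oV.
  (* Around each image point the ball has the radius of a ball inside [V]; by [chart_expanding] no
     point outside [V] is mapped into it. *)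
  pose W := \bigcup_(p in [set p : 'rV[R]_k * R | ball p.1 p.2 `<=` V /\ 0 < p.2])
    interior (ball (chart p.1) p.2).
  exists W; first by apply: bigcup_open => p _; exact: open_interior.
  apply/seteqP; split=> [y [[x r] /= [xV r0]] /interior_subset yx|y Vy].
    apply: xV; split=> // i j; rewrite (ord1 i) /ball /= -lte_fin.
    apply: le_lt_trans (chart_expanding x y j) _; exact: yx.
  have /nbhs_ballP [r /= r0 rV] : nbhs y V by exact: open_nbhs_nbhs.
  exists (y, r) => //=; exact: nbhsx_ballx.
- move=> x y xy; apply/rowP => i.
  by apply: expR_inj; rewrite -!chart_mass xy.
Qed.

End Chart.

Theorem corollary2p12 (R : realType) (C : triangulated_category)
    (A T : set C) (k : nat) (s : 'I_k -> C)
    (heartA : is_heart A)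
    (tiltsA : forall B : set C, simple_tilts A B ->
      finite_length B /\ finite_up_to_iso (simple B))
    (simple_s : forall i, simple A (s i))
    (distinct_s : forall i j, isomorphic (s i) (s j) -> i = j)
    (torsionT : torsion_theory A T)
    (T_sub : T `<=` ext_closure (range s))
    (T_indec : finite_up_to_iso (indecomposable A `&` T)) :
  S_ R A s `<=` U R A `&` closure (U R (left_tilt A T)) /\
  (k%:R%:E <= dim_real R (U R A `&` closure (U R (left_tilt A T))))%E.
Proof.
have [L [Rr [tf AE]]] := is_heart_family heartA; subst A.
have TT := torsion_theory_tri tf torsionT.
have [flA simplesA] := tiltsA _ (simple_tilts0 _).
have tiltT : simple_tilts (hrt L Rr 0) (left_tilt (hrt L Rr 0) T).
  have [n [r Hr]] := T_indec.
  apply: (left_tilt_simple_tilts _ (simple_tilts0 _) tf erefl TT).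
    by move=> B /tiltsA [].
  by move=> x Ix Tx; apply: Hr; split.
have [flB simplesB] := tiltsA _ tiltT.
have part1 : S_ R (hrt L Rr 0) s `<=`
    U R (hrt L Rr 0) `&` closure (U R (left_tilt (hrt L Rr 0) T)).
  move=> sg [hA [Ps _]]; split=> //.
  (* As the [s i] have phase 1 and generate a subcategory containing [T], all of [T] lies in
     P(1). *)
  apply: (closure_left_tilt tf) => // x /T_sub.
  by apply: ext_closure_mono => {}x [i _ <-]; apply: (pin_P (phi := 1)).
split=> //; apply: ereal_sup_ubound; exists k => //.
exists (chart tf flA simplesA simple_s distinct_s); split.
  exact: chart_embedding.
by move=> _ [x _ <-]; apply: part1; have [] := chartP tf flA simplesA simple_s distinct_s x.
Qed.
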